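(* Let $L>0$ and suppose $g(x,y)=g(x)$ for some $g\in L^2(0,L;\mathbb{C})$. Then the control system $$u_t(t,x)-u_x(t,x)=\int_0^L g(x)u(t,y)\,dy,\quad u(t,L)=U(t),\quad u(0,x)=u^0(x)$$ is exactly controllable at time $L$ if and only if $\ker(\lambda-A^* )\cap\ker B^*=\{0\}$ for every $\lambda\in\mathbb{C}$.
   Context: For $T>0$, $u^0\in L^2(0,L)$, $U\in L^2(0,T)$, the (weak) solution is the unique $u\in C^0([0,T];L^2(0,L))$ such that for every $\tau\in[0,T]$ and every $\phi\in C^1([0,\tau]\times[0,L])$ with $\phi(\cdot,0)=0$, $$\int_0^\tau\!\!\int_0^L u\,\overline{\Big(-\phi_t+\phi_x-\int_0^L\overline{g(y)}\phi(t,y)dy\Big)}\,dx\,dt+\int_0^L u(\tau)\overline{\phi(\tau)}dx-\int_0^L u^0\overline{\phi(0)}dx-\int_0^\tau U(t)\overline{\phi(t,L)}dt=0.$$ Exact controllability at time $T$: for all $u^0,u^1\in L^2(0,L)$ there is $U\in L^2(0,T)$ with $u(T)=u^1$. $A^*$ is the operator on $L^2(0,L)$ with domain $D(A^* )=\{z\in H^1(0,L): z(0)=0\}$ and $A^*z(x)=-z'(x)+\int_0^L\overline{g(y)}z(y)\,dy$; $B^*:D(A^* )\to\mathbb{C}$ is $B^*z=z(L)$. *)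

(* Defs.v *)
From HB Require Import structures.
From mathcomp Require Import all_boot all_order all_algebra.
From mathcomp Require Import all_classical all_reals all_analysis.
From mathcomp Require Import complex.
Set Implicit Arguments. Unset Strict Implicit. Unset Printing Implicit Defensive.
Import Order.TTheory GRing.Theory Num.Theory.
Local Open Scope ring_scope.
Local Open Scope classical_set_scope.

Import numFieldNormedType.Exports.
Section Defs.
Context {R : realType}.
Local Notation C := (R[i]).
Local Notation mu := (@lebesgue_measure R).

Definition cre (z : C) : R := complex.Re z.
Definition cim (z : C) : R := complex.Im z.
Definition cmk (a b : R) : C := complex.Complex a b.
Definition cconj (z : C) : C := complex.conjc z.
Definition cabs2 (z : C) : R := cre z ^+ 2 + cim z ^+ 2.

Definition cint (D : set R) (f : R -> C) : C :=
  cmk (Rintegral mu D (fun x => cre (f x))) (Rintegral mu D (fun x => cim (f x))).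

Definition cL2 (a b : R) (f : R -> C) : Prop :=
  measurable_fun `[a, b] (fun x => cre (f x)) /\
  measurable_fun `[a, b] (fun x => cim (f x)) /\
  mu.-integrable `[a, b] (fun x => (cabs2 (f x))%:E).

Definition L2cont (L T : R) (u : R -> R -> C) : Prop :=
  (forall t, 0 <= t <= T -> cL2 0 L (u t)) /\
  (forall t, 0 <= t <= T -> forall e : R, 0 < e -> exists2 d : R, 0 < d &
     forall s, 0 <= s <= T -> `|s - t| < d ->
       Rintegral mu `[0, L] (fun x => cabs2 (u s x - u t x)) < e).

Definition pt (phi : R -> R -> C) (t x : R) : C :=
  cmk (derive1 (fun s => cre (phi s x)) t) (derive1 (fun s => cim (phi s x)) t).
Definition px (phi : R -> R -> C) (t x : R) : C :=
  cmk (derive1 (fun y => cre (phi t y)) x) (derive1 (fun y => cim (phi t y)) x).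

Definition C1fun (phi : R -> R -> C) : Prop :=
  (forall t x, derivable (fun s => cre (phi s x)) t 1 /\
               derivable (fun s => cim (phi s x)) t 1 /\
               derivable (fun y => cre (phi t y)) x 1 /\
               derivable (fun y => cim (phi t y)) x 1) /\
  continuous (fun p : R * R => cre (phi p.1 p.2)) /\
  continuous (fun p : R * R => cim (phi p.1 p.2)) /\
  continuous (fun p : R * R => cre (pt phi p.1 p.2)) /\
  continuous (fun p : R * R => cim (pt phi p.1 p.2)) /\
  continuous (fun p : R * R => cre (px phi p.1 p.2)) /\
  continuous (fun p : R * R => cim (px phi p.1 p.2)).

(* weak solution of u_t - u_x = g(x) \int_0^L u(t,y) dy, u(t,L) = U(t),
   u(0,.) = u0, on [0,T] x [0,L] *)
Definition weak_solution (L T : R) (g u0 U : R -> C) (u : R -> R -> C) : Prop :=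
  L2cont L T u /\
  forall tau, 0 <= tau <= T -> forall phi, C1fun phi ->
    (forall t, 0 <= t <= tau -> phi t 0 = 0) ->
    cint `[0, tau] (fun t => cint `[0, L] (fun x =>
        u t x * cconj (- pt phi t x + px phi t x
                       - cint `[0, L] (fun y => cconj (g y) * phi t y))))
    + cint `[0, L] (fun x => u tau x * cconj (phi tau x))
    - cint `[0, L] (fun x => u0 x * cconj (phi 0 x))
    - cint `[0, tau] (fun t => U t * cconj (phi t L)) = 0.

Definition exactly_controllable (L T : R) (g : R -> C) : Prop :=
  forall u0 u1, cL2 0 L u0 -> cL2 0 L u1 ->
    exists U, cL2 0 T U /\
      (exists u, weak_solution L T g u0 U u) /\
      (forall u, weak_solution L T g u0 U u ->
         {ae mu, forall x, `[0, L] x -> u T x = u1 x}).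

(* Astar_graph L g z v : z \in D(A^* ) = {z \in H^1(0,L) : z(0) = 0}
   (z given by its absolutely continuous representative z = z(0) + \int_0^x z')
   and A^* z = v in L^2(0,L), where A^* z = - z' + \int_0^L conj(g y) z(y) dy *)
Definition Astar_graph (L : R) (g z v : R -> C) : Prop :=
  exists w : R -> C, cL2 0 L w /\
    (forall x, 0 <= x <= L -> z x = z 0 + cint `[0, x] w) /\
    z 0 = 0 /\
    {ae mu, forall x, `[0, L] x ->
       v x = - w x + cint `[0, L] (fun y => cconj (g y) * z y)}.

Definition Bstar (L : R) (z : R -> C) : C := z L.

Definition unique_continuation (L : R) (g : R -> C) (lam : C) : Prop :=
  forall z, Astar_graph L g z (fun x => lam * z x) -> Bstar L z = 0 ->
    {ae mu, forall x, `[0, L] x -> z x = 0}.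

End Defs.

(* Main.v *)
Require Import Defs.
From HB Require Import structures.
From mathcomp Require Import all_boot all_order all_algebra.
From mathcomp Require Import all_classical all_reals all_analysis.
From mathcomp Require Import measurable_realfun simple_functions.
From mathcomp Require Import complex ring lra.
Set Implicit Arguments.
Unset Strict Implicit.
Unset Printing Implicit Defensive.
Import Order.TTheory GRing.Theory Num.Theory.
Import numFieldNormedType.Exports.
Local Open Scope ring_scope.
Local Open Scope classical_set_scope.

(* Let [h t] be the integral of [u t] over [[0, L]], and let [gt] be [g] extended by 0. Solutions
   are [u t x = W (t + x) + \int_0^t h s gt (x + t - s) ds], where [W] is [u0] followed by the
   control. Choosing the control so that [u L = u1] turns the definition of [h] into an equation
   on the circle of length [L], [h + F * h = f + const], where [F] is the periodized primitive
   of [g]. The Fourier coefficient of [1 + F *] at a nonzero frequency [th] vanishes exactly when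
   [(1 - exp (- lam x)) / lam], [lam = - i th], violates unique continuation; the zero mode is
   absorbed by the constant. When no other coefficient vanishes, the equation is solvable: [F]
   is an L1-small perturbation of a trigonometric polynomial.
   Conversely, an eigenfunction [z] of the adjoint with [z L = 0] gives the test function
   [exp (lam (L - t)) z x], which makes every state reachable from 0 orthogonal to [z]. *)

(** * Real Lebesgue integrals: parameters, Fubini, translations and reflections *)

Section RealIntegrals.
Context {R : realType}.
Local Notation mu := (@lebesgue_measure R).

(** The circle comes from transport at unit speed during a time equal to the length. At time [t] the
    mean counts [u0] on [[t, L]], the target on [[0, t]], the pulses of source still inside, and the
    correction by which the control compensates in advance the effect of all of [h] at time [L]. Up
    to a term independent of [t], the pulse emitted at [s] contributes [- Gam (t - s)] if [s <= t]
    and [- Gam (t + L - s)] if [s > t]: one kernel read modulo [L]. Future values of [h] enter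
    through the control, so the equation is of Fredholm and not of Volterra type. Its alternative is
    obtained by hand: convolution by [E] is bounded in sup norm by the L1 norm of [E], and the
    trigonometric polynomial comes from an explicit kernel. Exact controllability speaks of every
    weak solution for the chosen control, so uniqueness of the final state belongs to the proof.
    Functions of [t + x] are constant along characteristics; tested against them, two solutions
    differ only through their means, and Gronwall applies. *)

(** Tonelli measures the positive and the negative part separately, and [fine] of their difference
    is measurable whatever values they take. *)
Lemma measurable_Rintegral_param d (T : measurableType d) (B : set R) (f : T -> R -> R) : measurable B ->
  measurable_fun setT (fun p : T * R => f p.1 p.2) ->
  measurable_fun setT (fun x => \int[mu]_(y in B) f x y).
Proof.
move=> mB mf; pose F (p : T * R) := ((f p.1 p.2) * \1_B p.2)%:E.
have mF : measurable_fun setT F.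
  apply/measurable_EFinP; apply: measurable_funM => //.
  by apply: measurableT_comp => //; exact: measurable_indic.
have -> : (fun x => \int[mu]_(y in B) f x y) =
   (fun x => fine (\int[mu]_y F (x, y))%E).
  apply/funext => x; rewrite /Rintegral integral_mkcond; congr fine.
  apply: eq_integral => y _; rewrite /F /= patchE indicE.
  by case: ifPn => yB; rewrite ?mulr1 ?mulr0.
apply: measurableT_comp => //.
have -> : (fun x => \int[mu]_y F (x, y))%E =
  (fun x => (\int[mu]_y F^\+ (x, y) - \int[mu]_y F^\- (x, y))%E).
  apply/funext => x; rewrite integralE; congr (_ - _)%E.
  - by apply: eq_integral => y _; rewrite funepos_comp.
  - by apply: eq_integral => y _; rewrite funeneg_comp.
apply: emeasurable_funB.
- apply: (measurable_fun_fubini_tonelli_F (m2 := mu) (F^\+)%E).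
    exact: measurable_funepos.
  by move=> p; exact: funepos_ge0.
- apply: (measurable_fun_fubini_tonelli_F (m2 := mu) (F^\-)%E).
    exact: measurable_funeneg.
  by move=> p; exact: funeneg_ge0.
Qed.

(** The uniform bound [K] on the inner L1 norms and the finite measure of [A] make the integrand
    integrable on the product. In the exchanged order a section is integrable only for almost every
    [y], so that side is compared almost everywhere. *)
Lemma Rfubini (A B : set R) (f : R -> R -> R) (K : R) :
  measurable A -> measurable B -> (mu A < +oo)%E ->
  measurable_fun setT (fun p : R * R => f p.1 p.2) ->
  (forall x, A x -> (\int[mu]_(y in B) `|f x y|%:E <= K%:E)%E) ->
  \int[mu]_(x in A) \int[mu]_(y in B) f x y =
  \int[mu]_(y in B) \int[mu]_(x in A) f x y.
Proof.
move=> mA mB Aoo mf fK.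
pose F (p : R * R) := ((f p.1 p.2) * \1_A p.1 * \1_B p.2)%:E.
have mF : measurable_fun setT F.
  apply/measurable_EFinP; apply: measurable_funM => //; first apply: measurable_funM => //.
    by apply: measurableT_comp => //; exact: measurable_indic.
  by apply: measurableT_comp => //; exact: measurable_indic.
have iF : (mu \x mu)%E.-integrable setT F.
  apply/integrable12ltyP => //.
  apply: (@le_lt_trans _ _ (\int[mu]_(x in A) (`|K|%:E))%E).
    rewrite [leRHS]integral_mkcond; apply: ge0_le_integral => //.
    - by move=> x _; exact: integral_ge0.
    - apply: (measurable_fun_fubini_tonelli_F (m2 := mu) (fun p => `|F p|)%E) => //.
      exact: measurableT_comp.
    - apply/(measurable_restrictT _ mA); exact: measurable_cst.
    move=> x _; rewrite patchE; case: ifPn => [|] xA.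
      have := fK x (set_mem xA); rewrite integral_mkcond => fK'.
      apply: (@le_trans _ _ K%:E); last by rewrite lee_fin ler_norm.
      apply: le_trans fK'; apply: ge0_le_integral => //.
      - apply: measurableT_comp => //; exact: (measurableT_comp mF (pair1_measurable x)).
      - apply/(measurable_restrictT _ mB); apply/measurable_EFinP.
        apply: measurable_funTS; apply: measurableT_comp => //.
        exact: (measurableT_comp mf (pair1_measurable x)).
      move=> y _; rewrite /F /= !patchE !indicE xA mulr1.
      by case: ifPn => yB; rewrite ?mulr1 ?mulr0 ?normr0.
    rewrite integral0_eq // => y _; rewrite /F /= indicE.
    by move/negbTE: xA => ->; rewrite mulr0 mul0r normr0.
  rewrite integral_cst //; exact: lte_mul_pinfty.
have e1 : (\int[mu]_x \int[mu]_y F (x, y) =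
    \int[mu]_(x in A) (\int[mu]_(y in B) f x y)%:E)%E.
  rewrite [RHS]integral_mkcond; apply: eq_integral => x _.
  rewrite patchE; case: ifPn => xA; last first.
    rewrite integral0_eq // => y _; rewrite /F /= indicE.
    by move/negbTE: xA => ->; rewrite mulr0 mul0r.
  rewrite /Rintegral fineK; last first.
    apply: integrable_fin_num => //; apply/integrableP; split.
      apply/measurable_EFinP; apply: measurable_funTS.
      exact: (measurableT_comp mf (pair1_measurable x)).
    apply: le_lt_trans (ltry K); exact: (fK _ (set_mem xA)).
  rewrite [RHS]integral_mkcond; apply: eq_integral => y _.
  rewrite /F /= !patchE !indicE xA mulr1.
  by case: ifPn => yB; rewrite ?mulr1 ?mulr0.
have e2 : (\int[mu]_y \int[mu]_x F (x, y) =
    \int[mu]_(y in B) (\int[mu]_(x in A) f x y)%:E)%E.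
  rewrite [RHS]integral_mkcond; apply: ae_eq_integral => //.
  - exact: measurable_fubini_G iF.
  - apply/(measurable_restrictT _ mB); apply/measurable_EFinP/measurable_funTS.
    apply: (measurable_Rintegral_param mA (f := fun y x => f x y)).
    have ms : measurable_fun setT (fun p : R * R => (p.2, p.1)).
      exact: measurable_fun_pair.
    exact: (measurableT_comp mf ms).
  - have := ae_integrable2 iF; apply: filterS => y iy _.
    rewrite patchE; case: ifPn => yB; last first.
      rewrite integral0_eq // => x _; rewrite /F /= [\1_B y]indicE.
      by move/negbTE: yB => ->; rewrite mulr0.
    rewrite /Rintegral; have -> : (\int[mu]_(x in A) (f x y)%:E = \int[mu]_x F (x, y))%E.
      rewrite integral_mkcond; apply: eq_integral => x _.
      rewrite /F /= !patchE [\1_B y]indicE yB mulr1 indicE.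
      by case: ifPn => xA; rewrite ?mulr1 ?mulr0.
    rewrite fineK //; exact: integrable_fin_num.
by rewrite /Rintegral -e1 -e2 (Fubini iF).
Qed.

(** The pushforward of [mu] by [phi] is [mu] itself. The change of variables is made for nonnegative
    functions and then for the two parts of [f]. *)
Lemma integral_preserving (phi : R -> R) (f : R -> \bar R) (D : set R) :
  measurable_fun setT phi ->
  (forall A, measurable A -> mu (phi @^-1` A) = mu A) ->
  measurable D -> measurable_fun setT f ->
  (\int[mu]_(x in phi @^-1` D) f (phi x) = \int[mu]_(x in D) f x)%E.
Proof.
move=> mphi hphi mD mf.
have ge0 (h : R -> \bar R) : measurable_fun setT h -> (forall x, (0 <= h x)%E) ->
    (\int[mu]_(x in phi @^-1` D) h (phi x) = \int[mu]_(x in D) h x)%E.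
  move=> mh h0.
  have mphi' : measurable_fun [set: measurableTypeR R]
    (phi : measurableTypeR R -> measurableTypeR R) by exact: mphi.
  rewrite -(@ge0_integral_pushforward _ _ _ _ _ _ mphi' mu D h) //.
  - by apply: eq_measure_integral => A mA _; exact: hphi.
  - by apply: measurable_funTS.
rewrite integralE [RHS]integralE; congr (_ - _)%E.
- have H := ge0 _ (measurable_funepos mf) (funepos_ge0 f).
  by apply: etrans H; apply: eq_integral => x _; rewrite funepos_comp.
- have H := ge0 _ (measurable_funeneg mf) (funeneg_ge0 f).
  by apply: etrans H; apply: eq_integral => x _; rewrite funeneg_comp.
Qed.

(** By uniqueness of the Lebesgue measure it is enough to measure half-open intervals. *)
Lemma lebesgue_measure_shift (c : R) (A : set R) : measurable A ->
  mu ((fun x => x + c) @^-1` A) = mu A.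
Proof.
move=> mA; have mphi : measurable_fun setT (fun x : R => x + c).
  exact: measurable_funD.
have : pushforward mu (fun x : measurableTypeR R => (x + c : measurableTypeR R)) A = mu A.
  apply/esym/lebesgue_measure_unique => //= _ [[a b]] _ <-.
  rewrite /pushforward.
  have -> : (fun x : R => x + c) @^-1` `]a, b] = `](a - c), (b - c)]%classic.
    by apply/seteqP; split => x /=; rewrite !in_itv /= ltrBlDr lerBrDr.
  rewrite !lebesgue_measure_itv /= !lte_fin ltrD2r; case: ifP => // _.
  by rewrite -!EFinB; congr EFin; ring.
by [].
Qed.

Lemma lebesgue_measure_reflect (c : R) (A : set R) : measurable A ->
  mu ((fun x => c - x) @^-1` A) = mu A.
Proof.
move=> mA; have mphi : measurable_fun setT (fun x : R => x + c).
  exact: measurable_funD.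
have <- := lebesgue_measureN mA.
rewrite -(lebesgue_measure_shift (- c)); last first.
  by rewrite -[X in measurable X]setTI; exact: (measurable_funB (measurable_cst c) (@measurable_id _ _ _)).
have -> : (fun x => x - c) @^-1` ((fun x => c - x) @^-1` A) = (fun x => c - (x - c)) @^-1` A by [].
rewrite -[RHS](lebesgue_measure_shift (- (c + c))); last first.
  by rewrite -[X in measurable X]setTI; exact: (@measurable_funN _ _ R _ _ (@measurable_id _ _ _)).
congr (mu _); apply/seteqP; split => x /=; rewrite /preimage /=.
  by have -> : c - (x - c) = - (x - (c + c)) by ring.
by have -> : c - (x - c) = - (x - (c + c)) by ring.
Qed.

Lemma Rintegral_shift (f : R -> R) (a b c : R) : measurable_fun setT f ->
  \int[mu]_(x in `[a, b]) f (x + c) = \int[mu]_(x in `[a + c, b + c]) f x.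
Proof.
move=> mf; rewrite /Rintegral; congr fine.
have mphi : measurable_fun setT (fun x : R => x + c) by exact: measurable_funD.
rewrite -(@integral_preserving (fun x => x + c) (EFin \o f)) //; last 2 first.
- exact: lebesgue_measure_shift.
- exact/measurable_EFinP.
congr integral; apply/seteqP; split => x /=; rewrite /preimage /= !in_itv /=;
  by rewrite !lerD2r.
Qed.

Lemma Rintegral_reflect (f : R -> R) (a b c : R) : measurable_fun setT f ->
  \int[mu]_(x in `[a, b]) f (c - x) = \int[mu]_(x in `[c - b, c - a]) f x.
Proof.
move=> mf; rewrite /Rintegral; congr fine.
have mphi : measurable_fun setT (fun x : R => c - x) by exact: measurable_funB.
rewrite -(@integral_preserving (fun x => c - x) (EFin \o f)) //; last 2 first.
- exact: lebesgue_measure_reflect.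
- exact/measurable_EFinP.
congr integral; apply/seteqP; split => x /=; rewrite /preimage /= !in_itv /=;
  by rewrite !lerD2l !lerN2 andbC.
Qed.

Lemma Rintegral_split (f : R -> R) (a b c : R) : a <= b -> b <= c ->
  mu.-integrable `[a, c] (EFin \o f) ->
  \int[mu]_(x in `[a, c]) f x = \int[mu]_(x in `[a, b]) f x + \int[mu]_(x in `[b, c]) f x.
Proof.
move=> ab bc fi.
have H := @Rintegral_itvB R f (BLeft a) (BRight c) b fi.
rewrite -[X in _ + X](@Rintegral_itv_obnd_cbnd _ b (BRight c)).
  by rewrite -H ?bnd_simp // addrC subrK.
by apply: integrableS fi => //; apply: subset_itvr; rewrite bnd_simp.
Qed.

Lemma integrable_cst_fin (D : set R) (M : R) : measurable D -> (mu D < +oo)%E ->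
  mu.-integrable D (EFin \o (fun _ => M)).
Proof.
move=> mD Doo; apply/integrableP; split.
  by apply/measurable_EFinP; exact: measurable_cst.
rewrite (_ : (fun x => _) = cst `|M|%:E) // integral_cst //.
exact: lte_mul_pinfty.
Qed.

Lemma itv_fin (a b : R) : (mu `[a, b] < +oo)%E.
Proof. by rewrite lebesgue_measure_itv /=; case: ifP => // _; rewrite -EFinB ltry. Qed.

Lemma integrable_cst_itv (M a b : R) : mu.-integrable `[a, b] (EFin \o (fun _ => M)).
Proof. by apply: integrable_cst_fin => //; exact: itv_fin. Qed.

Lemma Rintegral_cst_itv (a b r : R) : a <= b -> \int[mu]_(_ in `[a, b]) r = r * (b - a).
Proof.
rewrite le_eqVlt => /predU1P[->|ab].
  by rewrite set_itv1 Rintegral_set1 subrr mulr0.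
have := Rintegral_cst mu (measurable_itv `[a, b]%R) r; move=> ->; congr (r * _).
by have := lebesgue_measure_itv `[a, b]%R; rewrite /= lte_fin ab -EFinB => ->.
Qed.

Lemma RintegrableZ (D : set R) (f : R -> R) (a : R) : measurable D ->
  mu.-integrable D (EFin \o f) -> mu.-integrable D (EFin \o (fun x => a * f x)).
Proof. by move=> mD fi; exact: (@integrableZl _ _ _ mu D _ a _ fi). Qed.

Lemma RintegrableD (D : set R) (f g : R -> R) : measurable D ->
  mu.-integrable D (EFin \o f) -> mu.-integrable D (EFin \o g) ->
  mu.-integrable D (EFin \o (fun x => f x + g x)).
Proof. by move=> mD fi gi; exact: (integrableD _ fi gi). Qed.

Lemma Rintegrable_le (D : set R) (f b : R -> R) : measurable D -> measurable_fun setT f ->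
  mu.-integrable D (EFin \o b) -> (forall x, D x -> `|f x| <= b x) ->
  mu.-integrable D (EFin \o f).
Proof.
move=> mD mf bi fb; apply: le_integrable bi => //.
  by apply/measurable_EFinP; exact: measurable_funTS.
by move=> x Dx; rewrite lee_fin; apply: le_trans (fb x Dx) (ler_norm _).
Qed.

Lemma Rintegrable_preserving (phi f : R -> R) (D : set R) :
  measurable_fun setT phi -> (forall A, measurable A -> mu (phi @^-1` A) = mu A) ->
  measurable D -> measurable_fun setT f -> mu.-integrable D (EFin \o f) ->
  mu.-integrable (phi @^-1` D) (EFin \o (fun x => f (phi x))).
Proof.
move=> mphi hphi mD mf /integrableP[_ fi]; apply/integrableP; split.
  by apply/measurable_EFinP; apply: measurable_funTS; exact: measurableT_comp.
have := @integral_preserving phi (fun x => `|(f x)%:E|)%E D mphi hphi mD.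
by move=> -> //; apply: measurableT_comp => //; exact/measurable_EFinP.
Qed.

Lemma Rintegrable_shift (f : R -> R) (a b c : R) : measurable_fun setT f ->
  mu.-integrable `[a + c, b + c] (EFin \o f) ->
  mu.-integrable `[a, b] (EFin \o (fun x => f (x + c))).
Proof.
move=> mf fi.
have -> : `[a, b]%classic = (fun x => x + c) @^-1` `[a + c, b + c].
  by apply/seteqP; split => x /=; rewrite /preimage /= !in_itv /= !lerD2r.
apply: (@Rintegrable_preserving (fun x => x + c)) => //.
- exact: measurable_funD.
- exact: lebesgue_measure_shift.
Qed.

Lemma Rintegrable_reflect (f : R -> R) (a b c : R) : measurable_fun setT f ->
  mu.-integrable `[c - b, c - a] (EFin \o f) ->
  mu.-integrable `[a, b] (EFin \o (fun x => f (c - x))).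
Proof.
move=> mf fi.
have -> : `[a, b]%classic = (fun x => c - x) @^-1` `[c - b, c - a].
  by apply/seteqP; split => x /=; rewrite /preimage /= !in_itv /= !lerD2l !lerN2 andbC.
apply: (@Rintegrable_preserving (fun x => c - x)) => //.
- exact: measurable_funB.
- exact: lebesgue_measure_reflect.
Qed.

(** The measurable sets of the plane are those of the product structure, so an open set is exhibited
    as a countable union of boxes with rational centres and radii. *)
Lemma open_prod_measurable (A : set (R * R)) : open A -> measurable A.
Proof.
move=> oA.
pose box (q : rat * rat * rat) : set (R * R) :=
  [set p | `|p.1 - ratr q.1.1| < ratr q.2 /\ `|p.2 - ratr q.1.2| < ratr q.2].
have -> : A = \bigcup_(q in [set q | box q `<=` A]) box q.
  apply/seteqP; split; last by move=> p [q qA qp]; exact: qA.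
  move=> [x y] Axy.
  have /nbhs_ballP[e /= e0 eA] : nbhs (x, y) A by exact: open_nbhs_nbhs.
  (* A rational radius [r < e / 2] and a rational centre within [r] of the point: the box contains
     the point and stays within [2 * r < e] of it. *)
  have e20 : 0 < e / 2 by rewrite divr_gt0.
  have [r] := rat_in_itvoo e20; rewrite in_itv /= => /andP[r0 re].
  have hx : x - ratr r < x + ratr r by rewrite ltrD2l gtrN.
  have hy : y - ratr r < y + ratr r by rewrite ltrD2l gtrN.
  have [qx] := rat_in_itvoo hx; rewrite in_itv /= => /andP[qx1 qx2].
  have [qy] := rat_in_itvoo hy; rewrite in_itv /= => /andP[qy1 qy2].
  exists (qx, qy, r); last first.
    by split => /=; rewrite ltr_norml; apply/andP; split; lra.
  move=> [x' y'] [/= h1 h2]; apply: eA; split => /=; rewrite /ball /=.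
    by move: h1; rewrite !ltr_norml => /andP[h1 h1']; apply/andP; split; lra.
  by move: h2; rewrite !ltr_norml => /andP[h2 h2']; apply/andP; split; lra.
rewrite bigcup_mkcond; apply: countable_bigcupT_measurable => // q.
case: ifP => // _.
have -> : box q = (ball (ratr q.1.1 : R) (ratr q.2)) `*` (ball (ratr q.1.2 : R) (ratr q.2)).
  by apply/seteqP; split => [[x y] [/= h1 h2]|[x y] [/= h1 h2]]; split;
    rewrite /ball /= ?(distrC x) ?(distrC y) //; rewrite distrC.
by apply: measurableX; exact: measurable_ball.
Qed.

Lemma continuous2_measurable (f : R * R -> R) : continuous f -> measurable_fun setT f.
Proof.
move=> cf; apply: (measurability _ (RGenOpens.measurableE R)).
move=> _ [_ [a [b ->] <-]]; rewrite setTI.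
apply: open_prod_measurable; apply: open_comp; last exact: interval_open.
by move=> x _; exact: cf.
Qed.

End RealIntegrals.

(** * Complex numbers by coordinates, and the norm |Re| + |Im| *)

Section ComplexNumbers.
Context {R : realType}.
Local Notation C := (R[i]).
Implicit Types (x y z : C).

Lemma complex_ext x y : cre x = cre y -> cim x = cim y -> x = y.
Proof. by case: x => a b; case: y => c d /= -> ->. Qed.

Lemma creD x y : cre (x + y) = cre x + cre y.
Proof. by case: x => a b; case: y. Qed.
Lemma cimD x y : cim (x + y) = cim x + cim y.
Proof. by case: x => a b; case: y. Qed.
Lemma creN x : cre (- x) = - cre x.
Proof. by case: x. Qed.
Lemma cimN x : cim (- x) = - cim x.
Proof. by case: x. Qed.
Lemma creM x y : cre (x * y) = cre x * cre y - cim x * cim y.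
Proof. by case: x => a b; case: y. Qed.
Lemma cimM x y : cim (x * y) = cre x * cim y + cim x * cre y.
Proof. by case: x => a b; case: y. Qed.
Lemma cre_conj x : cre (cconj x) = cre x.
Proof. by case: x. Qed.
Lemma cim_conj x : cim (cconj x) = - cim x.
Proof. by case: x. Qed.
Lemma cre_mk (a b : R) : cre (cmk a b) = a.
Proof. by []. Qed.
Lemma cim_mk (a b : R) : cim (cmk a b) = b.
Proof. by []. Qed.
Lemma cre0 : cre (0 : C) = 0.
Proof. by []. Qed.
Lemma cim0 : cim (0 : C) = 0.
Proof. by []. Qed.
Lemma cre1 : cre (1 : C) = 1.
Proof. by []. Qed.
Lemma cim1 : cim (1 : C) = 0.
Proof. by []. Qed.

Definition reimE := (creD, cimD, creN, cimN, creM, cimM, cre_conj, cim_conj,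
  cre_mk, cim_mk, cre0, cim0, cre1, cim1).

Lemma cconjM x y : cconj (x * y) = cconj x * cconj y.
Proof. by apply: complex_ext; rewrite !reimE; ring. Qed.

Lemma cconjB x y : cconj (x - y) = cconj x - cconj y.
Proof. by apply: complex_ext; rewrite !reimE; ring. Qed.

Lemma cconjK x : cconj (cconj x) = x.
Proof. by apply: complex_ext; rewrite !reimE; ring. Qed.

(** Equivalent to the modulus and still submultiplicative, but free of square roots: estimates
    reduce to linear arithmetic on the coordinates. *)
Definition norm1 z : R := `|cre z| + `|cim z|.

Lemma norm1_ge0 z : 0 <= norm1 z. Proof. by rewrite addr_ge0. Qed.
Local Hint Resolve norm1_ge0 : core.

Lemma norm1_0 : norm1 0 = 0. Proof. by rewrite /norm1 !reimE normr0 addr0. Qed.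

Lemma norm1N z : norm1 (- z) = norm1 z.
Proof. by rewrite /norm1 !reimE !normrN. Qed.

Lemma norm1_conj z : norm1 (cconj z) = norm1 z.
Proof. by rewrite /norm1 !reimE normrN. Qed.

Lemma norm1D x y : norm1 (x + y) <= norm1 x + norm1 y.
Proof. by rewrite /norm1 !reimE addrACA lerD // ler_normD. Qed.

Lemma norm1B x y : norm1 (x - y) <= norm1 x + norm1 y.
Proof. by rewrite -(norm1N y) norm1D. Qed.

Lemma norm1M x y : norm1 (x * y) <= norm1 x * norm1 y.
Proof.
rewrite /norm1 !reimE mulrDl !mulrDr -!normrM.
apply: (le_trans (lerD (ler_normB _ _) (ler_normD _ _))); lra.
Qed.

Lemma cre_le_norm1 z : `|cre z| <= norm1 z. Proof. by rewrite lerDl. Qed.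
Lemma cim_le_norm1 z : `|cim z| <= norm1 z. Proof. by rewrite lerDr. Qed.

Lemma norm1_le0 z : norm1 z <= 0 -> z = 0.
Proof.
move=> h; apply: complex_ext; rewrite !reimE; apply/eqP; rewrite -normr_le0.
  exact: le_trans (cre_le_norm1 _) h.
exact: le_trans (cim_le_norm1 _) h.
Qed.

Lemma cabs2_ge0 z : 0 <= cabs2 z.
Proof. by rewrite addr_ge0 // sqr_ge0. Qed.

Lemma cabs2_le_norm1 z : cabs2 z <= norm1 z ^+ 2.
Proof.
rewrite /cabs2 /norm1 -[cre z ^+ 2]real_normK ?num_real // -[cim z ^+ 2]real_normK ?num_real //.
by rewrite sqrrD lerD2r lerDl mulrn_wge0 // mulr_ge0.
Qed.

Lemma norm1_le_cabs2 z : norm1 z ^+ 2 <= 2 * cabs2 z.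
Proof.
rewrite /cabs2 /norm1 -[cre z ^+ 2]real_normK ?num_real // -[cim z ^+ 2]real_normK ?num_real //.
have := sqr_ge0 (`|cre z| - `|cim z|); nra.
Qed.

(** Young's inequality followed by [norm1_le_cabs2]. With a free weight [e] it does the work of
    Cauchy-Schwarz when an L1 bound on a bounded interval is drawn from an L2 bound. *)
Lemma norm1_le_young (e : R) z : 0 < e -> norm1 z <= e + e^-1 * cabs2 z.
Proof.
move=> e0; have h := norm1_le_cabs2 z.
have e1 : 0 < e^-1 by rewrite invr_gt0.
have h1 := sqr_ge0 (e - norm1 z).
have h3 : norm1 z <= 2^-1 * (e + e^-1 * norm1 z ^+ 2).
  rewrite -(ler_pM2l e0).
  have -> : e * (2^-1 * (e + e^-1 * norm1 z ^+ 2)) = 2^-1 * (e ^+ 2 + norm1 z ^+ 2).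
    by field; rewrite gt_eqF.
  nra.
apply: (le_trans h3).
have : e^-1 * norm1 z ^+ 2 <= e^-1 * (2 * cabs2 z) by rewrite ler_pM2l.
nra.
Qed.

Lemma cabs2B_le x y : cabs2 (x - y) <= 2 * cabs2 x + 2 * cabs2 y.
Proof.
rewrite /cabs2 !reimE.
have := sqr_ge0 (cre x + cre y); have := sqr_ge0 (cim x + cim y); nra.
Qed.

Lemma cabs2D_le x y : cabs2 (x + y) <= 2 * cabs2 x + 2 * cabs2 y.
Proof.
rewrite /cabs2 !reimE.
have := sqr_ge0 (cre x - cre y); have := sqr_ge0 (cim x - cim y); nra.
Qed.

Lemma cabs2_0 : cabs2 (0 : C) = 0.
Proof. by rewrite /cabs2 !reimE expr0n addr0. Qed.

End ComplexNumbers.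
#[global] Hint Resolve norm1_ge0 : core.

(** * Measurability and integration of complex-valued functions *)

Section ComplexIntegrals.
Context {R : realType}.
Local Notation C := (R[i]).
Local Notation mu := (@lebesgue_measure R).
Implicit Types (D : set R).

Lemma cre_cint D (f : R -> C) : cre (cint D f) = \int[mu]_(x in D) cre (f x).
Proof. by []. Qed.

Lemma cim_cint D (f : R -> C) : cim (cint D f) = \int[mu]_(x in D) cim (f x).
Proof. by []. Qed.

Section Measurable.
Context {d : measure_display} {T : measurableType d}.
Implicit Types f g : T -> C.

Definition cmeas f := measurable_fun setT (fun t => cre (f t)) /\
  measurable_fun setT (fun t => cim (f t)).

Lemma cmeas_cst (c : C) : cmeas (fun _ => c).
Proof. by split; exact: measurable_cst. Qed.

Lemma cmeasD f g : cmeas f -> cmeas g -> cmeas (fun t => f t + g t).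
Proof.
move=> [f1 f2] [g1 g2]; split; [under eq_fun do rewrite !reimE..].
  exact: measurable_funD.
exact: measurable_funD.
Qed.

Lemma cmeasN f : cmeas f -> cmeas (fun t => - f t).
Proof.
move=> [f1 f2]; split; [under eq_fun do rewrite !reimE..].
  exact: measurableT_comp.
exact: measurableT_comp.
Qed.

Lemma cmeasB f g : cmeas f -> cmeas g -> cmeas (fun t => f t - g t).
Proof. by move=> hf hg; apply: cmeasD => //; exact: cmeasN. Qed.

Lemma cmeasM f g : cmeas f -> cmeas g -> cmeas (fun t => f t * g t).
Proof.
move=> [f1 f2] [g1 g2]; split; [under eq_fun do rewrite !reimE..].
  by apply: measurable_funB; exact: measurable_funM.
by apply: measurable_funD; exact: measurable_funM.
Qed.

Lemma cmeas_conj f : cmeas f -> cmeas (fun t => cconj (f t)).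
Proof.
move=> [f1 f2]; split; [under eq_fun do rewrite !reimE..] => //.
exact: measurableT_comp.
Qed.

Lemma cmeas_if (b : T -> bool) f g : measurable_fun setT b ->
  cmeas f -> cmeas g -> cmeas (fun t => if b t then f t else g t).
Proof.
move=> mb [f1 f2] [g1 g2]; split.
  under eq_fun do rewrite (fun_if cre); exact: measurable_fun_ifT.
under eq_fun do rewrite (fun_if cim); exact: measurable_fun_ifT.
Qed.

Lemma measurable_norm1 f : cmeas f -> measurable_fun setT (fun t => norm1 (f t)).
Proof.
by move=> [f1 f2]; apply: measurable_funD; exact: measurableT_comp.
Qed.

Lemma measurable_cabs2 f : cmeas f -> measurable_fun setT (fun t => cabs2 (f t)).
Proof.
by move=> [f1 f2]; apply: measurable_funD; exact: measurable_funX.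
Qed.

End Measurable.

Lemma cmeas_comp d d' (T : measurableType d) (T' : measurableType d')
  (f : T -> C) (k : T' -> T) :
  cmeas f -> measurable_fun setT k -> cmeas (fun t => f (k t)).
Proof.
by move=> [f1 f2] mk; split; [exact: (measurableT_comp f1)|exact: (measurableT_comp f2)].
Qed.

Lemma cmeas_comp2 d (T : measurableType d) (F : R -> R -> C) (a b : T -> R) :
  cmeas (fun p : R * R => F p.1 p.2) ->
  measurable_fun setT a -> measurable_fun setT b -> cmeas (fun t => F (a t) (b t)).
Proof.
move=> mF ma mb; apply: (cmeas_comp (k := fun t => (a t, b t)) mF).
exact: measurable_fun_pair.
Qed.

Lemma cmeas_cint d (T : measurableType d) (B : set R) (F : T -> R -> C) : measurable B ->
  cmeas (fun p : T * R => F p.1 p.2) -> cmeas (fun x => cint B (F x)).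
Proof.
by move=> mB [f1 f2]; split;
  [exact: (measurable_Rintegral_param (f := fun x y => cre (F x y)))|
   exact: (measurable_Rintegral_param (f := fun x y => cim (F x y)))].
Qed.

(** Measurability is required on the whole line and integrability only on [D], so that shifts,
    reflections and Fubini need not track domains of measurability. *)
Definition cL1 D (f : R -> C) :=
  cmeas f /\ mu.-integrable D (fun x => (norm1 (f x))%:E).

Lemma cL1_re D f : measurable D -> cL1 D f -> mu.-integrable D (EFin \o (fun x => cre (f x))).
Proof.
move=> mD [[f1 f2] fi]; apply: le_integrable fi => //.
  by apply/measurable_EFinP; exact: measurable_funTS.
by move=> x _; rewrite lee_fin; exact: le_trans (cre_le_norm1 _) (ler_norm _).
Qed.

Lemma cL1_im D f : measurable D -> cL1 D f -> mu.-integrable D (EFin \o (fun x => cim (f x))).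
Proof.
move=> mD [[f1 f2] fi]; apply: le_integrable fi => //.
  by apply/measurable_EFinP; exact: measurable_funTS.
by move=> x _; rewrite lee_fin; exact: le_trans (cim_le_norm1 _) (ler_norm _).
Qed.

Lemma cL1_le D f (b : R -> R) : measurable D -> cmeas f ->
  mu.-integrable D (EFin \o b) -> (forall x, D x -> norm1 (f x) <= b x) -> cL1 D f.
Proof.
move=> mD mf bi fb; split=> //; apply: le_integrable bi => //.
  by apply/measurable_EFinP; apply: measurable_funTS; exact: measurable_norm1.
move=> x Dx; rewrite lee_fin (ger0_norm (norm1_ge0 _)).
by apply: le_trans (fb x Dx) _; exact: ler_norm.
Qed.

Lemma cL1_bounded D f (M : R) : measurable D -> (mu D < +oo)%E -> cmeas f ->
  (forall x, D x -> norm1 (f x) <= M) -> cL1 D f.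
Proof.
move=> mD Doo mf fM; apply: (cL1_le mD mf _ fM).
exact: integrable_cst_fin.
Qed.

Lemma cL1D D f g : measurable D -> cL1 D f -> cL1 D g -> cL1 D (fun x => f x + g x).
Proof.
move=> mD [mf fi] [mg gi].
apply: (@cL1_le _ _ (fun x => norm1 (f x) + norm1 (g x))) => //.
- exact: cmeasD.
- exact: (integrableD _ fi gi).
- by move=> x _; exact: norm1D.
Qed.

Lemma cL1N D f : cL1 D f -> cL1 D (fun x => - f x).
Proof.
move=> [mf fi]; split; first exact: cmeasN.
by under eq_fun do rewrite norm1N.
Qed.

Lemma cL1B D f g : measurable D -> cL1 D f -> cL1 D g -> cL1 D (fun x => f x - g x).
Proof. by move=> mD hf hg; apply: cL1D => //; exact: cL1N. Qed.

Lemma cL1Mb D f g (M : R) : measurable D -> cL1 D f -> cmeas g ->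
  (forall x, D x -> norm1 (g x) <= M) -> cL1 D (fun x => f x * g x).
Proof.
move=> mD [mf fi] mg gM.
apply: (@cL1_le _ _ (fun x => M * norm1 (f x))) => //.
- exact: cmeasM.
- exact: (@integrableZl _ _ _ mu D mD M _ fi).
- move=> x Dx; apply: (le_trans (norm1M _ _)).
  by rewrite [leLHS]mulrC; exact: (ler_wpM2r (norm1_ge0 _) (gM x Dx)).
Qed.

Lemma cL1Mbl D f g (M : R) : measurable D -> cL1 D f -> cmeas g ->
  (forall x, D x -> norm1 (g x) <= M) -> cL1 D (fun x => g x * f x).
Proof.
move=> mD hf mg gM; have := @cL1Mb D f g M mD hf mg gM.
by rewrite (_ : (fun x => f x * g x) = (fun x => g x * f x)) //; apply/funext => x; rewrite mulrC.
Qed.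

Lemma cL1Z D f (c : C) : measurable D -> cL1 D f -> cL1 D (fun x => c * f x).
Proof.
move=> mD hf; have := @cL1Mb D f (fun _ => c) (norm1 c) mD hf (cmeas_cst c) (fun _ _ => lexx _).
by under eq_fun do rewrite mulrC.
Qed.

Lemma cL1S D E f : measurable D -> measurable E -> E `<=` D -> cL1 D f -> cL1 E f.
Proof. by move=> mD mE ED [mf fi]; split=> //; exact: integrableS fi. Qed.

Lemma cL1_sum D (I : Type) (r : seq I) (F : I -> R -> C) : measurable D ->
  (forall i, cL1 D (F i)) -> cL1 D (fun x => \sum_(i <- r) F i x).
Proof.
move=> mD h; elim: r => [|i r IH].
  under eq_fun do rewrite big_nil; split; first exact: cmeas_cst.
  by under eq_fun do rewrite norm1_0; exact: integrable0.
by under eq_fun do rewrite big_cons; exact: cL1D.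
Qed.

Lemma eq_cint D f g : (forall x, D x -> f x = g x) -> cint D f = cint D g.
Proof.
by move=> fg; apply: complex_ext; rewrite ?cre_cint ?cim_cint; apply: eq_Rintegral => x /set_mem Dx;
  rewrite fg.
Qed.

Lemma cint0 D : cint D (fun _ => 0) = 0.
Proof.
by apply: complex_ext; rewrite ?cre_cint ?cim_cint !reimE /Rintegral integral0.
Qed.

Lemma cintD D f g : measurable D -> cL1 D f -> cL1 D g ->
  cint D (fun x => f x + g x) = cint D f + cint D g.
Proof.
move=> mD hf hg; apply: complex_ext; rewrite reimE ?cre_cint ?cim_cint.
  by under eq_Rintegral do rewrite reimE; apply: RintegralD => //; exact: cL1_re.
by under eq_Rintegral do rewrite reimE; apply: RintegralD => //; exact: cL1_im.
Qed.

Lemma cintZl D f (c : C) : measurable D -> cL1 D f ->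
  cint D (fun x => c * f x) = c * cint D f.
Proof.
move=> mD hf; have h1 := cL1_re mD hf; have h2 := cL1_im mD hf.
have z1 (a : R) : mu.-integrable D (EFin \o (fun x => a * cre (f x))).
  exact: (@integrableZl _ _ _ mu D mD a _ h1).
have z2 (a : R) : mu.-integrable D (EFin \o (fun x => a * cim (f x))).
  exact: (@integrableZl _ _ _ mu D mD a _ h2).
apply: complex_ext; rewrite !reimE ?cre_cint ?cim_cint.
  under eq_Rintegral do rewrite reimE.
  by rewrite RintegralB // !RintegralZl.
under eq_Rintegral do rewrite reimE.
by rewrite RintegralD // !RintegralZl.
Qed.

Lemma cintZr D f (c : C) : measurable D -> cL1 D f ->
  cint D (fun x => f x * c) = cint D f * c.
Proof. by move=> mD hf; rewrite mulrC -cintZl //; apply: eq_cint => x _; rewrite mulrC. Qed.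

Lemma cintN D f : measurable D -> cL1 D f -> cint D (fun x => - f x) = - cint D f.
Proof.
move=> mD hf; rewrite -mulN1r -cintZl //.
by apply: eq_cint => x _; rewrite mulN1r.
Qed.

Lemma cintB D f g : measurable D -> cL1 D f -> cL1 D g ->
  cint D (fun x => f x - g x) = cint D f - cint D g.
Proof.
by move=> mD hf hg; rewrite cintD ?cintN //; exact: cL1N.
Qed.

Lemma cint_sum D (I : Type) (r : seq I) (F : I -> R -> C) : measurable D ->
  (forall i, cL1 D (F i)) ->
  cint D (fun x => \sum_(i <- r) F i x) = \sum_(i <- r) cint D (F i).
Proof.
move=> mD h; elim: r => [|i r IH].
  by rewrite big_nil -[RHS](cint0 D); apply: eq_cint => x _; rewrite big_nil.
rewrite big_cons -IH -cintD //; last exact: cL1_sum.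
by apply: eq_cint => x _; rewrite big_cons.
Qed.

Lemma cint_conj D f : measurable D -> cL1 D f ->
  cint D (fun x => cconj (f x)) = cconj (cint D f).
Proof.
move=> mD hf; have h2 := cL1_im mD hf.
apply: complex_ext; rewrite !reimE ?cre_cint ?cim_cint.
  by apply: eq_Rintegral => x _; rewrite reimE.
rewrite -mulN1r -RintegralZl //.
by apply: eq_Rintegral => x _; rewrite reimE mulN1r.
Qed.

Lemma norm1_cint D f : measurable D -> cL1 D f ->
  norm1 (cint D f) <= \int[mu]_(x in D) norm1 (f x).
Proof.
move=> mD hf; have h1 := cL1_re mD hf; have h2 := cL1_im mD hf.
rewrite [norm1 (cint _ _)]/norm1 cre_cint cim_cint.
apply: (@le_trans _ _ (\int[mu]_(x in D) `|cre (f x)| + \int[mu]_(x in D) `|cim (f x)|)).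
  by apply: lerD; exact: le_normr_Rintegral.
rewrite -RintegralD //.
- exact: (integrable_norm h1).
- exact: (integrable_norm h2).
Qed.

Lemma norm1_cint_le D f (b : R -> R) : measurable D -> cmeas f ->
  mu.-integrable D (EFin \o b) -> (forall x, D x -> norm1 (f x) <= b x) ->
  norm1 (cint D f) <= \int[mu]_(x in D) b x.
Proof.
move=> mD mf bi fb; have hf := cL1_le mD mf bi fb.
by apply: (le_trans (norm1_cint mD hf)); apply: le_Rintegral => //; case: hf.
Qed.

Lemma cfubini (A B : set R) (F : R -> R -> C) (K : R) :
  measurable A -> measurable B -> (mu A < +oo)%E ->
  cmeas (fun p : R * R => F p.1 p.2) ->
  (forall x, A x -> (\int[mu]_(y in B) (norm1 (F x y))%:E <= K%:E)%E) ->
  cint A (fun x => cint B (F x)) = cint B (fun y => cint A (fun x => F x y)).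
Proof.
move=> mA mB Aoo [m1 m2] FK.
have mn x : measurable_fun setT (fun y => norm1 (F x y)).
  have mp : measurable_fun setT (fun y : R => (x, y)) by exact: pair1_measurable.
  apply: measurable_norm1.
  by split; [exact: (measurableT_comp m1 mp)|exact: (measurableT_comp m2 mp)].
have mr x : measurable_fun setT (fun y => `|cre (F x y)|).
  exact: measurableT_comp (measurableT_comp m1 (pair1_measurable x)).
have mi x : measurable_fun setT (fun y => `|cim (F x y)|).
  exact: measurableT_comp (measurableT_comp m2 (pair1_measurable x)).
apply: complex_ext.
  apply: (@Rfubini _ _ _ (fun x y => cre (F x y)) K) => // x Ax.
  apply: le_trans (FK x Ax); apply: ge0_le_integral => //.
  - by apply/measurable_EFinP; exact: (measurable_funTS (mr x)).
  - by apply/measurable_EFinP; exact: (measurable_funTS (mn x)).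
  - by move=> y _; rewrite lee_fin cre_le_norm1.
apply: (@Rfubini _ _ _ (fun x y => cim (F x y)) K) => // x Ax.
apply: le_trans (FK x Ax); apply: ge0_le_integral => //.
- by apply/measurable_EFinP; exact: (measurable_funTS (mi x)).
- by apply/measurable_EFinP; exact: (measurable_funTS (mn x)).
- by move=> y _; rewrite lee_fin cim_le_norm1.
Qed.

(** The form in which Fubini is applied below: every inner integrand is dominated by a constant, or
    by a constant times an integrable function, with a bound uniform in the outer variable. *)
Lemma cfubini_le (A B : set R) (F : R -> R -> C) (K : R) :
  measurable A -> measurable B -> (mu A < +oo)%E ->
  cmeas (fun p : R * R => F p.1 p.2) ->
  (forall x, A x -> exists b : R -> R, [/\ mu.-integrable B (EFin \o b),
     forall y, B y -> norm1 (F x y) <= b y & \int[mu]_(y in B) b y <= K]) ->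
  cint A (fun x => cint B (F x)) = cint B (fun y => cint A (fun x => F x y)).
Proof.
move=> mA mB Aoo mF HF; apply: (@cfubini _ _ _ K) => // x /HF[b [bi Fb bK]].
apply: (@le_trans _ _ (\int[mu]_(y in B) (b y)%:E)%E).
  apply: ge0_le_integral => //.
  - by move=> y _; rewrite lee_fin; exact: norm1_ge0.
  - apply/measurable_EFinP; apply: measurable_funTS; apply: measurable_norm1.
    exact: (cmeas_comp (k := fun y => (x, y)) mF (pair1_measurable x)).
  - exact: measurable_int bi.
have fb : (\int[mu]_(y in B) (b y)%:E)%E \is a fin_num by exact: integrable_fin_num.
by rewrite -(fineK fb) lee_fin; exact: bK.
Qed.

Lemma cint_shift f (a b c : R) : cmeas f ->
  cint `[a, b] (fun x => f (x + c)) = cint `[a + c, b + c] f.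
Proof.
move=> [m1 m2]; apply: complex_ext; rewrite ?cre_cint ?cim_cint.
  exact: (Rintegral_shift (f := fun x => cre (f x))).
exact: (Rintegral_shift (f := fun x => cim (f x))).
Qed.

Lemma cint_reflect f (a b c : R) : cmeas f ->
  cint `[a, b] (fun x => f (c - x)) = cint `[c - b, c - a] f.
Proof.
move=> [m1 m2]; apply: complex_ext; rewrite ?cre_cint ?cim_cint.
  exact: (Rintegral_reflect (f := fun x => cre (f x))).
exact: (Rintegral_reflect (f := fun x => cim (f x))).
Qed.

Lemma cint_split f (a b c : R) : a <= b -> b <= c -> cL1 `[a, c] f ->
  cint `[a, c] f = cint `[a, b] f + cint `[b, c] f.
Proof.
move=> ab bc hf; apply: complex_ext; rewrite reimE ?cre_cint ?cim_cint.
  by apply: Rintegral_split => //; exact: cL1_re.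
by apply: Rintegral_split => //; exact: cL1_im.
Qed.

Lemma cint_point f (a : R) : cint `[a, a] f = 0.
Proof.
by apply: complex_ext; rewrite ?cre_cint ?cim_cint !reimE set_itv1 Rintegral_set1.
Qed.

Lemma ae_imp (P Q : R -> Prop) : {ae mu, forall x, P x} ->
  (forall x, P x -> Q x) -> {ae mu, forall x, Q x}.
Proof.
move=> + PQ; apply: filterS; first exact: (ae_filter_ringOfSetsType mu).
by move=> x; exact: PQ.
Qed.

Lemma ae_eq_cint D f g : measurable D -> cL1 D f -> cL1 D g ->
  {ae mu, forall x, D x -> f x = g x} -> cint D f = cint D g.
Proof.
move=> mD hf hg fg; apply: complex_ext; rewrite ?cre_cint ?cim_cint /Rintegral; congr fine.
  apply: ae_eq_integral => //; [exact: measurable_int (cL1_re mD hf)|exact: measurable_int (cL1_re mD hg)|].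
  by apply: (ae_imp fg) => x h Dx; rewrite h.
apply: ae_eq_integral => //; [exact: measurable_int (cL1_im mD hf)|exact: measurable_int (cL1_im mD hg)|].
by apply: (ae_imp fg) => x h Dx; rewrite h.
Qed.

End ComplexIntegrals.

(** * Test functions along characteristics, and the transport identity *)

Section Characteristics.
Context {R : realType}.
Local Notation C := (R[i]).
Local Notation mu := (@lebesgue_measure R).

Lemma Rintegral_FTC2 (F f : R -> R) (a b : R) : a <= b ->
  (forall x : R, is_derive x (1 : R) F (f x)) -> continuous f ->
  \int[mu]_(x in `[a, b]) f x = F b - F a.
Proof.
rewrite le_eqVlt => /predU1P[->|ab] dF cf.
  by rewrite set_itv1 Rintegral_set1 subrr.
have cF : continuous F.
  move=> x; apply: differentiable_continuous; apply/derivable1_diffP.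
  by have [] := dF x.
rewrite /Rintegral (@continuous_FTC2 R f F a b) //.
- by apply: continuous_subspaceT.
- split.
  + by move=> x _; have [] := dF x.
  + by apply: cvg_at_right_filter; exact: cF.
  + by apply: cvg_at_left_filter; exact: cF.
- by move=> x _; rewrite derive1E; have [_ ->] := dF x.
Qed.

(** The points come in either order because the increment of a difference quotient has either sign;
    only the distance of [c] to [a] matters. *)
Lemma mean_value (F f : R -> R) (a b : R) :
  (forall x : R, is_derive x (1 : R) F (f x)) ->
  exists2 c, `|c - a| <= `|b - a| & F b - F a = f c * (b - a).
Proof.
move=> dF.
have cF : continuous F.
  move=> x; apply: differentiable_continuous; apply/derivable1_diffP.
  by have [] := dF x.
case: (leP a b) => [ab|/ltW ba].
  have [c] := @MVT_segment R F f a b ab (fun x _ => dF x) (continuous_subspaceT cF).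
  rewrite in_itv /= => /andP[ac cb] e; exists c => //.
  by rewrite !ger0_norm ?subr_ge0 // lerD2r.
have [c] := @MVT_segment R F f b a ba (fun x _ => dF x) (continuous_subspaceT cF).
rewrite in_itv /= => /andP[ac cb] e; exists c.
  by rewrite !ler0_norm ?subr_le0 // lerN2 lerD2r.
by rewrite -opprB e; ring.
Qed.

(** The increment splits into a change of the first variable at the moved point and a change of the
    second variable at fixed [t]. The latter is the chain rule. The former is, by the mean value
    theorem, a value of [ft] at a nearby point, which tends to [ft t (xi - t)] by joint
    continuity. *)
Lemma is_derive_characteristic (f ft fx : R -> R -> R) (xi t : R) :
  (forall t x : R, is_derive t (1 : R) (fun s => f s x) (ft t x)) ->
  (forall t x : R, is_derive x (1 : R) (fun y => f t y) (fx t x)) ->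
  continuous (fun p : R * R => ft p.1 p.2) ->
  is_derive t (1 : R) (fun s => f s (xi - s)) (ft t (xi - t) - fx t (xi - t)).
Proof.
move=> dt dx ct.
have d2 : is_derive t (1 : R) (fun s => f t (xi - s)) (- fx t (xi - t)).
  have d3 : is_derive t (1 : R) (fun s : R => xi - s) (-1).
    by have := is_deriveB (is_derive_cst xi t 1) (is_derive_id t (1 : R)); rewrite sub0r.
  have := @is_derive1_comp R (f t) (fun s => xi - s) t _ _ (dx t (xi - t)) d3.
  by rewrite mulrN1.
have lim2 : h^-1 *: (f t (xi - (h *: 1 + t)) - f t (xi - t)) @[h --> 0^'] --> - fx t (xi - t).
  by have [d2' <-] := d2; exact: d2'.
have lim1 : h^-1 *: (f (h *: 1 + t) (xi - (h *: 1 + t)) - f t (xi - (h *: 1 + t))) @[h --> 0^'] --> ft t (xi - t).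
  apply/cvgrPdist_lt => e e0.
  have /cvgrPdist_lt /(_ e e0) := ct (t, xi - t).
  case=> [[A1 A2]] /= [/nbhs_ballP[d1 /= d10 dA1] /nbhs_ballP[d2' /= d20 dA2]] HA.
  near=> h.
  have h0 : h != 0 by near: h; exact: nbhs_dnbhs_neq.
  have hd1 : `|h| < d1 by near: h; exact: dnbhs0_lt.
  have hd2 : `|h| < d2' by near: h; exact: dnbhs0_lt.
  have [c ct' ce] := mean_value t (h *: 1 + t) (fun s => dt s (xi - (h *: 1 + t))).
  rewrite ce addrK [h *: 1]mulr1 /GRing.scale /= mulrCA mulVf // mulr1.
  apply: (HA (c, xi - (h + t))); split => /=.
    apply: dA1; rewrite /ball /= distrC; apply: le_lt_trans hd1.
    by move: ct'; rewrite [h *: 1]mulr1 addrK.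
  apply: dA2; rewrite /ball /=.
  by have -> : xi - t - (xi - (h + t)) = h by ring.
have lim : h^-1 *: (f (h *: 1 + t) (xi - (h *: 1 + t)) - f t (xi - t)) @[h --> 0^'] -->
    ft t (xi - t) - fx t (xi - t).
  have -> : (fun h : R => h^-1 *: (f (h *: 1 + t) (xi - (h *: 1 + t)) - f t (xi - t))) =
    (fun h => h^-1 *: (f (h *: 1 + t) (xi - (h *: 1 + t)) - f t (xi - (h *: 1 + t))) +
       h^-1 *: (f t (xi - (h *: 1 + t)) - f t (xi - t))).
    by apply/funext => h; rewrite -scalerDr addrA subrK.
  exact: cvgD.
split; first by apply/cvg_ex; eexists; exact: lim.
by apply/cvg_lim => //; exact: lim.
Unshelve. all: by end_near. Qed.

Lemma continuous2_comp (f : R * R -> R) (a b : R -> R) :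
  continuous f -> continuous a -> continuous b -> continuous (fun t => f (a t, b t)).
Proof.
move=> cf ca cb t.
have h : f (z.1, z.2) @[z --> (a t, b t)] --> f (a t, b t).
  have -> : (fun z : R * R => f (z.1, z.2)) = f by apply/funext => -[].
  exact: cf.
apply: (@continuous2_cvg _ _ _ _ _ _ _ _ (fun x y => f (x, y)) _ _ h); [exact: ca|exact: cb].
Qed.

Lemma continuous2_bounded (f : R * R -> R) (a b c d : R) : continuous f ->
  exists M, forall t x, a <= t <= b -> c <= x <= d -> `|f (t, x)| <= M.
Proof.
move=> cf.
have cK : compact (`[a, b] `*` `[c, d] : set (R * R)).
  by apply: compact_setX; exact: segment_compact.
have := @continuous_compact _ _ f _ (continuous_subspaceT cf) cK.
move=> /compact_bounded[M [_ hM]]; exists (`|M| + 1) => t x tab xcd.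
apply: (hM (`|M| + 1)); first by rewrite (le_lt_trans (ler_norm _)) // ltrDl.
by exists (t, x) => //; split; rewrite /= in_itv.
Qed.

(** Trades a variable domain for a truncated integrand on a fixed one; this is how triangles and
    parallelograms become rectangles before Fubini. *)
Lemma cint_sub (f : R -> C) (a b c d : R) : c <= a -> b <= d ->
  cint `[a, b] f = cint `[c, d] (fun x => if a <= x <= b then f x else 0).
Proof.
move=> ca bd.
have E : `[a, b] = `[c, d] `&` `[a, b] :> set R.
  apply/seteqP; split => x /=; rewrite !in_itv /=; last by case.
  move=> /andP[ax xb]; split; last by rewrite ax.
  by rewrite (le_trans ca ax) (le_trans xb bd).
have P (k : C -> R) : k 0 = 0 ->
    \int[mu]_(x in `[a, b]) k (f x) =
    \int[mu]_(x in `[c, d]) k (if a <= x <= b then f x else 0).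
  move=> k0; rewrite [in LHS]E Rintegral_mkcondr; apply: eq_Rintegral => x _.
  rewrite patchE; case: ifPn => [/set_mem|/negP] /=; rewrite ?in_itv /= => h.
    by rewrite h.
  by case: ifP => // h'; exfalso; apply: h; apply/mem_set; rewrite /= in_itv.
by apply: complex_ext; [exact: (P cre)|exact: (P cim)].
Qed.

Lemma cint_FTC2 (F f : R -> C) (a b : R) : a <= b ->
  (forall x : R, is_derive x (1 : R) (fun y => cre (F y)) (cre (f x))) ->
  (forall x : R, is_derive x (1 : R) (fun y => cim (F y)) (cim (f x))) ->
  continuous (fun x => cre (f x)) -> continuous (fun x => cim (f x)) ->
  cint `[a, b] f = F b - F a.
Proof.
move=> ab d1 d2 c1 c2; apply: complex_ext; rewrite !reimE ?cre_cint ?cim_cint.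
  exact: (Rintegral_FTC2 ab d1).
exact: (Rintegral_FTC2 ab d2).
Qed.

Variables (phi : R -> R -> C) (Hphi : C1fun phi).

(** Minus the derivative of the conjugate of [phi] along the characteristic [t + x = xi]. *)
Definition chi (t x : R) : C := cconj (- pt phi t x + px phi t x).

Lemma phi_is_derive_t_re t x : is_derive t (1 : R) (fun s => cre (phi s x)) (cre (pt phi t x)).
Proof.
have [/(_ t x)[h1 [h2 [h3 h4]]] _] := Hphi.
by apply: (DeriveDef h1); rewrite -derive1E.
Qed.

Lemma phi_is_derive_t_im t x : is_derive t (1 : R) (fun s => cim (phi s x)) (cim (pt phi t x)).
Proof.
have [/(_ t x)[h1 [h2 [h3 h4]]] _] := Hphi.
by apply: (DeriveDef h2); rewrite -derive1E.
Qed.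

Lemma phi_is_derive_x_re t x : is_derive x (1 : R) (fun y => cre (phi t y)) (cre (px phi t x)).
Proof.
have [/(_ t x)[h1 [h2 [h3 h4]]] _] := Hphi.
by apply: (DeriveDef h3); rewrite -derive1E.
Qed.

Lemma phi_is_derive_x_im t x : is_derive x (1 : R) (fun y => cim (phi t y)) (cim (px phi t x)).
Proof.
have [/(_ t x)[h1 [h2 [h3 h4]]] _] := Hphi.
by apply: (DeriveDef h4); rewrite -derive1E.
Qed.

Lemma chi_re_continuous : continuous (fun p : R * R => cre (chi p.1 p.2)).
Proof.
have [_ [_ [_ [h1 [_ [h2 _]]]]]] := Hphi; move=> p.
under eq_fun do rewrite /chi !reimE.
by apply: cvgD; [apply: cvgN; exact: h1|exact: h2].
Qed.

Lemma chi_im_continuous : continuous (fun p : R * R => cim (chi p.1 p.2)).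
Proof.
have [_ [_ [_ [_ [h1 [_ h2]]]]]] := Hphi; move=> p.
under eq_fun do rewrite /chi !reimE.
by apply: cvgN; apply: cvgD; [apply: cvgN; exact: h1|exact: h2].
Qed.

Lemma chi_cmeas : cmeas (fun p : R * R => chi p.1 p.2).
Proof.
by split; apply: continuous2_measurable; [exact: chi_re_continuous|exact: chi_im_continuous].
Qed.

Lemma phi_cmeas : cmeas (fun p : R * R => phi p.1 p.2).
Proof.
have [_ [h1 [h2 _]]] := Hphi.
by split; exact: continuous2_measurable.
Qed.

Lemma norm1_bounded2 (f : R -> R -> C) (a b c d : R) :
  continuous (fun p : R * R => cre (f p.1 p.2)) ->
  continuous (fun p : R * R => cim (f p.1 p.2)) ->
  exists M, forall t x, a <= t <= b -> c <= x <= d -> norm1 (f t x) <= M.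
Proof.
move=> /continuous2_bounded-/(_ a b c d)[M1 h1] /continuous2_bounded-/(_ a b c d)[M2 h2].
exists (M1 + M2) => t x ht hx; rewrite /norm1; apply: lerD.
  exact: (h1 t x).
exact: (h2 t x).
Qed.

Lemma cint_characteristic (xi a b : R) : a <= b ->
  cint `[a, b] (fun t => chi t (xi - t)) =
  cconj (phi a (xi - a)) - cconj (phi b (xi - b)).
Proof.
move=> ab; have [_ [_ [_ [c1 [c2 _]]]]] := Hphi.
apply: (etrans (@cint_FTC2 (fun t => - cconj (phi t (xi - t))) _ a b ab _ _ _ _));
  last by rewrite opprK addrC.
- move=> t; under eq_fun do rewrite !reimE.
  have := is_deriveN (is_derive_characteristic xi t phi_is_derive_t_re phi_is_derive_x_re c1).
  by rewrite /chi !reimE opprD opprK.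
- move=> t; under eq_fun do rewrite !reimE opprK.
  have := is_derive_characteristic xi t phi_is_derive_t_im phi_is_derive_x_im c2.
  by rewrite /chi !reimE opprD opprK.
- apply: (@continuous2_comp (fun p => cre (chi p.1 p.2)) id (fun s => xi - s)).
  + exact: chi_re_continuous.
  + by move=> t; exact: cvg_id.
  + by move=> t; apply: cvgB; [exact: cvg_cst|exact: cvg_id].
- apply: (@continuous2_comp (fun p => cim (chi p.1 p.2)) id (fun s => xi - s)).
  + exact: chi_im_continuous.
  + by move=> t; exact: cvg_id.
  + by move=> t; apply: cvgB; [exact: cvg_cst|exact: cvg_id].
Qed.

Lemma measurable_le_between (d : measure_display) (T : measurableType d) (f g h : T -> R) :
  measurable_fun setT f -> measurable_fun setT g -> measurable_fun setT h ->
  measurable_fun setT (fun t => f t <= g t <= h t).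
Proof.
by move=> mf mg mh; apply: measurable_and; exact: measurable_fun_ler.
Qed.

(** The weak formulation of free transport for [W (t + x)]. In the coordinate [xi = t + x] Fubini
    puts the integral in [t] inside, and along each characteristic [chi] integrates to the
    difference of [phi] at entry and exit. Entries lie at time [s] or at [x = L], exits at time
    [tau] or at [x = 0]. *)
Lemma transport_identity (W : R -> C) (L s tau : R) :
  0 <= L -> s <= tau -> (forall a b, cL1 `[a, b] W) ->
  (forall t, s <= t <= tau -> phi t 0 = 0) ->
  cint `[s, tau] (fun t => cint `[0, L] (fun x => W (t + x) * chi t x)) =
  cint `[0, L] (fun x => W (s + x) * cconj (phi s x))
  + cint `[s, tau] (fun t => W (t + L) * cconj (phi t L))
  - cint `[0, L] (fun x => W (tau + x) * cconj (phi tau x)).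
Proof.
move=> L0 st WL phi0; have mW : cmeas W by have [] := WL 0 0.
have mchi2 : cmeas (fun p : R * R => chi p.1 (p.2 - p.1)).
  apply: (cmeas_comp (k := fun p : R * R => (p.1, p.2 - p.1)) chi_cmeas).
  by apply: measurable_fun_pair => //; exact: measurable_funB.
have [M HM] := norm1_bounded2 s tau 0 L chi_re_continuous chi_im_continuous.
(* In the variables [t, xi] the domain is a parallelogram; [F] extends the integrand by 0 to a
   rectangle. *)
pose F (t xi : R) : C := if t <= xi <= t + L then W xi * chi t (xi - t) else 0.
have -> : cint `[s, tau] (fun t => cint `[0, L] (fun x => W (t + x) * chi t x)) =
    cint `[s, tau] (fun t => cint `[s, tau + L] (F t)).
  apply: eq_cint => t /=; rewrite in_itv /= => /andP[st' tt].
  have tL : t + L <= tau + L by rewrite lerD2r.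
  apply: etrans (@cint_sub (fun xi => W xi * chi t (xi - t)) t (t + L) s (tau + L) st' tL).
  have -> : cint `[t, t + L] (fun xi => W xi * chi t (xi - t)) =
      cint `[0 + t, L + t] (fun xi => W xi * chi t (xi - t)).
    by rewrite add0r addrC.
  rewrite -cint_shift; first by apply: eq_cint => x _; rewrite addrK addrC.
  apply: cmeasM => //.
  exact: (cmeas_comp (k := fun y => (t, y)) mchi2 (pair1_measurable t)).
rewrite (@cfubini_le _ _ _ _ (M * \int[mu]_(x in `[s, tau + L]) norm1 (W x))) //; first last.
- move=> t /=; rewrite in_itv /= => /andP[st' tt].
  have [_ Wi] := WL s (tau + L).
  exists (fun x => M * norm1 (W x)); split; last by rewrite RintegralZl.
    exact: (@integrableZl _ _ _ mu _ _ M _ Wi).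
  move=> xi _; rewrite /F; case: ifPn => [/andP[h1 h2]|_].
    apply: (le_trans (norm1M _ _)); rewrite mulrC; apply: (ler_wpM2r (norm1_ge0 _)).
    by apply: HM; rewrite ?st' // subr_ge0 h1 lerBlDl.
  rewrite norm1_0; apply: (mulr_ge0 _ (norm1_ge0 _)).
  by apply: (le_trans (norm1_ge0 _) (HM t 0 _ _)); rewrite ?st' ?lexx.
- apply: cmeas_if; [|apply: cmeasM => //|exact: cmeas_cst].
    by apply: measurable_le_between => //; exact: measurable_funD.
  exact: cmeas_comp.
- exact: itv_fin.
(* Entry and exit times of the characteristic [t + x = xi]. *)
pose a (xi : R) := Num.max s (xi - L); pose b (xi : R) := Num.min tau xi.
have -> : cint `[s, tau + L] (fun xi => cint `[s, tau] (F^~ xi)) =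
   cint `[s, tau + L] (fun xi => W xi * cconj (phi (a xi) (xi - a xi))
     - W xi * cconj (phi (b xi) (xi - b xi))).
  apply: eq_cint => xi /=; rewrite in_itv /= => /andP[sxi xit].
  have ab : a xi <= b xi.
    by rewrite /a /b ge_max !le_min st sxi !lerBlDr xit lerDl L0.
  rewrite -mulrBr -cint_characteristic // -cintZl //; last first.
    apply: (@cL1_bounded _ _ _ M) => //; first exact: itv_fin.
      exact: (cmeas_comp (k := fun y => (y, xi)) mchi2 (pair2_measurable xi)).
    move=> t /=; rewrite in_itv /= /a /b ge_max le_min => /andP[/andP[h1 h2] /andP[h3 h4]].
    by apply: HM; rewrite ?h1 ?h3 // subr_ge0 h4 lerBlDr -lerBlDl.
  rewrite (@cint_sub _ _ _ s tau) ?/a ?/b ?le_max ?ge_min ?lexx //.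
  apply: eq_cint => t /=; rewrite in_itv /= => /andP[h1 h2].
  by rewrite /F ge_max le_min h1 h2 /= lerBlDr andbC.
have ma : measurable_fun setT a by apply: measurable_maxr => //; exact: measurable_funB.
have mb : measurable_fun setT b by exact: measurable_minr.
have [_ [c1 [c2 _]]] := Hphi.
have [N HN] := norm1_bounded2 s tau 0 L c1 c2.
have La : cL1 `[s, tau + L] (fun xi => W xi * cconj (phi (a xi) (xi - a xi))).
  apply: (@cL1Mb _ _ _ _ N) => //.
    apply: cmeas_conj; apply: (cmeas_comp (k := fun y => (a y, y - a y)) phi_cmeas).
    by apply: measurable_fun_pair => //; exact: measurable_funB.
  move=> xi /=; rewrite in_itv /= norm1_conj => /andP[h1 h2]; apply: HN.
    by rewrite le_max lexx /= ge_max st lerBlDr.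
  by rewrite /a subr_ge0 ge_max h1 lerBlDr lerDl L0 /= lerBlDr addrC -lerBlDr le_max lexx orbT.
have Lb : cL1 `[s, tau + L] (fun xi => W xi * cconj (phi (b xi) (xi - b xi))).
  apply: (@cL1Mb _ _ _ _ N) => //.
    apply: cmeas_conj; apply: (cmeas_comp (k := fun y => (b y, y - b y)) phi_cmeas).
    by apply: measurable_fun_pair => //; exact: measurable_funB.
  move=> xi /=; rewrite in_itv /= norm1_conj => /andP[h1 h2]; apply: HN.
    by rewrite le_min st h1 /= ge_min lexx.
  rewrite /b subr_ge0 ge_min lexx orbT /= lerBlDr addrC -lerBlDr le_min lerBlDr h2 /=.
  by rewrite lerBlDr lerDl.
rewrite cintB //; congr (_ - _).
  have sL : s <= s + L by rewrite lerDl.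
  have sLt : s + L <= tau + L by rewrite lerD2r.
  rewrite (cint_split sL sLt La); congr (_ + _).
    have -> : cint `[s, s + L] (fun xi => W xi * cconj (phi (a xi) (xi - a xi))) =
        cint `[0 + s, L + s] (fun xi => W xi * cconj (phi s (xi - s))).
      rewrite add0r [L + s]addrC; apply: eq_cint => xi /=; rewrite in_itv /= => /andP[h1 h2].
      by rewrite /a max_l // lerBlDr.
    rewrite -cint_shift; first by apply: eq_cint => x _; rewrite addrK addrC.
    apply: cmeasM => //; apply: cmeas_conj.
    by apply: (cmeas_comp2 (T := R) (a := fun y : R => s) (b := fun y : R => y - s) phi_cmeas) => //; exact: measurable_funB.
  have -> : cint `[s + L, tau + L] (fun xi => W xi * cconj (phi (a xi) (xi - a xi))) =
        cint `[s + L, tau + L] (fun xi => W xi * cconj (phi (xi - L) L)).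
    apply: eq_cint => xi /=; rewrite in_itv /= => /andP[h1 h2].
    by rewrite /a max_r ?lerBrDr // subKr.
  rewrite -cint_shift; first by apply: eq_cint => x _; rewrite addrK.
  apply: cmeasM => //; apply: cmeas_conj.
  by apply: (cmeas_comp2 (T := R) (a := fun y : R => y - L) (b := fun y : R => L) phi_cmeas) => //; exact: measurable_funB.
have tauL : tau <= tau + L by rewrite lerDl.
rewrite (cint_split st tauL Lb).
(* For [xi <= tau] the characteristic leaves through [x = 0], where [phi] vanishes. *)
rewrite (_ : cint `[s, tau] _ = 0) ?add0r; last first.
  rewrite -[RHS](cint0 `[s, tau]); apply: eq_cint => xi /=; rewrite in_itv /= => /andP[h1 h2].
  rewrite /b min_r // subrr phi0 ?h1 //; apply: complex_ext; rewrite !reimE; ring.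
have -> : cint `[tau, tau + L] (fun xi => W xi * cconj (phi (b xi) (xi - b xi))) =
        cint `[0 + tau, L + tau] (fun xi => W xi * cconj (phi tau (xi - tau))).
  rewrite add0r [L + tau]addrC; apply: eq_cint => xi /=; rewrite in_itv /= => /andP[h1 h2].
  by rewrite /b min_l.
rewrite -cint_shift; first by apply: eq_cint => x _; rewrite addrK addrC.
apply: cmeasM => //; apply: cmeas_conj.
by apply: (cmeas_comp2 (T := R) (a := fun y : R => tau) (b := fun y : R => y - tau) phi_cmeas) => //; exact: measurable_funB.
Qed.

End Characteristics.

(** * Continuity of translations in L2 *)

Section Translation.
Context {R : realType}.
Local Notation C := (R[i]).
Local Notation mu := (@lebesgue_measure R).

Lemma Rdominated_cvg (D : set R) (f_ : nat -> R -> R) (f g : R -> R) :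
  measurable D -> (forall n, measurable_fun setT (f_ n)) -> measurable_fun setT f ->
  (forall x, D x -> f_ n x @[n --> \oo] --> f x) ->
  mu.-integrable D (EFin \o g) -> (forall n x, D x -> `|f_ n x| <= g x) ->
  \int[mu]_(x in D) f_ n x @[n --> \oo] --> \int[mu]_(x in D) f x.
Proof.
move=> mD mf_ mf f_f ig f_g.
have h1 n : measurable_fun D (fun x => (f_ n x)%:E).
  by apply/measurable_EFinP; exact: measurable_funTS.
have h2 : measurable_fun D (fun x => (f x)%:E).
  by apply/measurable_EFinP; exact: measurable_funTS.
have h3 : {ae mu, forall x, D x -> (f_ n x)%:E @[n --> \oo] --> (f x)%:E}.
  apply: aeW => x Dx; apply/fine_cvgP; split; first exact: nearW.
  exact: f_f.
have h4 : {ae mu, forall x n, D x -> (`|(f_ n x)%:E| <= (g x)%:E)%E}.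
  by apply: aeW => x n Dx; rewrite lee_fin; exact: f_g.
have [fi _ h] := @dominated_convergence _ (measurableTypeR R) R mu D mD _ _ _ h1 h2 h3 ig h4.
apply: fine_cvg; rewrite fineK; last exact: integrable_fin_num.
exact: h.
Qed.

Definition clamp (n y : R) : R := Num.max (- n) (Num.min n y).

Lemma clamp_cases (n y : R) : 0 <= n ->
  [\/ y < - n /\ clamp n y = - n, n < y /\ clamp n y = n | - n <= y <= n /\ clamp n y = y].
Proof.
move=> n0; rewrite /clamp; case: (leP n y) => h1.
  have -> : Num.max (- n) n = n by apply: max_r; lra.
  move: h1; rewrite le_eqVlt => /predU1P[ny|h1]; last by apply: Or32.
  by apply: Or33; split => //; apply/andP; split; lra.
case: (leP (- n) y) => h2; first by apply: Or33; rewrite /= (ltW h1).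
by apply: Or31.
Qed.

Lemma clamp_sub_le (n y : R) : 0 <= n -> `|y - clamp n y| <= `|y|.
Proof.
by move=> n0; case: (clamp_cases y n0) => -[h ->]; case: ger0P => ?; case: ger0P => ?; lra.
Qed.

Lemma clamp_id (n y : R) : `|y| <= n -> clamp n y = y.
Proof.
move=> yn; have n0 : 0 <= n by exact: le_trans yn.
move: yn; rewrite ler_norml => /andP[h1 h2].
by case: (clamp_cases y n0) => -[h ->] //; lra.
Qed.

Lemma clamp_le (n y : R) : 0 <= n -> `|clamp n y| <= n.
Proof.
by move=> n0; case: (clamp_cases y n0) => -[h ->]; rewrite ler_norml; apply/andP; split; lra.
Qed.

Lemma clamp_lip (n y z : R) : 0 <= n -> `|clamp n y - clamp n z| <= `|y - z|.
Proof.
move=> n0; suff H w : - w <= y - z <= w -> `|clamp n y - clamp n z| <= w.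
  by apply: H; rewrite -ler_norml.
move=> /andP[a1 a2]; case: (clamp_cases y n0) => -[h ->]; case: (clamp_cases z n0) => -[h' ->];
  by rewrite ler_norml; apply/andP; split; lra.
Qed.

Lemma clamp_continuous (n : R) : 0 <= n -> continuous (clamp n).
Proof.
move=> n0 y; apply/cvgrPdist_lt => e e0; near=> z.
apply: (le_lt_trans (clamp_lip _ _ n0)); near: z.
exact: cvgr_dist_lt (@cvg_id _ _) e e0.
Unshelve. all: by end_near. Qed.

(** Truncation at a level [n] costs little in L2 by dominated convergence. Between two functions
    bounded by [n] the squared distance is at most [2 * n] times the distance, so an L1
    approximation of the truncated function by continuous ones is enough. *)
Lemma L2_approx_continuous (f : R -> R) (c d e : R) : 0 < e -> measurable_fun setT f ->
  mu.-integrable `[c, d] (EFin \o (fun x => f x ^+ 2)) ->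
  exists k : R -> R, exists N : R, [/\ continuous k, forall x, `|k x| <= N &
    \int[mu]_(x in `[c, d]) (f x - k x) ^+ 2 < e].
Proof.
move=> e0 mf fi; pose E : set R := `[c, d]%classic.
have mE : measurable E by exact: measurable_itv.
have mclamp n (h : R -> R) : 0 <= n -> measurable_fun setT h -> measurable_fun setT (fun x => clamp n (h x)).
  move=> n0 mh; apply: (measurableT_comp _ mh).
  exact: continuous_measurable_fun (clamp_continuous n0).
have [n n0 hn] : exists2 n : R, 0 < n & \int[mu]_(x in E) (f x - clamp n (f x)) ^+ 2 < e / 4.
  have H : \int[mu]_(x in E) (f x - clamp n%:R (f x)) ^+ 2 @[n --> \oo] --> \int[mu]_(x in E) (0 : R).
    apply: (@Rdominated_cvg _ _ _ (fun x => f x ^+ 2)) => //.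
    - move=> n; apply: measurable_funX; apply: measurable_funB => //.
      exact: mclamp.
    - move=> x _; apply: cvg_near_cst; near=> n.
      rewrite clamp_id ?subrr ?expr0n //.
      by near: n; exact: nbhs_infty_ger.
    - move=> n x _; rewrite ger0_norm ?sqr_ge0 // -[leLHS]real_normK ?num_real // -[leRHS]real_normK ?num_real //.
      by rewrite ler_pXn2r ?nnegrE //; exact: clamp_sub_le.
  have R0 : \int[mu]_(x in E) (0 : R) = 0 by rewrite /Rintegral integral0.
  rewrite R0 in H; have e4 : 0 < e / 4 by rewrite divr_gt0.
  have /cvgrPdist_lt /(_ _ e4) [m _ hm] := H.
  exists m.+1%:R => //.
  have := hm m.+1 (leqnSn m); rewrite /= sub0r normrN; apply: le_lt_trans; exact: ler_norm.
have En : (mu E < +oo)%E by exact: itv_fin.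
have fni : mu.-integrable E (EFin \o (fun x => clamp n (f x))).
  apply: le_integrable (integrable_cst_fin n _ En) => //.
    by apply/measurable_EFinP; apply: measurable_funTS; apply: mclamp => //; exact: ltW.
  by move=> x _; rewrite lee_fin (le_trans (clamp_le _ (ltW n0))) // ler_norm.
have [k_ [ck ki kc]] := approximation_continuous_integrable mE En fni.
(* The two errors enter the final bound as [2 * (e / 4)] and [2 * (2 * n * (e / (8 * n)))], that is
   [e / 2] each. *)
have e8 : (0 < (e / (8 * n)))%R by rewrite divr_gt0 // mulr_gt0.
have ki' m : mu.-integrable E (EFin \o (fun x => `|clamp n (f x) - k_ m x|)).
  have i0 : mu.-integrable E (EFin \o (fun x => clamp n (f x) - k_ m x)).
    exact: (integrableB _ fni (ki m)).
  exact: (integrable_norm i0).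
have kc' : \int[mu]_(x in E) `|clamp n (f x) - k_ m x| @[m --> \oo] --> 0.
  by apply: fine_cvg; exact: kc.
have /cvgrPdist_lt /(_ _ e8) [m _ hm] := kc'.
have {hm} hm : \int[mu]_(x in E) `|clamp n (f x) - k_ m x| < e / (8 * n).
  have := hm m (leqnn m); rewrite /= sub0r normrN; apply: le_lt_trans; exact: ler_norm.
have n0' := ltW n0.
(* Clamping the approximant makes it bounded and does not increase its distance to the truncated
   function. *)
exists (fun x => clamp n (k_ m x)), n; split.
- by move=> x; apply: continuous_comp; [exact: ck|exact: clamp_continuous].
- by move=> x; exact: clamp_le.
have mk : measurable_fun setT (k_ m) by exact: continuous_measurable_fun.
have i1 : mu.-integrable E (EFin \o (fun x => (f x - clamp n (f x)) ^+ 2)).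
  apply: le_integrable fi => //.
    apply/measurable_EFinP; apply: measurable_funTS; apply: measurable_funX.
    by apply: measurable_funB => //; exact: mclamp.
  move=> x _; rewrite lee_fin !ger0_norm ?sqr_ge0 // -[leLHS]real_normK ?num_real // -[leRHS]real_normK ?num_real //.
  by rewrite ler_pXn2r ?nnegrE //; exact: clamp_sub_le.
have i2 : mu.-integrable E (EFin \o (fun x => 2 * n * `|clamp n (f x) - k_ m x|)).
  exact: (@integrableZl _ _ _ mu _ _ (2 * n) _ (ki' m)).
have i3 : mu.-integrable E (EFin \o (fun x => 2 * (f x - clamp n (f x)) ^+ 2)).
  exact: (@integrableZl _ _ _ mu _ _ 2 _ i1).
have i4 : mu.-integrable E (EFin \o (fun x => 2 * (2 * n * `|clamp n (f x) - k_ m x|))).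
  exact: (@integrableZl _ _ _ mu _ _ 2 _ i2).
have P x : (f x - clamp n (k_ m x)) ^+ 2 <=
    2 * (f x - clamp n (f x)) ^+ 2 + 2 * (2 * n * `|clamp n (f x) - k_ m x|).
  have h1 := clamp_lip (f x) (k_ m x) n0'.
  have h2 : (clamp n (f x) - clamp n (k_ m x)) ^+ 2 <= 2 * n * `|clamp n (f x) - clamp n (k_ m x)|.
    rewrite -[leLHS]real_normK ?num_real // expr2; apply: ler_wpM2r => //.
    apply: (le_trans (ler_normB _ _)); rewrite mulr_natl mulr2n.
    by apply: lerD; exact: clamp_le.
  have h3 : 2 * n * `|clamp n (f x) - clamp n (k_ m x)| <= 2 * n * `|f x - k_ m x|.
    by apply: ler_wpM2l => //; rewrite mulr_ge0.
  have h4 := clamp_lip (clamp n (f x)) (k_ m x) n0'.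
  rewrite (@clamp_id n (clamp n (f x))) ?clamp_le // in h4.
  have h5 : 2 * n * `|clamp n (f x) - clamp n (k_ m x)| <= 2 * n * `|clamp n (f x) - k_ m x|.
    by apply: ler_wpM2l => //; rewrite mulr_ge0.
  move: h2 h5; move: (clamp n (f x)) (clamp n (k_ m x)) => p q h2 h5.
  have := sqr_ge0 (f x - p - (p - q)); nra.
apply: (@le_lt_trans _ _ (\int[mu]_(x in E)
    (2 * (f x - clamp n (f x)) ^+ 2 + 2 * (2 * n * `|clamp n (f x) - k_ m x|)))).
  apply: le_Rintegral => //.
  - apply: le_integrable (integrableD _ i3 i4) => //.
      apply/measurable_EFinP; apply: measurable_funTS; apply: measurable_funX.
      by apply: measurable_funB => //; exact: mclamp.
    move=> x _; rewrite lee_fin ger0_norm ?sqr_ge0 //; apply: le_trans (P x) _.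
    exact: ler_norm.
  - exact: (integrableD _ i3 i4).
rewrite RintegralD // !RintegralZl //.
have : 2 * n * \int[mu]_(x in E) `|clamp n (f x) - k_ m x| < 2 * n * (e / (8 * n)).
  by rewrite ltr_pM2l // mulr_gt0.
have -> : 2 * n * (e / (8 * n)) = e / 4 by field; rewrite gt_eqF.
move: hn; lra.
Unshelve. all: by end_near. Qed.

(** A bounded continuous [k] close to [f] in L2 is translated instead, by dominated convergence. The
    three errors are below [e / 12] and are each multiplied by 3, for a total below [e]. *)
Lemma L2_translation (f : R -> R) (c d e : R) : 0 < e -> measurable_fun setT f ->
  (forall a b, mu.-integrable `[a, b] (EFin \o (fun x => f x ^+ 2))) ->
  exists2 del : R, 0 < del & forall eta : R, `|eta| < del ->
    \int[mu]_(x in `[c, d]) (f (x + eta) - f x) ^+ 2 < e.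
Proof.
move=> e0 mf fi; have e12 : 0 < e / 12 by rewrite divr_gt0.
(* A margin of 1 on both sides keeps the translated interval inside the one where [k] is close to
   [f]. *)
have [k [N [ck kN hk]]] := L2_approx_continuous e12 mf (fi (c - 1) (d + 1)).
have N0 : 0 <= N by exact: le_trans (kN 0).
have mk : measurable_fun setT k by exact: continuous_measurable_fun.
have msh (h : R -> R) (eta : R) : measurable_fun setT h -> measurable_fun setT (fun x : R => h (x + eta)).
  by move=> mh; apply: (measurableT_comp mh); exact: measurable_funD.
have fki a b : mu.-integrable `[a, b] (EFin \o (fun x => (f x - k x) ^+ 2)).
  have i1 := fi a b.
  have i2 : mu.-integrable `[a, b] (EFin \o (fun x => 2 * f x ^+ 2)).
    exact: (@integrableZl _ _ _ mu _ _ 2 _ i1).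
  have i3 := integrable_cst_itv (2 * N ^+ 2) a b.
  apply: le_integrable (integrableD _ i2 i3) => //.
    apply/measurable_EFinP; apply: measurable_funTS; apply: measurable_funX.
    exact: measurable_funB.
  move=> x _; rewrite lee_fin ger0_norm ?sqr_ge0 //; apply: (le_trans _ (ler_norm _)).
  have := kN x; rewrite -ler_sqr ?nnegrE // real_normK ?num_real // => h.
  have := sqr_ge0 (f x + k x); rewrite /=; nra.
have kc : \int[mu]_(x in `[c, d]) (k (x + eta) - k x) ^+ 2 @[eta --> (0 : R)] --> (0 : R).
  apply/(@cvg_nbhsP _ R^o) => u u0.
  have -> : 0 = \int[mu]_(x in `[c, d]) (0 : R) by rewrite /Rintegral integral0.
  apply: (@Rdominated_cvg _ _ _ (fun _ => (2 * N) ^+ 2)) => //.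
  - move=> n; apply: measurable_funX; apply: measurable_funB => //; exact: msh.
  - move=> x _.
    have h1 : x + u n @[n --> \oo] --> x + 0 by apply: cvgD; [exact: cvg_cst|exact: u0].
    have h2 : k (x + u n) @[n --> \oo] --> k (x + 0) by exact: (cvg_comp _ _ h1 (ck _)).
    have h3 : k (x + u n) - k x @[n --> \oo] --> k (x + 0) - k x.
      by apply: cvgB => //; exact: cvg_cst.
    have e00 : (k (x + 0) - k x) ^+ 2 = 0 by rewrite addr0 subrr expr0n.
    have h4 : (k (x + u n) - k x) ^+ 2 @[n --> \oo] --> (k (x + 0) - k x) ^+ 2.
      exact: (cvgM h3 h3).
    by rewrite e00 in h4.
  - exact: integrable_cst_itv.
  - move=> n x _; rewrite ger0_norm ?sqr_ge0 // -[leLHS]real_normK ?num_real //.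
    rewrite ler_pXn2r ?nnegrE ?mulr_ge0 //.
    by apply: (le_trans (ler_normB _ _)); rewrite mulr_natl mulr2n; exact: lerD.
have /cvgrPdist_lt /(_ _ e12) [del /= del0 hdel] := kc.
exists (Num.min del 1); first by rewrite lt_min del0 ltr01.
move=> eta; rewrite lt_min => /andP[etad eta1].
have {hdel} hd : \int[mu]_(x in `[c, d]) (k (x + eta) - k x) ^+ 2 < e / 12.
  have := hdel eta; rewrite /ball /= sub0r normrN => /(_ etad).
  by rewrite sub0r normrN; apply: le_lt_trans; exact: ler_norm.
have sub (a b : R) : c - 1 <= a -> b <= d + 1 ->
    \int[mu]_(x in `[a, b]) (f x - k x) ^+ 2 < e / 12.
  move=> ca bd; apply: le_lt_trans hk.
  rewrite /Rintegral fine_le //; [exact: integrable_fin_num (fki _ _)..|].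
  apply: ge0_subset_integral => //.
  - by apply/measurable_EFinP; apply: measurable_funTS; apply: measurable_funX; exact: measurable_funB.
  - by move=> x _; rewrite lee_fin sqr_ge0.
  - by apply: subset_itv; rewrite bnd_simp.
move: eta1; rewrite ltr_norml => /andP[eta1 eta2].
have s1 : \int[mu]_(x in `[c, d]) (f (x + eta) - k (x + eta)) ^+ 2 < e / 12.
  rewrite (@Rintegral_shift _ (fun x => (f x - k x) ^+ 2)); last first.
    by apply: measurable_funX; exact: measurable_funB.
  by apply: sub; lra.
have s2 : \int[mu]_(x in `[c, d]) (f x - k x) ^+ 2 < e / 12 by apply: sub; lra.
have i1 : mu.-integrable `[c, d] (EFin \o (fun x => 3 * (f (x + eta) - k (x + eta)) ^+ 2)).
  apply: RintegrableZ => //; apply: (@Rintegrable_shift _ (fun x => (f x - k x) ^+ 2)) => //.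
  by apply: measurable_funX; exact: measurable_funB.
have i2 : mu.-integrable `[c, d] (EFin \o (fun x => 3 * (f x - k x) ^+ 2)).
  exact: (@integrableZl _ _ _ mu _ _ 3 _ (fki c d)).
have i3' : mu.-integrable `[c, d] (EFin \o (fun x => (k (x + eta) - k x) ^+ 2)).
  apply: le_integrable (integrable_cst_itv ((2 * N) ^+ 2) c d) => //.
    apply/measurable_EFinP; apply: measurable_funTS; apply: measurable_funX.
    by apply: measurable_funB => //; exact: msh.
  move=> x _; rewrite lee_fin !ger0_norm ?sqr_ge0 // -[leLHS]real_normK ?num_real //.
  rewrite ler_pXn2r ?nnegrE ?mulr_ge0 //.
  by apply: (le_trans (ler_normB _ _)); rewrite mulr_natl mulr2n; exact: lerD.
have i3 : mu.-integrable `[c, d] (EFin \o (fun x => 3 * (k (x + eta) - k x) ^+ 2)).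
  exact: (@integrableZl _ _ _ mu _ _ 3 _ i3').
have i12 : mu.-integrable `[c, d] (EFin \o (fun x => 3 * (f (x + eta) - k (x + eta)) ^+ 2
    + 3 * (f x - k x) ^+ 2)).
  exact: (integrableD _ i1 i2).
have P x : (f (x + eta) - f x) ^+ 2 <= 3 * (f (x + eta) - k (x + eta)) ^+ 2 + 3 * (f x - k x) ^+ 2
    + 3 * (k (x + eta) - k x) ^+ 2.
  move: (f (x + eta)) (f x) (k (x + eta)) (k x) => A B p q.
  have := sqr_ge0 ((A - p) + (B - q)); have := sqr_ge0 ((A - p) - (p - q)).
  have := sqr_ge0 ((B - q) + (p - q)); nra.
apply: (@le_lt_trans _ _ (\int[mu]_(x in `[c, d]) (3 * (f (x + eta) - k (x + eta)) ^+ 2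
    + 3 * (f x - k x) ^+ 2 + 3 * (k (x + eta) - k x) ^+ 2))).
  have i123 : mu.-integrable `[c, d] (EFin \o (fun x => 3 * (f (x + eta) - k (x + eta)) ^+ 2
    + 3 * (f x - k x) ^+ 2 + 3 * (k (x + eta) - k x) ^+ 2)).
    exact: (integrableD _ i12 i3).
  apply: le_Rintegral => //.
  apply: le_integrable i123 => //.
    apply/measurable_EFinP; apply: measurable_funTS; apply: measurable_funX.
    by apply: measurable_funB => //; exact: msh.
  by move=> x _; rewrite lee_fin ger0_norm ?sqr_ge0 //; apply: le_trans (P x) (ler_norm _).
have z1 : mu.-integrable `[c, d] (EFin \o (fun x => (f (x + eta) - k (x + eta)) ^+ 2)).
  apply: (@Rintegrable_shift _ (fun x => (f x - k x) ^+ 2)) => //.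
  by apply: measurable_funX; exact: measurable_funB.
rewrite RintegralD // RintegralD // !RintegralZl //.
move: s1 s2 hd; lra.
Qed.

Lemma cL2_translation (f : R -> C) (c d e : R) : 0 < e -> cmeas f ->
  (forall a b, mu.-integrable `[a, b] (fun x => (cabs2 (f x))%:E)) ->
  exists2 del : R, 0 < del & forall eta : R, `|eta| < del ->
    \int[mu]_(x in `[c, d]) cabs2 (f (x + eta) - f x) < e.
Proof.
move=> e0 [m1 m2] fi; have e2 : 0 < e / 2 by rewrite divr_gt0.
have i1 a b : mu.-integrable `[a, b] (EFin \o (fun x => cre (f x) ^+ 2)).
  apply: le_integrable (fi a b) => //.
    by apply/measurable_EFinP; apply: measurable_funTS; exact: measurable_funX.
  move=> x _; rewrite lee_fin [leRHS]ger0_norm ?cabs2_ge0 // ger0_norm ?sqr_ge0 //.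
  by rewrite lerDl sqr_ge0.
have i2 a b : mu.-integrable `[a, b] (EFin \o (fun x => cim (f x) ^+ 2)).
  apply: le_integrable (fi a b) => //.
    by apply/measurable_EFinP; apply: measurable_funTS; exact: measurable_funX.
  move=> x _; rewrite lee_fin [leRHS]ger0_norm ?cabs2_ge0 // ger0_norm ?sqr_ge0 //.
  by rewrite lerDr sqr_ge0.
have [d1 d10 h1] := L2_translation c d e2 m1 i1.
have [d2 d20 h2] := L2_translation c d e2 m2 i2.
exists (Num.min d1 d2); first by rewrite lt_min d10.
move=> eta; rewrite lt_min => /andP[/h1 {}h1 /h2 {}h2].
have shi (k : R -> R) : measurable_fun setT k ->
  (forall a b, mu.-integrable `[a, b] (EFin \o (fun x => k x ^+ 2))) ->
  mu.-integrable `[c, d] (EFin \o (fun x => (k (x + eta) - k x) ^+ 2)).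
  move=> mk ki.
  have mks : measurable_fun setT (fun x : R => k (x + eta)).
    by apply: (measurableT_comp mk); exact: measurable_funD.
  have s1 : mu.-integrable `[c, d] (EFin \o (fun x => k (x + eta) ^+ 2)).
    by apply: (@Rintegrable_shift _ (fun x => k x ^+ 2)) => //; exact: measurable_funX.
  have s2 := RintegrableZ 2 (measurable_itv `[c, d]%R) s1.
  have s3 := RintegrableZ 2 (measurable_itv `[c, d]%R) (ki c d).
  apply: Rintegrable_le (RintegrableD _ s2 s3) _ => //.
    by apply: measurable_funX; exact: measurable_funB.
  move=> x _; rewrite ger0_norm ?sqr_ge0 //.
  have := sqr_ge0 (k (x + eta) + k x); nra.
have -> : \int[mu]_(x in `[c, d]) cabs2 (f (x + eta) - f x) =
  \int[mu]_(x in `[c, d]) (cre (f (x + eta)) - cre (f x)) ^+ 2 +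
  \int[mu]_(x in `[c, d]) (cim (f (x + eta)) - cim (f x)) ^+ 2.
  rewrite -RintegralD //; [|exact: shi..].
  by apply: eq_Rintegral => x _; rewrite /cabs2 !reimE.
by move: h1 h2; lra.
Qed.

End Translation.

(** * The Duhamel term and the weak solution built from it *)

Section Duhamel.
Context {R : realType}.
Local Notation C := (R[i]).
Local Notation mu := (@lebesgue_measure R).

(** Half-open on the right: consecutive pieces glue without overlap, and [gt] vanishes at [L]
    itself, hence on the inflow boundary at every time. *)
Definition cut (a b : R) (f : R -> C) (x : R) : C := if a <= x < b then f x else 0.

Lemma cL2_cut_cmeas (a b : R) (f : R -> C) : cL2 a b f -> cmeas (cut a b f).
Proof.
move=> [m1 [m2 _]].
have P (k : C -> R) : k 0 = 0 -> measurable_fun `[a, b] (fun x => k (f x)) ->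
    measurable_fun setT (fun x => k (cut a b f x)).
  move=> k0 mk; have mk' : measurable_fun `[a, b[ (fun x => k (f x)).
    by apply: measurable_funS mk => //; apply: subset_itvl; rewrite bnd_simp.
  have := (measurable_restrictT _ (measurable_itv `[a, b[%R)).1 mk'.
  apply: eq_measurable_fun => x _; rewrite patchE /cut.
  case: ifPn => [/set_mem|/negP] /=; rewrite ?in_itv /= => h.
    by rewrite h.
  by case: ifP => // h'; exfalso; apply: h; apply/mem_set; rewrite /= in_itv.
by split; [exact: (P cre)|exact: (P cim)].
Qed.

Lemma cL2_cut_cabs2 (a b : R) (f : R -> C) : cL2 a b f ->
  mu.-integrable setT (EFin \o (fun x => cabs2 (cut a b f x))).
Proof.
move=> hf; have [_ [_ fi]] := hf.
have mcut := cL2_cut_cmeas hf.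
have h : mu.-integrable setT ((fun x => (cabs2 (f x))%:E) \_ `[a, b]).
  exact: ((@integrable_mkcond _ (measurableTypeR R) R mu _ _ (measurable_itv `[a, b]%R)).1 fi).
apply: le_integrable h => //.
  by apply/measurable_EFinP; exact: measurable_cabs2.
move=> x _; rewrite /= patchE /cut; case: ifPn => [/andP[h1 h2]|_].
  by rewrite mem_set //= in_itv /= h1 ltW.
by rewrite cabs2_0 normr0; exact: abse_ge0.
Qed.

Lemma cL2_cut_cL1 (a b : R) (f : R -> C) : cL2 a b f -> cL1 setT (cut a b f).
Proof.
move=> hf; have mcut := cL2_cut_cmeas hf; have fi := cL2_cut_cabs2 hf.
have h : mu.-integrable setT ((EFin \o (fun _ => 1)) \_ `[a, b]).
  exact: ((@integrable_mkcond _ (measurableTypeR R) R mu _ _ (measurable_itv `[a, b]%R)).1 (integrable_cst_itv 1 a b)).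
have hs := integrableD measurableT h fi.
split => //; apply: le_integrable hs => //.
  by apply/measurable_EFinP; exact: measurable_norm1.
move=> x _; rewrite /= patchE /cut; case: ifPn => [/andP[h1 h2]|_].
  rewrite mem_set /=; last by rewrite in_itv /= h1 ltW.
  rewrite lee_fin ger0_norm ?norm1_ge0 //; apply: le_trans (ler_norm _).
  by have := norm1_le_young (f x) ltr01; rewrite invr1 mul1r.
by rewrite norm1_0 normr0; exact: abse_ge0.
Qed.

Lemma cint_eq_co (a b : R) (f f' : R -> C) : cmeas f -> cmeas f' ->
  (forall x, a <= x < b -> f x = f' x) -> cint `[a, b] f = cint `[a, b] f'.
Proof.
move=> [m1 m2] [m1' m2'] E.
have P (k : C -> R) : measurable_fun setT (fun x => k (f x)) -> measurable_fun setT (fun x => k (f' x)) ->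
    \int[mu]_(x in `[a, b]) k (f x) = \int[mu]_(x in `[a, b]) k (f' x).
  move=> n1 n2; rewrite /Rintegral -!integral_itv_bndo_bndc; last 2 first.
  - by apply/measurable_EFinP; exact: measurable_funTS.
  - by apply/measurable_EFinP; exact: measurable_funTS.
  congr fine; apply: eq_integral => x /set_mem /=; rewrite in_itv /= => h.
  by rewrite E.
by apply: complex_ext; [exact: (P cre)|exact: (P cim)].
Qed.

(** The data are measurable on [[a, b]] only. This version is measurable on the whole line and
    agrees with [f] at every point of the closed interval, so it replaces [f] under an integral by
    pointwise equality. *)
Definition cutc (a b : R) (f : R -> C) (x : R) : C := if x == b then f b else cut a b f x.

Lemma cutcE (a b x : R) (f : R -> C) : a <= x <= b -> cutc a b f x = f x.
Proof.
move=> /andP[ax xb]; rewrite /cutc /cut ax /= lt_neqAle xb andbT.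
by case: eqVneq => [->|].
Qed.

Lemma cL2_cutc_cmeas (a b : R) (f : R -> C) : cL2 a b f -> cmeas (cutc a b f).
Proof.
move=> hf; apply: cmeas_if; [exact: measurable_fun_eqr|exact: cmeas_cst|exact: cL2_cut_cmeas].
Qed.

Lemma cL1_shift (f : R -> C) (a b c : R) : cL1 `[a + c, b + c] f -> cL1 `[a, b] (fun x => f (x + c)).
Proof.
move=> [mf fi]; split.
  by apply: (cmeas_comp mf); exact: measurable_funD.
apply: (@Rintegrable_shift _ (fun x => norm1 (f x))) => //.
exact: measurable_norm1.
Qed.

Lemma cL1_reflect (f : R -> C) (a b c : R) : cL1 `[c - b, c - a] f -> cL1 `[a, b] (fun x => f (c - x)).
Proof.
move=> [mf fi]; split.
  by apply: (cmeas_comp mf); exact: measurable_funB.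
apply: (@Rintegrable_reflect _ (fun x => norm1 (f x))) => //.
exact: measurable_norm1.
Qed.

Lemma Rintegral_le_setT (k : R -> R) (D : set R) : measurable D -> measurable_fun setT k ->
  (forall x, 0 <= k x) -> mu.-integrable setT (EFin \o k) ->
  \int[mu]_(x in D) k x <= \int[mu]_x k x.
Proof.
move=> mD mk k0 ki; rewrite /Rintegral fine_le //.
- by apply: integrable_fin_num => //; exact: integrableS ki.
- exact: integrable_fin_num.
- apply: ge0_subset_integral => //; first exact/measurable_EFinP.
  by move=> x _; rewrite lee_fin.
Qed.

Variables (L : R) (g : R -> C).
Hypotheses (L0 : 0 < L) (Hg : cL2 0 L g).

Definition gt : R -> C := cut 0 L g.

Definition normg := \int[mu]_x norm1 (gt x).

Lemma gt_cmeas : cmeas gt. Proof. exact: cL2_cut_cmeas. Qed.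

Lemma gt_cL1 D : measurable D -> cL1 D gt.
Proof. by move=> mD; apply: (cL1S measurableT) => //; exact: cL2_cut_cL1. Qed.

Lemma gt_out x : ~~ (0 <= x < L) -> gt x = 0.
Proof. by move=> /negbTE h; rewrite /gt /cut h. Qed.

Lemma normg_ge0 : 0 <= normg.
Proof. by apply: Rintegral_ge0 => x _; exact: norm1_ge0. Qed.

Lemma normg_shift (a b c : R) : \int[mu]_(x in `[a, b]) norm1 (gt (x + c)) <= normg.
Proof.
have mn : measurable_fun setT (fun x => norm1 (gt x)) by apply: measurable_norm1; exact: gt_cmeas.
rewrite (@Rintegral_shift _ (fun x => norm1 (gt x))) //.
apply: Rintegral_le_setT.
- exact: measurable_itv.
- exact: mn.
- by move=> x; exact: norm1_ge0.
- by have [] := gt_cL1 measurableT.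
Qed.

Lemma normg_reflect (a b c : R) : \int[mu]_(x in `[a, b]) norm1 (gt (c - x)) <= normg.
Proof.
have mn : measurable_fun setT (fun x => norm1 (gt x)) by apply: measurable_norm1; exact: gt_cmeas.
rewrite (@Rintegral_reflect _ (fun x => norm1 (gt x))) //.
apply: Rintegral_le_setT.
- exact: measurable_itv.
- exact: mn.
- by move=> x; exact: norm1_ge0.
- by have [] := gt_cL1 measurableT.
Qed.

Lemma gt_cL1_shift (a b c : R) : cL1 `[a, b] (fun x => gt (x + c)).
Proof. by apply: cL1_shift; exact: gt_cL1. Qed.

Lemma gt_cL1_reflect (a b c : R) : cL1 `[a, b] (fun x => gt (c - x)).
Proof. by apply: cL1_reflect; exact: gt_cL1. Qed.

(** The nonlocal term of the adjoint carries [g], known only on [[0, L]]; this moves it to [gt],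
    measurable everywhere. The two may differ at [L], a null set. *)
Lemma adjoint_integral (f : R -> C) (N : R) : cmeas f ->
  (forall x, 0 <= x <= L -> norm1 (f x) <= N) ->
  cconj (cint `[0, L] (fun y => cconj (g y) * f y)) = cint `[0, L] (fun y => gt y * cconj (f y)).
Proof.
move=> mf fN; have mf' := cmeas_conj mf.
transitivity (cconj (cint `[0, L] (fun y => cconj (gt y * cconj (f y))))).
  congr cconj; transitivity (cint `[0, L] (fun y => cconj (cutc 0 L g y * cconj (f y)))).
    by apply: eq_cint => y /=; rewrite in_itv /= => y0L; rewrite cutcE // cconjM cconjK.
  apply: cint_eq_co.
  - by apply: cmeas_conj; apply: cmeasM => //; exact: cL2_cutc_cmeas.
  - by apply: cmeas_conj; apply: cmeasM => //; exact: gt_cmeas.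
  - move=> y /andP[y0 yL]; rewrite cutcE ?y0 ?ltW //.
    by rewrite /gt /cut y0 yL.
rewrite cint_conj ?cconjK //.
apply: (@cL1Mb _ _ _ _ N) => //; first exact: gt_cL1.
by move=> x /=; rewrite in_itv /= norm1_conj => x0L; exact: fN.
Qed.

Lemma convolution_swap (k chi : R -> C) (a b c H M : R) :
  cmeas k -> (forall s, 0 <= s <= L -> norm1 (k s) <= H) ->
  cmeas chi -> (forall x, a <= x <= b -> norm1 (chi x) <= M) ->
  cint `[a, b] (fun x => cint `[0, L] (fun s => k s * gt (x + c - s)) * chi x) =
  cint `[0, L] (fun s => k s * cint `[a, b] (fun x => gt (x + c - s) * chi x)).
Proof.
move=> mk kH mchi chiM.
have I1 x : cL1 `[0, L] (fun s => k s * gt (x + c - s)).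
  apply: (@cL1Mbl _ _ (fun s => gt (x + c - s)) k H) => //; exact: gt_cL1_reflect.
have I2 s : cL1 `[a, b] (fun x => gt (x + c - s) * chi x).
  apply: (@cL1Mb _ _ _ _ M) => //.
  have := gt_cL1_shift a b (c - s).
  by rewrite (_ : (fun x : R => gt (x + (c - s))) = (fun x : R => gt (x + c - s))) //;
    apply/funext => x; rewrite addrA.
transitivity (cint `[a, b] (fun x => cint `[0, L] (fun s => k s * gt (x + c - s) * chi x))).
  by apply: eq_cint => x _; rewrite -cintZr.
rewrite (@cfubini_le _ _ _ _ (H * M * normg)) //; first last.
- move=> x /=; rewrite in_itv /= => xab.
  have H0 : 0 <= H by apply: (le_trans (norm1_ge0 _) (kH 0 _)); rewrite lexx ltW.
  have M0 : 0 <= M by apply: (le_trans (norm1_ge0 _) (chiM x _)).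
  have [_ gi] := gt_cL1_reflect 0 L (x + c).
  exists (fun s => H * M * norm1 (gt (x + c - s))); split.
  + exact: RintegrableZ.
  + move=> s /=; rewrite in_itv /= => s0L.
    apply: (le_trans (norm1M _ _)); rewrite mulrAC.
    apply: ler_pM => //; [exact: norm1_ge0|exact: norm1_ge0| |exact: chiM].
    apply: (le_trans (norm1M _ _)); apply: ler_wpM2r; [exact: norm1_ge0|exact: kH].
  + rewrite RintegralZl //; apply: ler_wpM2l; first by rewrite mulr_ge0.
    exact: normg_reflect.
- apply: cmeasM; last by apply: (cmeas_comp mchi).
  apply: cmeasM; first by apply: (cmeas_comp mk).
  apply: (cmeas_comp gt_cmeas); apply: measurable_funB => //.
  exact: measurable_funD.
- exact: itv_fin.
apply: eq_cint => s _; rewrite -cintZl //.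
by apply: eq_cint => x _; rewrite mulrA.
Qed.

Variables (h : R -> C) (H : R).
Hypotheses (mh : cmeas h) (hH : forall s, norm1 (h s) <= H).

(** Causality written into the integrand, so that the Duhamel integral over [[0, t]] has the fixed
    domain [[0, L]] for every [t] in [[0, L]]. *)
Definition hcut (t s : R) : C := if s <= t then h s else 0.

Lemma hcut_cmeas2 : cmeas (fun p : R * R => hcut p.1 p.2).
Proof.
apply: cmeas_if; [exact: measurable_fun_ler|exact: (cmeas_comp mh)|exact: cmeas_cst].
Qed.

Lemma hcut_cmeas t : cmeas (hcut t).
Proof.
apply: cmeas_if; [exact: measurable_fun_ler|by []|exact: cmeas_cst].
Qed.

Lemma H_ge0 : 0 <= H. Proof. exact: le_trans (norm1_ge0 _) (hH 0). Qed.

Lemma hcut_le t s : norm1 (hcut t s) <= H.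
Proof. by rewrite /hcut; case: ifP => // _; rewrite norm1_0 H_ge0. Qed.

(** Superposition of pulses: the profile [gt] emitted at time [s] with amplitude [h s] has moved
    left by [t - s] at time [t]. *)
Definition duh (t x : R) : C := cint `[0, L] (fun s => hcut t s * gt (x + t - s)).

Lemma duh_cmeas2 : cmeas (fun p : R * R => duh p.1 p.2).
Proof.
apply: (@cmeas_cint _ _ _ _ (fun (p : R * R) s => hcut p.1 s * gt (p.2 + p.1 - s))) => //.
apply: cmeasM.
  apply: (cmeas_comp2 hcut_cmeas2 (a := fun p : (R * R) * R => p.1.1) (b := fun p => p.2)).
    exact: measurableT_comp.
  exact: measurable_snd.
apply: (cmeas_comp gt_cmeas); apply: measurable_funB => //.
by apply: measurable_funD; exact: measurableT_comp.
Qed.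

Lemma duh_cmeas t : cmeas (duh t).
Proof. exact: (cmeas_comp2 duh_cmeas2 (a := fun _ : R => t) (b := id)). Qed.

Lemma duh_integrand_cL1 t x : cL1 `[0, L] (fun s => hcut t s * gt (x + t - s)).
Proof.
apply: (@cL1Mbl _ _ (fun s => gt (x + t - s)) (hcut t) H) => //.
- exact: gt_cL1_reflect.
- exact: hcut_cmeas.
- by move=> s _; exact: hcut_le.
Qed.

Lemma duh_le t x : norm1 (duh t x) <= H * normg.
Proof.
have [_ gi] := gt_cL1_reflect 0 L (x + t).
apply: (@le_trans _ _ (\int[mu]_(s in `[0, L]) (H * norm1 (gt (x + t - s))))).
  apply: norm1_cint_le => //.
  - by have [] := duh_integrand_cL1 t x.
  - exact: RintegrableZ.
  - move=> s _; apply: (le_trans (norm1M _ _)); apply: ler_wpM2r; [exact: norm1_ge0|exact: hcut_le].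
rewrite RintegralZl //; apply: ler_wpM2l; [exact: H_ge0|exact: normg_reflect].
Qed.

Lemma duh_cL1 t a b : cL1 `[a, b] (duh t).
Proof.
apply: (@cL1_bounded _ _ _ (H * normg)) => //; [exact: itv_fin|exact: duh_cmeas|].
by move=> x _; exact: duh_le.
Qed.

Section TestFunction.
Variables (phi : R -> R -> C) (Hphi : C1fun phi) (tau : R).
Hypotheses (tau0 : 0 <= tau) (tauL : tau <= L).
Hypothesis phi0 : forall t, 0 <= t <= tau -> phi t 0 = 0.

Lemma phi_cmeas_t t : cmeas (fun x => cconj (phi t x)).
Proof.
apply: cmeas_conj.
exact: (cmeas_comp2 (phi_cmeas Hphi) (a := fun _ : R => t) (b := id)).
Qed.

Lemma chi_cmeas_t t : cmeas (chi phi t).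
Proof. exact: (cmeas_comp2 (chi_cmeas Hphi) (a := fun _ : R => t) (b := id)). Qed.

(** With the emission time [s] as outer variable, each pulse is a free transport of [gt (xi - s)]
    started at time [s], to which [transport_identity] applies on [[s, tau]]. Integrating against
    [h s] gives the source term and the final term. *)
Lemma duhamel_identity :
  cint `[0, tau] (fun t => cint `[0, L] (fun x => duh t x * chi phi t x)) =
  cint `[0, tau] (fun s => h s * cint `[0, L] (fun x => gt x * cconj (phi s x)))
  - cint `[0, L] (fun x => duh tau x * cconj (phi tau x)).
Proof.
have [M HM] := norm1_bounded2 0 tau 0 L (chi_re_continuous Hphi) (chi_im_continuous Hphi).
have [_ [c1 [c2 _]]] := Hphi.
have [N HN] := norm1_bounded2 0 L 0 L c1 c2.
have M0 : 0 <= M.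
  by apply: (le_trans (norm1_ge0 _) (HM 0 0 _ _)); rewrite lexx //= ltW.
have N0 : 0 <= N.
  by apply: (le_trans (norm1_ge0 _) (HN 0 0 _ _)); rewrite lexx //= ltW.
pose Y t s := cint `[0, L] (fun x => gt (x + t - s) * chi phi t x).
have Ycm : cmeas (fun p : R * R => Y p.1 p.2).
  apply: (@cmeas_cint _ _ _ _ (fun (p : R * R) x => gt (x + p.1 - p.2) * chi phi p.1 x)) => //.
  apply: cmeasM.
    apply: (cmeas_comp gt_cmeas); apply: measurable_funB; last exact: measurableT_comp.
    by apply: measurable_funD => //; exact: measurableT_comp.
  apply: (cmeas_comp2 (chi_cmeas Hphi) (a := fun p : (R * R) * R => p.1.1) (b := fun p => p.2)).
    exact: measurableT_comp.
  exact: measurable_snd.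
have Yb t s : 0 <= t <= tau -> norm1 (Y t s) <= M * normg.
  move=> tt; have [mg gi] := gt_cL1_shift 0 L (t - s).
  apply: (@le_trans _ _ (\int[mu]_(x in `[0, L]) (M * norm1 (gt (x + (t - s)))))).
    apply: norm1_cint_le => //.
    - apply: cmeasM; last exact: chi_cmeas_t.
      by under eq_fun do rewrite -addrA.
    - exact: RintegrableZ.
    - move=> x /=; rewrite in_itv /= => x0L; apply: (le_trans (norm1M _ _)).
      by rewrite addrA mulrC; apply: ler_wpM2r; [exact: norm1_ge0|exact: HM].
  by rewrite RintegralZl //; apply: ler_wpM2l => //; exact: normg_shift.
transitivity (cint `[0, tau] (fun t => cint `[0, L] (fun s => hcut t s * Y t s))).
  apply: eq_cint => t /=; rewrite in_itv /= => tt.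
  rewrite (@convolution_swap (hcut t) (chi phi t) 0 L t H M) //.
  - exact: hcut_cmeas.
  - by move=> s _; exact: hcut_le.
  - exact: chi_cmeas_t.
  - by move=> x x0L; exact: HM.
rewrite (@cfubini_le _ _ _ _ (H * (M * normg) * fine (mu `[0, L]))) //; first last.
- move=> t /=; rewrite in_itv /= => tt.
  exists (fun _ => H * (M * normg)); split.
  + exact: integrable_cst_itv.
  + move=> s _; apply: (le_trans (norm1M _ _)); apply: ler_pM; [exact: norm1_ge0|exact: norm1_ge0|exact: hcut_le|exact: Yb].
  + by rewrite Rintegral_cst.
- by apply: cmeasM => //; exact: hcut_cmeas2.
- exact: itv_fin.
pose X2 s := cint `[0, L] (fun x => gt (x + tau - s) * cconj (phi tau x)).
pose X1 s := cint `[0, L] (fun x => gt x * cconj (phi s x)).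
have X1m : cmeas X1.
  apply: (@cmeas_cint _ _ _ _ (fun s x : R => gt x * cconj (phi s x))) => //.
  apply: cmeasM; first exact: (cmeas_comp gt_cmeas).
  apply: cmeas_conj; exact: (phi_cmeas Hphi).
have X2m : cmeas X2.
  apply: (@cmeas_cint _ _ _ _ (fun s x : R => gt (x + tau - s) * cconj (phi tau x))) => //.
  apply: cmeasM.
    by apply: (cmeas_comp gt_cmeas); apply: measurable_funB => //; exact: measurable_funD.
  exact: (cmeas_comp (phi_cmeas_t tau)).
have tauin : 0 <= tau <= L by rewrite tau0.
have X1b s : 0 <= s <= L -> norm1 (X1 s) <= N * normg.
  move=> ss; have [mg gi] := gt_cL1 (measurable_itv `[0, L]%R).
  apply: (@le_trans _ _ (\int[mu]_(x in `[0, L]) (N * norm1 (gt x)))).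
    apply: norm1_cint_le => //.
    - by apply: cmeasM => //; exact: phi_cmeas_t.
    - exact: RintegrableZ.
    - move=> x /=; rewrite in_itv /= => x0L; apply: (le_trans (norm1M _ _)).
      by rewrite norm1_conj mulrC; apply: ler_wpM2r; [exact: norm1_ge0|exact: HN].
  rewrite RintegralZl //; apply: ler_wpM2l => //.
  by have := normg_shift 0 L 0; under eq_Rintegral do rewrite addr0.
have X2b s : norm1 (X2 s) <= N * normg.
  have [mg gi] := gt_cL1_shift 0 L (tau - s).
  apply: (@le_trans _ _ (\int[mu]_(x in `[0, L]) (N * norm1 (gt (x + (tau - s)))))).
    apply: norm1_cint_le => //.
    - apply: cmeasM; last exact: phi_cmeas_t.
      by under eq_fun do rewrite -addrA.
    - exact: RintegrableZ.
    - move=> x /=; rewrite in_itv /= => x0L; apply: (le_trans (norm1M _ _)).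
      by rewrite norm1_conj addrA mulrC; apply: ler_wpM2r; [exact: norm1_ge0|exact: HN].
  by rewrite RintegralZl //; apply: ler_wpM2l => //; exact: normg_shift.
have bdd (k : R -> C) (K : R) a b : cmeas k -> (forall s, a <= s <= b -> norm1 (k s) <= K) -> cL1 `[a, b] k.
  by move=> mk kK; apply: (@cL1_bounded _ _ _ K) => //; exact: itv_fin.
transitivity (cint `[0, L] (fun s => (if 0 <= s <= tau then h s * X1 s else 0) - hcut tau s * X2 s)).
  apply: eq_cint => s /=; rewrite in_itv /= => /andP[s0 sL].
  rewrite s0 /= {2}/hcut; case: (leP s tau) => st; last first.
    rewrite mul0r subr0 -[RHS](cint0 `[0, tau]); apply: eq_cint => t /=; rewrite in_itv /= => /andP[t0 tt].
    by rewrite /hcut leNgt (le_lt_trans tt st) mul0r.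
  transitivity (cint `[s, tau] (fun t => h s * Y t s)).
    rewrite (@cint_sub _ (fun t => h s * Y t s) s tau 0 tau) //.
    apply: eq_cint => t /=; rewrite in_itv /= => /andP[t0 tt].
    by rewrite /hcut tt andbT; case: ifP => // _; rewrite mul0r.
  rewrite cintZl //; last first.
    apply: (bdd _ (M * normg)); first exact: (cmeas_comp2 Ycm (a := id) (b := fun _ : R => s)).
    by move=> t /andP[t0 tt]; apply: Yb; rewrite tt (le_trans s0 t0).
  rewrite -mulrBr; congr (_ * _).
  have WL a b : cL1 `[a, b] (fun xi => gt (xi - s)) by exact: gt_cL1_shift.
  have phi0' t : s <= t <= tau -> phi t 0 = 0.
    by move=> /andP[h1 h2]; apply: phi0; rewrite h2 (le_trans s0 h1).
  have := transport_identity Hphi (ltW L0) st WL phi0'.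
  (* Nothing enters at [x = L]: there [gt] is evaluated at [t + L - s >= L], where it is 0, also for
     [t = s]. *)
  have -> : cint `[s, tau] (fun t => gt (t + L - s) * cconj (phi t L)) = 0.
    rewrite -[RHS](cint0 `[s, tau]); apply: eq_cint => t /=; rewrite in_itv /= => /andP[st' _].
    rewrite gt_out ?mul0r // negb_and -leNgt; apply/orP; right; lra.
  rewrite addr0 => TI; transitivity (cint `[s, tau] (fun t => cint `[0, L] (fun x => gt (t + x - s) * chi phi t x))).
    by apply: eq_cint => t _; apply: eq_cint => x _; rewrite [t + x]addrC.
  rewrite TI; congr (_ - _).
    by apply: eq_cint => x _; rewrite [s + x]addrC addrK.
  by apply: eq_cint => x _; rewrite [tau + x]addrC.
rewrite cintB //; last 2 first.
- apply: (bdd _ (H * (N * normg))).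
    apply: cmeas_if; [exact: measurable_le_between|exact: cmeasM|exact: cmeas_cst].
  move=> s ss; case: ifP => _; last by rewrite norm1_0 !mulr_ge0 ?H_ge0 ?normg_ge0.
  by apply: (le_trans (norm1M _ _)); apply: ler_pM; [exact: norm1_ge0|exact: norm1_ge0|exact: hH|exact: X1b].
- apply: (bdd _ (H * (N * normg))); first by apply: cmeasM => //; exact: hcut_cmeas.
  by move=> s _; apply: (le_trans (norm1M _ _)); apply: ler_pM; [exact: norm1_ge0|exact: norm1_ge0|exact: hcut_le|exact: X2b].
rewrite -(@cint_sub _ (fun s => h s * X1 s)) //; congr (_ - _).
rewrite (@convolution_swap (hcut tau) (fun x => cconj (phi tau x)) 0 L tau H N) //.
- exact: hcut_cmeas.
- by move=> s _; exact: hcut_le.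
- exact: phi_cmeas_t.
- by move=> x x0L; rewrite norm1_conj; exact: HN.
Qed.

End TestFunction.


Definition h0 (s : R) : C := if 0 <= s then h s else 0.

Lemma h0_cmeas : cmeas h0.
Proof. by apply: cmeas_if; [exact: measurable_fun_ler|by []|exact: cmeas_cst]. Qed.

Lemma h0_le s : norm1 (h0 s) <= H.
Proof. by rewrite /h0; case: ifP => // _; rewrite norm1_0 H_ge0. Qed.

(** With [r = t - s] the time sits in the bounded function [h0] alone. Continuity of [duh] in time
    then reduces to continuity of translations of [h0] in L2, uniformly in [x]. *)
Lemma duh_reflect (t x : R) : 0 <= t <= L ->
  duh t x = cint `[0, L] (fun r => h0 (t - r) * gt (x + r)).
Proof.
move=> /andP[t0 tL]; pose F (r : R) : C := (if 0 <= r then h (t - r) else 0) * gt (x + r).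
have mF : cmeas F.
  apply: cmeasM; last by apply: (cmeas_comp gt_cmeas); exact: measurable_funD.
  apply: cmeas_if; [exact: measurable_fun_ler| |exact: cmeas_cst].
  by apply: (cmeas_comp mh); exact: measurable_funB.
transitivity (cint `[0, L] (fun s => F (t - s))).
  apply: eq_cint => s _; rewrite /F /hcut subr_ge0 addrA.
  by have -> : t - (t - s) = s by ring.
have a1 : - L <= t - L by lra.
have a2 : - L <= 0 by rewrite oppr_le0 ltW.
rewrite cint_reflect // subr0 (cint_sub F a1 tL).
rewrite [RHS](cint_sub _ a2 (lexx L)).
apply: eq_cint => r /=; rewrite in_itv /= => /andP[r1 r2].
rewrite /F /h0 subr_ge0 r2 andbT; case: (leP 0 r) => r0.
  have -> : t - L <= r by lra.
  by rewrite /=; case: ifP => // _; rewrite mul0r.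
by case: ifP => // _; rewrite mul0r.
Qed.

Definition gsq := \int[mu]_x cabs2 (gt x).

Lemma duh_uniform_continuity (t K : R) : 0 <= t <= L -> 0 < K ->
  exists2 del : R, 0 < del & forall s, 0 <= s <= L -> `|s - t| < del ->
    forall x, norm1 (duh s x - duh t x) <= K.
Proof.
move=> tt K0.
have g2i : mu.-integrable setT (EFin \o (fun x => cabs2 (gt x))) by exact: cL2_cut_cabs2.
have gsq0 : 0 <= gsq by apply: Rintegral_ge0 => x _; exact: cabs2_ge0.
(* Young weight: [e] times the squared L2 norm of [gt] is at most [K / 4], and a translation error
   below [e * K / 4] divided by [e] gives another [K / 4]. *)
pose e := K / (4 * (gsq + 1)).
have gsq1 : 0 < gsq + 1 by rewrite ltr_wpDl.
have e0 : 0 < e by rewrite divr_gt0 // mulr_gt0.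
have eK : 0 < e * K / 4 by rewrite divr_gt0 // mulr_gt0.
pose f (r : R) : C := h0 (t - r).
have mf : cmeas f by apply: (cmeas_comp h0_cmeas); exact: measurable_funB.
have fi a b : mu.-integrable `[a, b] (fun x => (cabs2 (f x))%:E).
  apply: (@Rintegrable_le _ _ _ (fun _ => H ^+ 2)) => //.
  - exact: measurable_cabs2.
  - exact: integrable_cst_itv.
  - move=> x _; rewrite ger0_norm ?cabs2_ge0 //; apply: (le_trans (cabs2_le_norm1 _)).
    by rewrite ler_pXn2r ?nnegrE ?norm1_ge0 ?H_ge0 //; exact: h0_le.
have [del del0 hdel] := cL2_translation 0 L eK mf fi.
exists del => // s ss st x; rewrite !duh_reflect //.
have Is y : cL1 `[0, L] (fun r => h0 (y - r) * gt (x + r)).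
  apply: (@cL1Mbl _ _ (fun r => gt (x + r)) (fun r => h0 (y - r)) H) => //.
  - have := gt_cL1_shift 0 L x.
    by rewrite (_ : (fun r : R => gt (r + x)) = (fun r : R => gt (x + r))) //; apply/funext => r; rewrite addrC.
  - by apply: (cmeas_comp h0_cmeas); exact: measurable_funB.
  - by move=> r _; exact: h0_le.
rewrite -cintB //.
have d2i : mu.-integrable `[0, L] (EFin \o (fun r => cabs2 (f (r + (t - s)) - f r))).
  apply: (@Rintegrable_le _ _ _ (fun _ => 2 * H ^+ 2 + 2 * H ^+ 2)) => //.
  - apply: measurable_cabs2; apply: cmeasB => //.
    by apply: (cmeas_comp mf); exact: measurable_funD.
  - exact: integrable_cst_itv.
  - move=> r _; rewrite ger0_norm ?cabs2_ge0 //; apply: (le_trans (cabs2B_le _ _)).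
    have hb y : 2 * cabs2 (f y) <= 2 * H ^+ 2.
      rewrite ler_pM2l //; apply: (le_trans (cabs2_le_norm1 _)).
      by rewrite ler_pXn2r ?nnegrE ?norm1_ge0 ?H_ge0 //; exact: h0_le.
    exact: lerD.
have gxi : mu.-integrable `[0, L] (EFin \o (fun r => cabs2 (gt (r + x)))).
  apply: (@Rintegrable_shift _ (fun r => cabs2 (gt r))); first by apply: measurable_cabs2; exact: gt_cmeas.
  by apply: integrableS g2i.
apply: (@le_trans _ _ (\int[mu]_(r in `[0, L])
    (e^-1 * cabs2 (f (r + (t - s)) - f r) + e * cabs2 (gt (r + x))))).
  apply: norm1_cint_le => //.
  - by have [] := cL1B (measurable_itv _) (Is s) (Is t).
  - by apply: RintegrableD => //; exact: RintegrableZ.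
  - move=> r _; rewrite -mulrBl; apply: (le_trans (norm1M _ _)).
    have -> : h0 (s - r) = f (r + (t - s)) by rewrite /f; congr h0; ring.
    rewrite [x + r]addrC -/(f r).
    have := norm1_le_cabs2 (f (r + (t - s)) - f r); have := norm1_le_cabs2 (gt (r + x)).
    have := norm1_ge0 (gt (r + x)); have := norm1_ge0 (f (r + (t - s)) - f r).
    move: (norm1 (f (r + (t - s)) - f r)) (norm1 (gt (r + x))) (cabs2 _) (cabs2 _) => a b A B a0 b0 hb ha.
    have h1 : e * (a * b) <= A + e ^+ 2 * B.
      by have := sqr_ge0 (a - e * b); have := sqr_ge0 e; nra.
    rewrite -(ler_pM2l e0); apply: (le_trans h1).
    by rewrite mulrDr mulrA mulfV ?gt_eqF // mul1r mulrA -expr2.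
rewrite RintegralD //; [|exact: RintegrableZ..].
rewrite !RintegralZl //.
have := hdel (t - s); rewrite distrC => /(_ st) h1.
have h2 : \int[mu]_(r in `[0, L]) cabs2 (gt (r + x)) <= gsq.
  have mg2 : measurable_fun setT (fun r => cabs2 (gt r)) by apply: measurable_cabs2; exact: gt_cmeas.
  rewrite (@Rintegral_shift _ (fun r => cabs2 (gt r))) //.
  apply: Rintegral_le_setT => //.
  by move=> r; exact: cabs2_ge0.
have h3 : e^-1 * \int[mu]_(r in `[0, L]) cabs2 (f (r + (t - s)) - f r) <= K / 4.
  by rewrite ler_pdivrMl // mulrA ltW.
have h4 : e * \int[mu]_(r in `[0, L]) cabs2 (gt (r + x)) <= e * (gsq + 1).
  by rewrite ler_pM2l //; apply: (le_trans h2); rewrite lerDl.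
have h5 : e * (gsq + 1) = K / 4 by rewrite /e; field; rewrite gt_eqF.
move: h3 h4; rewrite h5; lra.
Qed.

Variable W : R -> C.
Hypotheses (mW : cmeas W) (WL2 : forall a b, mu.-integrable `[a, b] (EFin \o (fun x => cabs2 (W x)))).

Lemma W_cL1 a b : cL1 `[a, b] W.
Proof.
apply: (@cL1_le _ _ _ (fun x => 1 + cabs2 (W x))) => //.
  by apply: RintegrableD => //; exact: integrable_cst_itv.
by move=> x _; have := norm1_le_young (W x) ltr01; rewrite invr1 mul1r.
Qed.

Definition sol (t x : R) : C := W (t + x) + duh t x.

Lemma Wshift_cmeas (t : R) : cmeas (fun x : R => W (t + x)).
Proof. by apply: (cmeas_comp mW); exact: measurable_funD. Qed.

Lemma Wshift_cabs2 (t a b : R) : mu.-integrable `[a, b] (EFin \o (fun x => cabs2 (W (t + x)))).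
Proof.
have := @Rintegrable_shift R (fun x => cabs2 (W x)) a b t (measurable_cabs2 mW) (WL2 _ _).
by rewrite (_ : (fun x : R => cabs2 (W (x + t))) = (fun x : R => cabs2 (W (t + x)))) //; apply/funext => x; rewrite addrC.
Qed.

Lemma Wshift_cL1 (t a b : R) : cL1 `[a, b] (fun x => W (t + x)).
Proof.
have := @cL1_shift W a b t (W_cL1 _ _).
by rewrite (_ : (fun x : R => W (x + t)) = (fun x : R => W (t + x))) //; apply/funext => x; rewrite addrC.
Qed.

Lemma sol_cmeas t : cmeas (sol t).
Proof. by apply: cmeasD; [exact: Wshift_cmeas|exact: duh_cmeas]. Qed.

Lemma sol_cL1 t : cL1 `[0, L] (sol t).
Proof. by apply: cL1D => //; [exact: Wshift_cL1|exact: duh_cL1]. Qed.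

Lemma sol_L2cont : L2cont L L sol.
Proof.
split => [t tt|t tt e e0].
  have [m1 m2] := sol_cmeas t.
  split; first exact: measurable_funTS.
  split; first exact: measurable_funTS.
  apply: (@Rintegrable_le _ _ _ (fun x => 2 * cabs2 (W (t + x)) + 2 * (H * normg) ^+ 2)) => //.
  - exact: measurable_cabs2 (sol_cmeas t).
  - apply: RintegrableD => //; last exact: integrable_cst_itv.
    by apply: RintegrableZ => //; exact: Wshift_cabs2.
  - move=> x _; rewrite ger0_norm ?cabs2_ge0 //; apply: (le_trans (cabs2D_le _ _)).
    rewrite lerD2l ler_pM2l //; apply: (le_trans (cabs2_le_norm1 _)).
    rewrite ler_pXn2r ?nnegrE ?norm1_ge0 ?mulr_ge0 ?H_ge0 ?normg_ge0 //; exact: duh_le.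
have e4 : 0 < e / 4 by rewrite divr_gt0.
have [d1 d10 h1] := @cL2_translation R (fun x => W (t + x)) 0 L _ e4 (Wshift_cmeas t) (Wshift_cabs2 t).
(* [K <= 1] gives [K ^+ 2 * L <= K * L <= e / 8]; with a translation error below [e / 4], doubling
   both leaves less than [e]. *)
pose K := Num.min 1 (e / (8 * L)).
have K0 : 0 < K by rewrite lt_min ltr01 divr_gt0 // mulr_gt0.
have [d2 d20 h2] := duh_uniform_continuity tt K0.
exists (Num.min d1 d2); first by rewrite lt_min d10.
move=> s ss; rewrite lt_min => /andP[/h1 {}h1 /(h2 s ss) {}h2].
have i1 : mu.-integrable `[0, L] (EFin \o (fun x => cabs2 (W (t + (x + (s - t))) - W (t + x)))).
  apply: (@Rintegrable_le _ _ _ (fun x => 2 * cabs2 (W (s + x)) + 2 * cabs2 (W (t + x)))) => //.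
  - apply: measurable_cabs2; apply: cmeasB; last exact: Wshift_cmeas.
    by apply: (cmeas_comp mW); apply: measurable_funD => //; exact: measurable_funD.
  - by apply: RintegrableD => //; apply: RintegrableZ => //; exact: Wshift_cabs2.
  - move=> x _; rewrite ger0_norm ?cabs2_ge0 //.
    have -> : t + (x + (s - t)) = s + x by ring.
    exact: cabs2B_le.
apply: (@le_lt_trans _ _ (\int[mu]_(x in `[0, L]) (2 * cabs2 (W (t + (x + (s - t))) - W (t + x)) + 2 * K ^+ 2))).
  apply: le_Rintegral => //.
  - apply: (@Rintegrable_le _ _ _ (fun x => 2 * cabs2 (W (t + (x + (s - t))) - W (t + x)) + 2 * K ^+ 2)) => //.
    + by apply: measurable_cabs2; apply: cmeasB; exact: sol_cmeas.
    + by apply: RintegrableD => //; [exact: RintegrableZ|exact: integrable_cst_itv].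
    + move=> x _; rewrite ger0_norm ?cabs2_ge0 //.
      have -> : sol s x - sol t x = (W (t + (x + (s - t))) - W (t + x)) + (duh s x - duh t x).
        have -> : t + (x + (s - t)) = s + x by ring.
        rewrite /sol; ring.
      apply: (le_trans (cabs2D_le _ _)); rewrite lerD2l ler_pM2l //.
      apply: (le_trans (cabs2_le_norm1 _)).
      by rewrite ler_pXn2r ?nnegrE ?norm1_ge0 ?(ltW K0).
  - by apply: RintegrableD => //; [exact: RintegrableZ|exact: integrable_cst_itv].
  - move=> x _.
    have -> : sol s x - sol t x = (W (t + (x + (s - t))) - W (t + x)) + (duh s x - duh t x).
      have -> : t + (x + (s - t)) = s + x by ring.
      rewrite /sol; ring.
    apply: (le_trans (cabs2D_le _ _)); rewrite lerD2l ler_pM2l //.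
    apply: (le_trans (cabs2_le_norm1 _)).
    by rewrite ler_pXn2r ?nnegrE ?norm1_ge0 ?(ltW K0).
rewrite RintegralD //; [|exact: RintegrableZ|exact: integrable_cst_itv].
rewrite (Rintegral_cst_itv _ (ltW L0)) RintegralZl // subr0.
have hK : K ^+ 2 * L <= e / 8.
  have K1 : K <= 1 by rewrite ge_min lexx.
  have K2 : K <= e / (8 * L) by rewrite ge_min lexx orbT.
  have : K * L <= e / 8.
    by move: K2; rewrite ler_pdivlMr ?mulr_gt0 //; lra.
  have := mulr_ge0 (ltW K0) (ltW L0); nra.
move: h1 hK; lra.
Qed.

Section WeakIdentity.
Hypothesis Hh : forall t, 0 <= t <= L -> h t = cint `[0, L] (sol t).
Variables (u0 U : R -> C).
Hypothesis Hu0 : cL2 0 L u0.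
Hypothesis Wu0 : forall x, 0 <= x < L -> W x = u0 x.
Hypothesis WU : forall t, 0 <= t <= L -> W (t + L) = U t.

(** The transport and Duhamel identities are added. Since [X1] does not depend on [x], the nonlocal
    term integrates to the mean of [sol] times [X1]; by [Hh] this is [h t * X1 t], which cancels the
    source term of the Duhamel identity. *)
Lemma sol_weak_solution : weak_solution L L g u0 U sol.
Proof.
split; first exact: sol_L2cont.
move=> tau /andP[tau0 tauL] phi Hphi phi0.
have [M HM] := norm1_bounded2 0 tau 0 L (chi_re_continuous Hphi) (chi_im_continuous Hphi).
have [_ [c1 [c2 _]]] := Hphi.
have [N HN] := norm1_bounded2 0 L 0 L c1 c2.
have M0 : 0 <= M.
  by apply: (le_trans (norm1_ge0 _) (HM 0 0 _ _)); rewrite lexx //= ltW.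
have mchit t : cmeas (chi phi t) by exact: chi_cmeas_t.
have mphit t : cmeas (fun x => cconj (phi t x)) by exact: phi_cmeas_t.
pose X1 t := cint `[0, L] (fun x => gt x * cconj (phi t x)).
have X1E t : 0 <= t <= L -> cconj (cint `[0, L] (fun y => cconj (g y) * phi t y)) = X1 t.
  move=> tt; apply: (@adjoint_integral _ N).
    exact: (cmeas_comp2 (phi_cmeas Hphi) (a := fun _ : R => t) (b := id)).
  by move=> x x0L; exact: HN.
have X1m : cmeas X1.
  apply: (@cmeas_cint _ _ _ _ (fun s x : R => gt x * cconj (phi s x))) => //.
  apply: cmeasM; first exact: (cmeas_comp gt_cmeas).
  apply: cmeas_conj; exact: (phi_cmeas Hphi).
have N0 : 0 <= N.
  by apply: (le_trans (norm1_ge0 _) (HN 0 0 _ _)); rewrite lexx //= ltW.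
have X1b s : 0 <= s <= L -> norm1 (X1 s) <= N * normg.
  move=> ss; have [mg gi] := gt_cL1 (measurable_itv `[0, L]%R).
  apply: (@le_trans _ _ (\int[mu]_(x in `[0, L]) (N * norm1 (gt x)))).
    apply: norm1_cint_le => //.
    - by apply: cmeasM => //; exact: phi_cmeas_t.
    - exact: RintegrableZ.
    - move=> x /=; rewrite in_itv /= => x0L; apply: (le_trans (norm1M _ _)).
      by rewrite norm1_conj mulrC; apply: ler_wpM2r; [exact: norm1_ge0|exact: HN].
  rewrite RintegralZl //; apply: ler_wpM2l => //.
  by have := normg_shift 0 L 0; under eq_Rintegral do rewrite addr0.
pose I1 t := cint `[0, L] (fun x => W (t + x) * chi phi t x).
pose I2 t := cint `[0, L] (fun x => duh t x * chi phi t x).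
have J1 t : 0 <= t <= tau -> cL1 `[0, L] (fun x => W (t + x) * chi phi t x).
  move=> tt; apply: (@cL1Mb _ _ _ _ M) => //; first exact: Wshift_cL1.
  by move=> x /=; rewrite in_itv /= => x0L; exact: HM.
have J2 t : 0 <= t <= tau -> cL1 `[0, L] (fun x => duh t x * chi phi t x).
  move=> tt; apply: (@cL1Mb _ _ _ _ M) => //; first exact: duh_cL1.
  by move=> x /=; rewrite in_itv /= => x0L; exact: HM.
have I1m : cmeas I1.
  apply: (@cmeas_cint _ _ _ _ (fun t x : R => W (t + x) * chi phi t x)) => //.
  apply: cmeasM; last exact: (chi_cmeas Hphi).
  by apply: (cmeas_comp mW); exact: measurable_funD.
have I2m : cmeas I2.
  apply: (@cmeas_cint _ _ _ _ (fun t x : R => duh t x * chi phi t x)) => //.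
  apply: cmeasM; [exact: duh_cmeas2|exact: (chi_cmeas Hphi)].
have bdd (k : R -> C) (K : R) a b : cmeas k -> (forall s, a <= s <= b -> norm1 (k s) <= K) -> cL1 `[a, b] k.
  by move=> mk kK; apply: (@cL1_bounded _ _ _ K) => //; exact: itv_fin.
have I1L : cL1 `[0, tau] I1.
  apply: (bdd _ (M * \int[mu]_(x in `[0, L + L]) norm1 (W x))) => // t tt.
  have [_ Wi] := Wshift_cL1 t 0 L.
  apply: (@le_trans _ _ (\int[mu]_(x in `[0, L]) (M * norm1 (W (t + x))))).
    apply: norm1_cint_le => //.
    - by have [] := J1 t tt.
    - exact: RintegrableZ.
    - move=> x /=; rewrite in_itv /= => x0L; apply: (le_trans (norm1M _ _)).
      by rewrite mulrC; apply: ler_wpM2r; [exact: norm1_ge0|exact: HM].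
  rewrite RintegralZl //; apply: ler_wpM2l => //.
  under eq_Rintegral do rewrite addrC.
  have mnW := measurable_norm1 mW.
  rewrite (@Rintegral_shift _ (fun x => norm1 (W x))) // add0r.
  have [_ Wi2] := W_cL1 0 (L + L); have [_ Wi3] := W_cL1 t (L + t).
  rewrite /Rintegral fine_le //; [exact: integrable_fin_num..|].
  apply: ge0_subset_integral => //.
  - by apply/measurable_EFinP; exact: measurable_funTS.
  - by move=> x _; rewrite lee_fin norm1_ge0.
  - move: tt => /andP[t0 tt]; apply: subset_itv; rewrite bnd_simp //.
    by rewrite lerD2l (le_trans tt).
have I2L : cL1 `[0, tau] I2.
  apply: (bdd _ (H * normg * M * fine (mu `[0, L]))) => // t tt.
  rewrite -Rintegral_cst //; apply: norm1_cint_le => //.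
  - by have [] := J2 t tt.
  - exact: integrable_cst_itv.
  - move=> x /=; rewrite in_itv /= => x0L; apply: (le_trans (norm1M _ _)).
    by apply: ler_pM; [exact: norm1_ge0|exact: norm1_ge0|exact: duh_le|exact: HM].
have I3L : cL1 `[0, tau] (fun t => h t * X1 t).
  apply: (bdd _ (H * (N * normg))); first exact: cmeasM.
  move=> t /andP[t0 tt]; apply: (le_trans (norm1M _ _)).
  apply: ler_pM; [exact: norm1_ge0|exact: norm1_ge0|exact: hH|apply: X1b].
  by rewrite t0 (le_trans tt).
have -> : cint `[0, tau] (fun t => cint `[0, L] (fun x => sol t x * cconj
    (- pt phi t x + px phi t x - cint `[0, L] (fun y => cconj (g y) * phi t y)))) =
    cint `[0, tau] (fun t => I1 t + I2 t - h t * X1 t).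
  apply: eq_cint => t tt0; have tt : 0 <= t <= tau by move: tt0; rewrite /= in_itv.
  have tL : 0 <= t <= L by move: tt => /andP[-> h2]; rewrite (le_trans h2).
  transitivity (cint `[0, L] (fun x => (W (t + x) * chi phi t x + duh t x * chi phi t x)
      - sol t x * X1 t)).
    apply: eq_cint => x _; rewrite cconjB -X1E // -/(chi phi t x) /sol.
    by move: (cconj _) => a; ring.
  rewrite cintB //; [|by apply: cL1D => //; [exact: J1|exact: J2]|]; last first.
    exact: (cL1Mb (measurable_itv _) (sol_cL1 t) (cmeas_cst (X1 t)) (fun _ _ => lexx _)).
  rewrite cintD //; [|exact: J1|exact: J2].
  by rewrite cintZr //; [rewrite -Hh|exact: sol_cL1].
rewrite cintB //; last exact: cL1D.
rewrite cintD //.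
have TI := transport_identity Hphi (ltW L0) tau0 W_cL1 phi0.
have DI := duhamel_identity Hphi tau0 tauL phi0.
rewrite /I1 /I2 TI DI.
have -> : cint `[0, L] (fun x => sol tau x * cconj (phi tau x)) =
    cint `[0, L] (fun x => W (tau + x) * cconj (phi tau x)) +
    cint `[0, L] (fun x => duh tau x * cconj (phi tau x)).
  rewrite -cintD //.
  - by apply: eq_cint => x _; rewrite /sol mulrDl.
  - apply: (@cL1Mb _ _ _ _ N) => //; first exact: Wshift_cL1.
    by move=> x /=; rewrite in_itv /= norm1_conj => x0L; apply: HN; rewrite ?tau0.
  - apply: (@cL1Mb _ _ _ _ N) => //; first exact: duh_cL1.
    by move=> x /=; rewrite in_itv /= norm1_conj => x0L; apply: HN; rewrite ?tau0.
have -> : cint `[0, L] (fun x => u0 x * cconj (phi 0 x)) =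
    cint `[0, L] (fun x => W (0 + x) * cconj (phi 0 x)).
  transitivity (cint `[0, L] (fun x => cutc 0 L u0 x * cconj (phi 0 x))).
    by apply: eq_cint => x /=; rewrite in_itv /= => x0L; rewrite cutcE.
  apply: cint_eq_co.
  - by apply: cmeasM => //; exact: cL2_cutc_cmeas.
  - by apply: cmeasM => //; exact: Wshift_cmeas.
  - by move=> x /andP[x0 xL]; rewrite add0r Wu0 ?x0 // cutcE // x0 ltW.
have -> : cint `[0, tau] (fun t => U t * cconj (phi t L)) =
    cint `[0, tau] (fun t => W (t + L) * cconj (phi t L)).
  apply: eq_cint => t /=; rewrite in_itv /= => /andP[t0 tt].
  by rewrite WU // t0 (le_trans tt).
rewrite -/(X1 _); ring.
Qed.

End WeakIdentity.

End Duhamel.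

(** * Uniqueness of the final state of a weak solution *)

Section Uniqueness.
Context {R : realType}.
Local Notation C := (R[i]).
Local Notation mu := (@lebesgue_measure R).

Lemma is_derive_quadratic (F : R -> R) (y d : R) :
  (forall h, `|F (h + y) - F y - d * h| <= h ^+ 2) -> is_derive y (1 : R) F d.
Proof.
move=> hF.
have lim : h^-1 *: (F (h *: 1 + y) - F y) @[h --> 0^'] --> d.
  apply/cvgrPdist_lt => e e0; near=> h.
  have h0 : h != 0 by near: h; exact: nbhs_dnbhs_neq.
  have he : `|h| < e by near: h; exact: dnbhs0_lt.
  rewrite [h *: 1]mulr1 /GRing.scale /=.
  have -> : d - h^-1 * (F (h + y) - F y) = - (h^-1 * (F (h + y) - F y - d * h)) by field.
  rewrite normrN normrM normfV ltr_pdivrMl ?normr_gt0 //.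
  apply: (le_lt_trans (hF h)); rewrite -real_normK ?num_real // expr2.
  by rewrite ltr_pM2l ?normr_gt0.
split; first by apply/cvg_ex; eexists; exact: lim.
by apply/cvg_lim => //; exact: lim.
Unshelve. all: by end_near. Qed.

Lemma is_derive_continuous (F f : R -> R) : (forall x : R, is_derive x (1 : R) F (f x)) ->
  continuous F.
Proof.
move=> dF x; apply: differentiable_continuous; apply/derivable1_diffP.
by have [] := dF x.
Qed.

Lemma is_derive_exp_comp (f : R -> R) (y df : R) : is_derive y (1 : R) f df ->
  is_derive y (1 : R) (fun z => expR (f z)) (expR (f y) * df).
Proof. by move=> h; exact: (@is_derive1_comp R expR f y _ _ (is_derive_expR _) h). Qed.

Lemma is_derive_mull (a x : R) : is_derive x (1 : R) (fun s : R => a * s) a.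
Proof. by have := is_deriveZ a (is_derive_id x (1 : R)); rewrite /GRing.scale /= mulr1. Qed.

Lemma continuous_expRM (a : R) : continuous (fun s : R => expR (a * s)).
Proof. exact: (is_derive_continuous (fun x => is_derive_exp_comp (is_derive_mull a x))). Qed.

(** Squaring the positive part makes it of class C^1, as a test function has to be. *)
Definition pos2 (y : R) : R := Num.max y 0 ^+ 2.

Lemma is_derive_pos2 (y : R) : is_derive y (1 : R) pos2 (2 * Num.max y 0).
Proof.
apply: is_derive_quadratic => h; rewrite /pos2.
case: (leP y 0) => y0; case: (leP (h + y) 0) => hy0;
  by rewrite ler_norml; apply/andP; split; nra.
Qed.

Lemma max0_continuous : continuous (fun y : R => Num.max y 0).
Proof.
move=> y; apply/cvgrPdist_lt => e e0; near=> z.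
have : `|y - z| < e by near: z; exact: cvgr_dist_lt (@cvg_id _ _) e e0.
apply: le_lt_trans; suff H w : - w <= y - z <= w -> `|Num.max y 0 - Num.max z 0| <= w.
  by apply: H; rewrite -ler_norml.
move=> /andP[h1 h2]; rewrite ler_norml; apply/andP.
by case: (leP y 0) => y0; case: (leP z 0) => z0; split; lra.
Unshelve. all: by end_near. Qed.

(* A C^1 approximation, vanishing on the negative axis, of the indicator of the positive axis. *)
Definition ramp (n : nat) (y : R) : R := 1 - expR (- (n%:R * pos2 y)).
Definition dramp (n : nat) (y : R) : R := expR (- (n%:R * pos2 y)) * (n%:R * (2 * Num.max y 0)).

Lemma is_derive_ramp n (y : R) : is_derive y (1 : R) (ramp n) (dramp n y).
Proof.
have d1 : is_derive y (1 : R) (fun z => - (n%:R * pos2 z)) (- (n%:R * (2 * Num.max y 0))).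
  have := is_deriveN (is_deriveZ n%:R (is_derive_pos2 y)).
  by [].
have d2 := is_derive_exp_comp d1.
have d3 := is_deriveB (is_derive_cst (1 : R) y (1 : R)) d2.
by move: d3; rewrite sub0r mulrN opprK.
Qed.

Lemma dramp_continuous n : continuous (dramp n).
Proof.
have ce : continuous (fun y : R => expR (- (n%:R * pos2 y))).
  apply: (is_derive_continuous (f := fun y => expR (- (n%:R * pos2 y)) * (- (n%:R * (2 * Num.max y 0))))).
  move=> y; apply: is_derive_exp_comp.
  exact: (is_deriveN (is_deriveZ n%:R (is_derive_pos2 y))).
move=> y; apply: cvgM; first exact: ce.
apply: cvgM; first exact: cvg_cst.
by apply: cvgM; [exact: cvg_cst|exact: max0_continuous].
Qed.

Lemma ramp_neg n (y : R) : y <= 0 -> ramp n y = 0.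
Proof. by move=> y0; rewrite /ramp /pos2 max_r // expr0n mulr0 oppr0 expR0 subrr. Qed.

Lemma ramp_le1 n (y : R) : `|ramp n y| <= 1.
Proof.
have p0 : 0 <= pos2 y by exact: sqr_ge0.
have h1 : expR (- (n%:R * pos2 y)) <= 1 by rewrite -expR0 ler_expR oppr_le0 mulr_ge0.
have h2 := expR_gt0 (- (n%:R * pos2 y)).
by rewrite /ramp ger0_norm; lra.
Qed.

Lemma ramp_cvg (y : R) : ramp n y @[n --> \oo] --> (if 0 < y then 1 else 0 : R).
Proof.
case: ltP => y0; last first.
  by apply: cvg_near_cst; apply: nearW => n; rewrite ramp_neg.
rewrite -[X in _ --> X]subr0; apply: cvgB; first exact: cvg_cst.
have p0 : 0 < pos2 y by rewrite /pos2 exprn_gt0 // lt_max y0.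
have -> : (fun n => expR (- (n%:R * pos2 y))) = (fun n => expR (- pos2 y) ^+ n).
  by apply/funext => n; rewrite -mulrN expRM_natl.
by apply: cvg_expr; rewrite ger0_norm ?expR_ge0 // expR_lt1 oppr_lt0.
Qed.

(** Functions of [t + x] are constant along characteristics, so the transport part of the adjoint
    equation disappears and only the nonlocal term is left. *)
Lemma real_test_C1 (psi dpsi : R -> R) :
  (forall y : R, is_derive y (1 : R) psi (dpsi y)) -> continuous dpsi ->
  C1fun (fun t x : R => cmk (psi (t + x)) 0) /\
  (forall t x, pt (fun t x : R => cmk (psi (t + x)) 0) t x = px (fun t x : R => cmk (psi (t + x)) 0) t x).
Proof.
move=> dp cdp.
have cp : continuous psi.
  move=> y; apply: differentiable_continuous; apply/derivable1_diffP.
  by have [] := dp y.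
have d1 (t x : R) : is_derive t (1 : R) (fun s => psi (s + x)) (dpsi (t + x)).
  have d3 : is_derive t (1 : R) (fun s : R => s + x) 1.
    by have := is_deriveD (is_derive_id t (1 : R)) (is_derive_cst x t (1 : R)); rewrite addr0.
  by have := @is_derive1_comp R psi (fun s => s + x) t _ _ (dp (t + x)) d3; rewrite mulr1.
have d2 (t x : R) : is_derive x (1 : R) (fun s => psi (t + s)) (dpsi (t + x)).
  have d3 : is_derive x (1 : R) (fun s : R => t + s) 1.
    by have := is_deriveD (is_derive_cst t x (1 : R)) (is_derive_id x (1 : R)); rewrite add0r.
  by have := @is_derive1_comp R psi (fun s => t + s) x _ _ (dp (t + x)) d3; rewrite mulr1.
have c0 (t : R) : (fun _ : R => (0 : R))^`() t = 0 by rewrite derive1_cst.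
have e1 t x : pt (fun t x : R => cmk (psi (t + x)) 0) t x = cmk (dpsi (t + x)) 0.
  apply: complex_ext; rewrite /pt !reimE; last exact: c0.
  by rewrite derive1E; have [_ ->] := d1 t x.
have e2 t x : px (fun t x : R => cmk (psi (t + x)) 0) t x = cmk (dpsi (t + x)) 0.
  apply: complex_ext; rewrite /px !reimE; last exact: c0.
  by rewrite derive1E; have [_ ->] := d2 t x.
have cadd : continuous (fun p : R * R => p.1 + p.2).
  by move=> p; apply: cvgD; [exact: cvg_fst|exact: cvg_snd].
have cc0 : continuous (fun _ : R * R => (0 : R)) by move=> p; exact: cvg_cst.
split; last by move=> t x; rewrite e1 e2.
split.
  move=> t x; split; first by have [] := d1 t x.
  split; first exact: derivable_cst.
  split; first by have [] := d2 t x.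
  exact: derivable_cst.
split; first by move=> p; apply: (cvg_comp _ _ (cadd p) (cp _)).
split; first exact: cc0.
split.
  rewrite (_ : (fun p : R * R => _) = (fun p : R * R => dpsi (p.1 + p.2))).
    by move=> p; apply: (cvg_comp _ _ (cadd p) (cdp _)).
  by apply/funext => p; rewrite e1.
split.
  by rewrite (_ : (fun p : R * R => _) = (fun _ => 0)) //; apply/funext => p; rewrite e1.
split.
  rewrite (_ : (fun p : R * R => _) = (fun p : R * R => dpsi (p.1 + p.2))).
    by move=> p; apply: (cvg_comp _ _ (cadd p) (cdp _)).
  by apply/funext => p; rewrite e2.
by rewrite (_ : (fun p : R * R => _) = (fun _ => 0)) //; apply/funext => p; rewrite e2.
Qed.

Definition ccvg (z_ : nat -> C) (z : C) :=
  (cre (z_ n) @[n --> \oo] --> cre z) /\ (cim (z_ n) @[n --> \oo] --> cim z).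

Lemma ccvg_unique (z_ : nat -> C) (z w : C) : ccvg z_ z -> ccvg z_ w -> z = w.
Proof.
move=> [h1 h2] [k1 k2]; apply: complex_ext.
  exact: (cvg_unique _ h1 k1).
exact: (cvg_unique _ h2 k2).
Qed.

Lemma ccvg_cint (D : set R) (f_ : nat -> R -> C) (f : R -> C) (b : R -> R) :
  measurable D -> (forall n, cmeas (f_ n)) -> cmeas f ->
  (forall x, D x -> ccvg (fun n => f_ n x) (f x)) ->
  mu.-integrable D (EFin \o b) -> (forall n x, D x -> norm1 (f_ n x) <= b x) ->
  ccvg (fun n => cint D (f_ n)) (cint D f).
Proof.
move=> mD mf_ mf f_f bi f_b; split.
  apply: (@Rdominated_cvg _ D (fun n x => cre (f_ n x)) (fun x => cre (f x)) b) => //.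
  - by move=> n; have [] := mf_ n.
  - by case: mf.
  - by move=> x Dx; have [] := f_f x Dx.
  - by move=> n x Dx; apply: le_trans (cre_le_norm1 _) (f_b n x Dx).
apply: (@Rdominated_cvg _ D (fun n x => cim (f_ n x)) (fun x => cim (f x)) b) => //.
- by move=> n; have [] := mf_ n.
- by case: mf.
- by move=> x Dx; have [] := f_f x Dx.
- by move=> n x Dx; apply: le_trans (cim_le_norm1 _) (f_b n x Dx).
Qed.

Lemma ccvgM (z_ w_ : nat -> C) (z w : C) : ccvg z_ z -> ccvg w_ w ->
  ccvg (fun n => z_ n * w_ n) (z * w).
Proof.
move=> [h1 h2] [k1 k2]; split.
  rewrite (_ : (fun n => _) = (fun n => cre (z_ n) * cre (w_ n) - cim (z_ n) * cim (w_ n))).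
    by rewrite reimE; apply: cvgB; exact: cvgM.
  by apply/funext => n; rewrite reimE.
rewrite (_ : (fun n => _) = (fun n => cre (z_ n) * cim (w_ n) + cim (z_ n) * cre (w_ n))).
  by rewrite reimE; apply: cvgD; exact: cvgM.
by apply/funext => n; rewrite reimE.
Qed.

Lemma ccvg_cst (z : C) : ccvg (fun _ => z) z.
Proof. by split; exact: cvg_cst. Qed.

(** By induction [f t <= M * 2^-1 ^+ n * expR (2 * k * t)]: integrating the exponential gains
    [1 / (2 * k)] and the inequality costs at most [k], hence a factor one half at each turn. The
    choice [k = c + 1] keeps the divisor positive. *)
Lemma gronwall_zero (f : R -> R) (c M L : R) : 0 <= c -> 0 <= M -> measurable_fun setT f ->
  (forall t, 0 <= t <= L -> 0 <= f t <= M) ->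
  (forall t, 0 <= t <= L -> f t <= c * \int[mu]_(s in `[0, t]) f s) ->
  forall t, 0 <= t <= L -> f t = 0.
Proof.
move=> c0 M0 mf fM hf; pose k := c + 1; have k0 : 0 < k by rewrite ltr_wpDl.
have ex_int (t : R) : 0 <= t -> \int[mu]_(s in `[0, t]) expR (2 * k * s) = (expR (2 * k * t) - 1) / (2 * k).
  move=> t0; have k2 : 2 * k != 0 by rewrite mulf_neq0 // gt_eqF.
  have der (x : R) : is_derive x (1 : R) (fun s => (2 * k)^-1 * expR (2 * k * s)) (expR (2 * k * x)).
    have := is_deriveZ (2 * k)^-1 (is_derive_exp_comp (is_derive_mull (2 * k) x)).
    by rewrite /GRing.scale /= mulrCA mulVf // mulr1.
  rewrite (Rintegral_FTC2 t0 der); last exact: continuous_expRM.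
  by rewrite mulr0 expR0; field; rewrite gt_eqF.
have ind n : forall t, 0 <= t <= L -> f t <= M * 2^-1 ^+ n * expR (2 * k * t).
  elim: n => [|n IH] t tt.
    have [_ h] := andP (fM t tt); apply: (le_trans h); rewrite expr0 mulr1 ler_peMr //.
    by rewrite -expR0 ler_expR !mulr_ge0 ?(ltW k0) //; case/andP: tt.
  have [t0 tL] := andP tt.
  have sub s : `[0, t]%classic s -> 0 <= s <= L.
    by rewrite /= in_itv /= => /andP[-> h]; rewrite (le_trans h).
  have ie : mu.-integrable `[0, t] (EFin \o (fun s => M * 2^-1 ^+ n * expR (2 * k * s))).
    apply: RintegrableZ => //; apply: continuous_compact_integrable; first exact: segment_compact.
    by apply: continuous_subspaceT; exact: continuous_expRM.
  have ifn : mu.-integrable `[0, t] (EFin \o f).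
    apply: (@Rintegrable_le _ _ _ (fun _ => M)) => //; first exact: integrable_cst_itv.
    by move=> s /sub /fM /andP[h1 h2]; rewrite ger0_norm.
  have ge0 : 0 <= \int[mu]_(s in `[0, t]) f s.
    by apply: Rintegral_ge0 => s /sub /fM /andP[].
  apply: (le_trans (hf t tt)); apply: (@le_trans _ _ (k * \int[mu]_(s in `[0, t]) f s)).
    by apply: ler_wpM2r => //; rewrite lerDl.
  apply: (@le_trans _ _ (k * \int[mu]_(s in `[0, t]) (M * 2^-1 ^+ n * expR (2 * k * s)))).
    apply: ler_wpM2l; first exact: ltW.
    by apply: le_Rintegral => // s /sub ss; exact: IH.
  rewrite RintegralZl //; last first.
    apply: continuous_compact_integrable; first exact: segment_compact.
    by apply: continuous_subspaceT; exact: continuous_expRM.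
  rewrite ex_int //.
  have -> : k * (M * 2^-1 ^+ n * ((expR (2 * k * t) - 1) / (2 * k))) =
      M * 2^-1 ^+ n.+1 * (expR (2 * k * t) - 1).
    by rewrite exprS; field; rewrite gt_eqF.
  by apply: ler_wpM2l; [rewrite mulr_ge0 // exprn_ge0|lra].
move=> t tt; have [f0 _] := andP (fM t tt).
apply/eqP; rewrite eq_le f0 andbT leNgt; apply/negP => ft.
have lim : M * 2^-1 ^+ n * expR (2 * k * t) @[n --> \oo] --> M * 0 * expR (2 * k * t).
  apply: cvgM; last exact: cvg_cst.
  apply: cvgM; first exact: cvg_cst.
  by apply: cvg_expr; rewrite ger0_norm; lra.
rewrite mulr0 mul0r in lim.
have /cvgrPdist_lt /(_ _ ft) [n _ hn] := lim.
have := hn n (leqnn n); rewrite /= sub0r normrN => h.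
have := ind n t tt; rewrite leNgt => /negP; apply.
exact: le_lt_trans (ler_norm _) h.
Qed.

(** Lebesgue differentiation: at almost every point to the right of 0, [k] is the derivative of its
    primitive. *)
Lemma ae0_of_primitive (k : R -> R) : measurable_fun setT k -> mu.-integrable setT (EFin \o k) ->
  (forall x, \int[mu]_(y in `[0, x]) k y = 0) ->
  {ae mu, forall x, 0 < x -> k x = 0}.
Proof.
move=> mk ki k0.
have loc : locally_integrable setT k by apply: open_integrable_locally => //; exact: openT.
have ki' y : mu.-integrable [set` Interval (BLeft 0) (BRight y)] (EFin \o k).
  by apply: integrableS ki.
have := FTC1 ki' loc.
move=> h; apply: (ae_imp h) => x hx x0.
have [_ <-] := hx x0.
have -> : (fun x0 : R => \int[mu]_(t in [set` Interval (BLeft 0) (BRight x0)]) k t) = (fun _ => 0).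
  by apply/funext => y; exact: k0.
by rewrite derive1_cst.
Qed.


Lemma continuous1_bounded (f : R -> R) (a b : R) : continuous f ->
  exists M, forall t, a <= t <= b -> `|f t| <= M.
Proof.
move=> cf; have c2 : continuous (fun p : R * R => f p.1).
  move=> p; have h : q.1 @[q --> p] --> p.1 by exact: cvg_fst.
  exact: (cvg_comp _ _ h (cf _)).
have [M HM] := @continuous2_bounded R (fun p => f p.1) a b 0 0 c2.
by exists M => t tt; apply: (HM t 0) => //; rewrite lexx.
Qed.

Lemma cint_eq_oc (a b : R) (f f' : R -> C) : cmeas f -> cmeas f' ->
  (forall x, a < x <= b -> f x = f' x) -> cint `[a, b] f = cint `[a, b] f'.
Proof.
move=> [m1 m2] [m1' m2'] E.
have P (k : C -> R) : measurable_fun setT (fun x => k (f x)) -> measurable_fun setT (fun x => k (f' x)) ->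
    \int[mu]_(x in `[a, b]) k (f x) = \int[mu]_(x in `[a, b]) k (f' x).
  move=> n1 n2; rewrite /Rintegral -!integral_itv_obnd_cbnd; last 2 first.
  - by apply/measurable_EFinP; exact: measurable_funTS.
  - by apply/measurable_EFinP; exact: measurable_funTS.
  congr fine; apply: eq_integral => x /set_mem /=; rewrite in_itv /= => h.
  by rewrite E.
by apply: complex_ext; [exact: (P cre)|exact: (P cim)].
Qed.

Lemma cutc_out (a b x : R) (f : R -> C) : ~~ (a <= x <= b) -> a <= b -> cutc a b f x = 0.
Proof.
move=> xab ab; rewrite /cutc /cut; case: eqVneq => [xb|_].
  by move: xab; rewrite xb ab lexx.
by case: ifP => // /andP[h1 h2]; move: xab; rewrite h1 ltW.
Qed.

Lemma cutc_cL1 (a b : R) (f : R -> C) : cL2 a b f -> cL1 `[a, b] (cutc a b f).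
Proof.
move=> hf; have [_ [_ fi]] := hf.
apply: (@cL1_le _ _ _ (fun x => 1 + cabs2 (f x))) => //.
- exact: cL2_cutc_cmeas.
- by apply: RintegrableD => //; exact: integrable_cst_itv.
- move=> x /=; rewrite in_itv /= => xab; rewrite cutcE //.
  by have := norm1_le_young (f x) ltr01; rewrite invr1 mul1r.
Qed.

Variables (L : R) (g : R -> C).
Hypotheses (L0 : 0 < L) (Hg : cL2 0 L g).

(** Nearest-point projection onto [[0, L]], as a centred clamp. Composition with it extends
    functions of time from [[0, L]] to the line and keeps continuity and bounds. *)
Definition proj0L (t : R) : R := clamp (L / 2) (t - L / 2) + L / 2.

Lemma proj0L_in t : 0 <= proj0L t <= L.
Proof.
have L2 : 0 <= L / 2 by rewrite divr_ge0 // ltW.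
have := clamp_le (t - L / 2) L2; rewrite ler_norml /proj0L => /andP[h1 h2].
by apply/andP; split; lra.
Qed.

Lemma proj0L_id t : 0 <= t <= L -> proj0L t = t.
Proof.
move=> /andP[t0 tL]; rewrite /proj0L clamp_id ?subrK //.
by rewrite ler_norml; apply/andP; split; lra.
Qed.

Lemma proj0L_lip s t : `|proj0L s - proj0L t| <= `|s - t|.
Proof.
have L2 : 0 <= L / 2 by rewrite divr_ge0 // ltW.
have -> : proj0L s - proj0L t = clamp (L / 2) (s - L / 2) - clamp (L / 2) (t - L / 2) by rewrite /proj0L; ring.
have -> : s - t = (s - L / 2) - (t - L / 2) by ring.
exact: clamp_lip.
Qed.

Lemma cutcB (x : R) (u v : R -> C) : 0 <= x <= L ->
  cutc 0 L u x - cutc 0 L v x = u x - v x.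
Proof. by move=> xL; rewrite !cutcE. Qed.

Lemma mean_continuous (u : R -> R -> C) : L2cont L L u ->
  continuous (fun t => cre (cint `[0, L] (u (proj0L t)))) /\
  continuous (fun t => cim (cint `[0, L] (u (proj0L t)))).
Proof.
move=> [u2 uc].
suff H : forall t e, 0 < e -> exists2 d : R, 0 < d & forall s, `|s - t| < d ->
    norm1 (cint `[0, L] (u (proj0L s)) - cint `[0, L] (u (proj0L t))) < e.
  split=> t; apply/cvgrPdist_lt => e e0; have [d d0 hd] := H t e e0; exists d => //= s;
    rewrite /ball /= distrC => /hd; apply: le_lt_trans; rewrite distrC.
    by have := cre_le_norm1 (cint `[0, L] (u (proj0L s)) - cint `[0, L] (u (proj0L t))); rewrite !reimE.
  by have := cim_le_norm1 (cint `[0, L] (u (proj0L s)) - cint `[0, L] (u (proj0L t))); rewrite !reimE.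
(* Young weight: [k * L = e / 4], and an L2 error below [k * e / 4] divided by [k] is below
   [e / 4]. *)
move=> t e e0; pose k := e / (4 * L).
have k0 : 0 < k by rewrite divr_gt0 // mulr_gt0.
have ke : 0 < k * e / 4 by rewrite divr_gt0 // mulr_gt0.
have [d d0 hd] := uc _ (proj0L_in t) _ ke.
exists d => // s st.
have hst := hd _ (proj0L_in s) (le_lt_trans (proj0L_lip s t) st).
have c1 := cutc_cL1 (u2 _ (proj0L_in s)); have c2 := cutc_cL1 (u2 _ (proj0L_in t)).
have m1 := cL2_cutc_cmeas (u2 _ (proj0L_in s)); have m2 := cL2_cutc_cmeas (u2 _ (proj0L_in t)).
have -> : cint `[0, L] (u (proj0L s)) - cint `[0, L] (u (proj0L t)) =
    cint `[0, L] (fun x => cutc 0 L (u (proj0L s)) x - cutc 0 L (u (proj0L t)) x).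
  rewrite cintB //; congr (_ - _); apply: eq_cint => x /=; rewrite in_itv /= => h;
    by rewrite cutcE.
have [_ [_ i1]] := u2 _ (proj0L_in s); have [_ [_ i2]] := u2 _ (proj0L_in t).
have i3 : mu.-integrable `[0, L] (EFin \o (fun x => cabs2 (cutc 0 L (u (proj0L s)) x - cutc 0 L (u (proj0L t)) x))).
  apply: (@Rintegrable_le _ _ _ (fun x => 2 * cabs2 (u (proj0L s) x) + 2 * cabs2 (u (proj0L t) x))) => //.
  - by apply: measurable_cabs2; exact: cmeasB.
  - by apply: RintegrableD => //; exact: RintegrableZ.
  - move=> x /=; rewrite in_itv /= => xL; rewrite ger0_norm ?cabs2_ge0 // cutcB //.
    exact: cabs2B_le.
apply: (@le_lt_trans _ _ (\int[mu]_(x in `[0, L])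
    (k + k^-1 * cabs2 (cutc 0 L (u (proj0L s)) x - cutc 0 L (u (proj0L t)) x)))).
  apply: norm1_cint_le => //.
  - exact: cmeasB.
  - by apply: RintegrableD => //; [exact: integrable_cst_itv|exact: RintegrableZ].
  - by move=> x _; exact: norm1_le_young.
rewrite RintegralD //; [|exact: integrable_cst_itv|exact: RintegrableZ].
rewrite (Rintegral_cst_itv _ (ltW L0)) RintegralZl // subr0.
have -> : \int[mu]_(x in `[0, L]) cabs2 (cutc 0 L (u (proj0L s)) x - cutc 0 L (u (proj0L t)) x) =
    \int[mu]_(x in `[0, L]) cabs2 (u (proj0L s) x - u (proj0L t) x).
  by apply: eq_Rintegral => x /set_mem /=; rewrite in_itv /= => xL; rewrite cutcB.
have : k^-1 * \int[mu]_(x in `[0, L]) cabs2 (u (proj0L s) x - u (proj0L t) x) < e / 4.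
  by rewrite ltr_pdivrMl // mulrA.
have -> : k * L = e / 4 by rewrite /k; field; rewrite gt_eqF.
lra.
Qed.

(** The vanishing of [psi] up to [tau] gives the boundary condition [phi t 0 = 0]. All unknowns are
    collected on the left; the right-hand side depends on the data alone and cancels between two
    solutions. *)
Lemma weak_test (u0 U : R -> C) (u : R -> R -> C) (tau : R) (psi dpsi : R -> R) :
  weak_solution L L g u0 U u -> 0 <= tau <= L ->
  (forall y : R, is_derive y (1 : R) psi (dpsi y)) -> continuous dpsi ->
  (forall y, y <= tau -> psi y = 0) ->
  cint `[0, tau] (fun t => - (cint `[0, L] (u t) * cint `[0, L] (fun y => gt L g y * cmk (psi (t + y)) 0)))
  + cint `[0, L] (fun x => u tau x * cmk (psi (tau + x)) 0)
  = cint `[0, L] (fun x => u0 x * cmk (psi x) 0)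
  + cint `[0, tau] (fun t => U t * cmk (psi (t + L)) 0).
Proof.
move=> [[u2 _] uw] /andP[tau0 tauL] dp cdp psi0.
have [Hphi ptpx] := real_test_C1 dp cdp.
have conjr (a : R) : cconj (cmk a 0) = cmk a 0.
  by apply: complex_ext; rewrite !reimE // oppr0.
have tauin : 0 <= tau <= L by rewrite tau0.
have := uw tau tauin _ Hphi.
have v0 t : 0 <= t <= tau -> cmk (psi (t + 0)) 0 = 0 :> C.
  by move=> /andP[_ tt]; rewrite psi0 // addr0.
move=> /(_ v0).
have -> : cint `[0, tau] (fun t => cint `[0, L] (fun x => u t x * cconj
    (- pt (fun t x : R => cmk (psi (t + x)) 0) t x + px (fun t x : R => cmk (psi (t + x)) 0) t x
     - cint `[0, L] (fun y => cconj (g y) * cmk (psi (t + y)) 0)))) =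
  cint `[0, tau] (fun t => - (cint `[0, L] (u t) * cint `[0, L] (fun y => gt L g y * cmk (psi (t + y)) 0))).
  apply: eq_cint => t tt0; have tt : 0 <= t <= tau by move: tt0; rewrite /= in_itv.
  have tL : 0 <= t <= L by move: tt => /andP[-> h]; rewrite (le_trans h).
  have mpsi : measurable_fun setT (fun y : R => psi (t + y)).
    apply: (measurableT_comp (continuous_measurable_fun (is_derive_continuous dp))).
    exact: measurable_funD.
  have [M HM] := continuous1_bounded t (t + L) (is_derive_continuous dp).
  have AI : cconj (cint `[0, L] (fun y => cconj (g y) * cmk (psi (t + y)) 0)) =
      cint `[0, L] (fun y => gt L g y * cmk (psi (t + y)) 0).
    rewrite (@adjoint_integral _ L g Hg (fun y => cmk (psi (t + y)) 0) M).
    - by apply: eq_cint => y _; rewrite conjr.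
    - by split => //; exact: measurable_cst.
    - move=> x /andP[x0 xL]; rewrite /norm1 !reimE normr0 addr0; apply: HM.
      by rewrite lerDl x0 lerD2l.
  rewrite -AI; set c := cint _ (fun y => cconj (g y) * _).
  transitivity (cint `[0, L] (fun x => cutc 0 L (u t) x * (- cconj c))).
    apply: eq_cint => x xL0; have xL : 0 <= x <= L by move: xL0; rewrite /= in_itv.
    rewrite cutcE // ptpx addNr sub0r.
    by congr (_ * _); apply: complex_ext; rewrite !reimE.
  rewrite cintZr //; last exact: cutc_cL1 (u2 t tL).
  rewrite mulrN; congr (- (_ * _)); apply: eq_cint => x /=; rewrite in_itv /= => xL.
  by rewrite cutcE.
have -> : cint `[0, L] (fun x => u tau x * cconj (cmk (psi (tau + x)) 0)) =
    cint `[0, L] (fun x => u tau x * cmk (psi (tau + x)) 0).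
  by apply: eq_cint => x _; rewrite conjr.
have -> : cint `[0, L] (fun x => u0 x * cconj (cmk (psi (0 + x)) 0)) =
    cint `[0, L] (fun x => u0 x * cmk (psi x) 0).
  by apply: eq_cint => x _; rewrite conjr add0r.
have -> : cint `[0, tau] (fun t => U t * cconj (cmk (psi (t + L)) 0)) =
    cint `[0, tau] (fun t => U t * cmk (psi (t + L)) 0).
  by apply: eq_cint => x _; rewrite conjr.
by move=> E; rewrite -[LHS]subr0 -[in LHS]E; ring.
Qed.

Section TwoSolutions.
Variables (u0 U : R -> C) (u v : R -> R -> C).
Hypotheses (wu : weak_solution L L g u0 U u) (wv : weak_solution L L g u0 U v).

Let hd (t : R) : C := cint `[0, L] (u (proj0L t)) - cint `[0, L] (v (proj0L t)).
Let wd (t x : R) : C := cutc 0 L (u t) x - cutc 0 L (v t) x.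

Let hd_cont : continuous (fun t => cre (hd t)) /\ continuous (fun t => cim (hd t)).
Proof.
have [a1 a2] := mean_continuous wu.1; have [b1 b2] := mean_continuous wv.1.
split.
  rewrite (_ : (fun t => _) = (fun t => cre (cint `[0, L] (u (proj0L t))) - cre (cint `[0, L] (v (proj0L t))))).
    by move=> t; apply: cvgB; [exact: a1|exact: b1].
  by apply/funext => t; rewrite /hd !reimE.
rewrite (_ : (fun t => _) = (fun t => cim (cint `[0, L] (u (proj0L t))) - cim (cint `[0, L] (v (proj0L t))))).
  by move=> t; apply: cvgB; [exact: a2|exact: b2].
by apply/funext => t; rewrite /hd !reimE.
Qed.

Let hd_cmeas : cmeas hd.
Proof. by have [c1 c2] := hd_cont; split; exact: continuous_measurable_fun. Qed.

Let hd_bounded : exists M, forall t, norm1 (hd t) <= M.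
Proof.
have [c1 c2] := hd_cont.
have [M1 H1] := continuous1_bounded 0 L c1; have [M2 H2] := continuous1_bounded 0 L c2.
exists (M1 + M2) => t.
have -> : hd t = hd (proj0L t) by rewrite /hd (proj0L_id (proj0L_in t)).
by apply: lerD; [apply: H1|apply: H2]; exact: proj0L_in.
Qed.

Let wd_cL1 t : 0 <= t <= L -> cL1 `[0, L] (wd t).
Proof.
by move=> tt; apply: cL1B => //; apply: cutc_cL1; [apply: wu.1.1|apply: wv.1.1].
Qed.

Let hd_wd t : 0 <= t <= L -> hd t = cint `[0, L] (wd t).
Proof.
move=> tt; rewrite /hd proj0L_id // /wd cintB //; last 2 first.
- by apply: cutc_cL1; apply: wu.1.1.
- by apply: cutc_cL1; apply: wv.1.1.
by congr (_ - _); apply: eq_cint => x /=; rewrite in_itv /= => h; rewrite cutcE.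
Qed.

Let Xpsi (psi : R -> R) (t : R) : C := cint `[0, L] (fun y => gt L g y * cmk (psi (t + y)) 0).

Let cmk_cmeas (psi : R -> R) : measurable_fun setT psi -> cmeas (fun x => cmk (psi x) 0 : C).
Proof. by move=> mp; split => //; exact: measurable_cst. Qed.

Let Xpsi_cmeas (psi : R -> R) : measurable_fun setT psi -> cmeas (Xpsi psi).
Proof.
move=> mp; apply: (@cmeas_cint _ _ _ _ (fun t y : R => gt L g y * cmk (psi (t + y)) 0)) => //.
apply: cmeasM; first by apply: (cmeas_comp (gt_cmeas Hg)).
apply: (cmeas_comp (cmk_cmeas mp)); exact: measurable_funD.
Qed.

Let Xpsi_le (psi : R -> R) t : measurable_fun setT psi -> (forall y, `|psi y| <= 1) ->
  norm1 (Xpsi psi t) <= normg L g.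
Proof.
move=> mp p1; have [mg gi] := gt_cL1 Hg (measurable_itv `[0, L]%R).
apply: (@le_trans _ _ (\int[mu]_(x in `[0, L]) norm1 (gt L g x))).
  apply: norm1_cint_le => //.
  - apply: cmeasM => //; apply: (cmeas_comp (cmk_cmeas mp)); exact: measurable_funD.
  - move=> y _; apply: (le_trans (norm1M _ _)); apply: ler_piMr; first exact: norm1_ge0.
    by rewrite /norm1 !reimE normr0 addr0.
by have := normg_shift Hg 0 L 0; under eq_Rintegral do rewrite addr0.
Qed.

Let test_diff tau (psi dpsi : R -> R) : 0 <= tau <= L ->
  (forall y : R, is_derive y (1 : R) psi (dpsi y)) -> continuous dpsi ->
  (forall y, y <= tau -> psi y = 0) -> (forall y, `|psi y| <= 1) ->
  cint `[0, L] (fun x => wd tau x * cmk (psi (tau + x)) 0) =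
  cint `[0, tau] (fun t => hd t * Xpsi psi t).
Proof.
move=> tt dp cdp p0 p1; have [tau0 tauL] := andP tt.
have mp : measurable_fun setT psi by exact: (continuous_measurable_fun (is_derive_continuous dp)).
have Eu := weak_test wu tt dp cdp p0; have Ev := weak_test wv tt dp cdp p0.
have mX := Xpsi_cmeas mp.
have hub (w : R -> R -> C) : weak_solution L L g u0 U w ->
    cL1 `[0, tau] (fun t => - (cint `[0, L] (w (proj0L t)) * Xpsi psi t)).
  move=> ww; apply: cL1N; have [c1 c2] := mean_continuous ww.1.
  have [M1 H1] := continuous1_bounded 0 L c1; have [M2 H2] := continuous1_bounded 0 L c2.
  apply: (@cL1_bounded _ _ _ ((M1 + M2) * normg L g)) => //; first exact: itv_fin.
    by apply: cmeasM => //; split; exact: continuous_measurable_fun.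
  move=> t /=; rewrite in_itv /= => /andP[t0 tt']; apply: (le_trans (norm1M _ _)).
  have tL : 0 <= t <= L by rewrite t0 (le_trans tt').
  apply: ler_pM; [exact: norm1_ge0|exact: norm1_ge0| |exact: Xpsi_le].
  by apply: lerD; [exact: H1|exact: H2].
have pr (w : R -> R -> C) :
    cint `[0, tau] (fun t => - (cint `[0, L] (w t) * Xpsi psi t)) =
    cint `[0, tau] (fun t => - (cint `[0, L] (w (proj0L t)) * Xpsi psi t)).
  apply: eq_cint => t /=; rewrite in_itv /= => /andP[t0 tt'].
  by rewrite proj0L_id // t0 (le_trans tt').
have wub (w : R -> R -> C) : weak_solution L L g u0 U w ->
   cL1 `[0, L] (fun x => cutc 0 L (w tau) x * cmk (psi (tau + x)) 0).
  move=> ww; apply: (@cL1Mb _ _ _ _ 1) => //.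
  - by apply: cutc_cL1; apply: ww.1.1.
  - by apply: (cmeas_comp (cmk_cmeas mp)); exact: measurable_funD.
  - by move=> x _; rewrite /norm1 !reimE normr0 addr0.
have -> : cint `[0, L] (fun x => wd tau x * cmk (psi (tau + x)) 0) =
   cint `[0, L] (fun x => u tau x * cmk (psi (tau + x)) 0) -
   cint `[0, L] (fun x => v tau x * cmk (psi (tau + x)) 0).
  transitivity (cint `[0, L] (fun x => cutc 0 L (u tau) x * cmk (psi (tau + x)) 0
     - cutc 0 L (v tau) x * cmk (psi (tau + x)) 0)).
    by apply: eq_cint => x _; rewrite /wd mulrBl.
  rewrite cintB //; [|exact: wub..].
  by congr (_ - _); apply: eq_cint => x /=; rewrite in_itv /= => h; rewrite cutcE.
transitivity (cint `[0, tau] (fun t => - (cint `[0, L] (v (proj0L t)) * Xpsi psi t)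
   - - (cint `[0, L] (u (proj0L t)) * Xpsi psi t))); last first.
  by apply: eq_cint => t _; rewrite /hd mulrBl; ring.
rewrite cintB //; [|exact: hub..].
rewrite -!pr; have E2 := etrans Eu (esym Ev).
have swap (a x b y : C) : a + x = b + y -> x - y = b - a.
  by move=> h; have -> : x = b + y - a; [rewrite -h|]; ring.
exact: (swap _ _ _ _ E2).
Qed.

Let step (a y : R) : R := if a < y then 1 else 0.

Let step_meas a : measurable_fun setT (step a).
Proof. by apply: measurable_fun_ifT => //; exact: measurable_fun_ltr. Qed.

Let step_le a y : `|step a y| <= 1.
Proof. by rewrite /step; case: ifP; rewrite ?normr1 ?normr0. Qed.

Let ccvg_cmk (r_ : nat -> R) (r : R) : r_ n @[n --> \oo] --> r ->
  ccvg (fun n => cmk (r_ n) 0 : C) (cmk r 0).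
Proof. by move=> h; split => //; exact: cvg_cst. Qed.

(** Dominated convergence along ramps that start at [tau + a]; [a >= 0] keeps them zero up to [tau].
    The left side becomes the integral of the difference of the states over the part of [[0, L]]
    beyond [a]. *)
Let step_diff tau a : 0 <= tau <= L -> 0 <= a ->
  cint `[0, L] (fun x => wd tau x * cmk (step (tau + a) (tau + x)) 0) =
  cint `[0, tau] (fun t => hd t * Xpsi (step (tau + a)) t).
Proof.
move=> tt a0; have [M HM] := hd_bounded.
have M0 : 0 <= M by exact: le_trans (norm1_ge0 _) (HM 0).
pose psi n (y : R) := ramp n (y - (tau + a)).
have dpsi n (y : R) : is_derive y (1 : R) (psi n) (dramp n (y - (tau + a))).
  have d3 : is_derive y (1 : R) (fun s : R => s - (tau + a)) 1.
    by have := is_deriveB (is_derive_id y (1 : R)) (is_derive_cst (tau + a) y (1 : R)); rewrite subr0.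
  by have := @is_derive1_comp R (ramp n) (fun s => s - (tau + a)) y _ _ (is_derive_ramp n _) d3; rewrite mulr1.
have cdpsi n : continuous (fun y => dramp n (y - (tau + a))).
  move=> y; have hs : (x - (tau + a)) @[x --> y] --> y - (tau + a).
    by apply: cvgB; [exact: cvg_id|exact: cvg_cst].
  exact: (cvg_comp _ _ hs (@dramp_continuous n _)).
have psi0 n y : y <= tau -> psi n y = 0 by move=> yt; apply: ramp_neg; lra.
have psi1 n y : `|psi n y| <= 1 by exact: ramp_le1.
have mpsi n : measurable_fun setT (psi n).
  exact: (continuous_measurable_fun (is_derive_continuous (dpsi n))).
have psic y : psi n y @[n --> \oo] --> step (tau + a) y.
  by have := @ramp_cvg (y - (tau + a)); rewrite /step subr_gt0.
have lhs : ccvg (fun n => cint `[0, L] (fun x => wd tau x * cmk (psi n (tau + x)) 0))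
   (cint `[0, L] (fun x => wd tau x * cmk (step (tau + a) (tau + x)) 0)).
  have [mw wi] := wd_cL1 tt.
  apply: (@ccvg_cint _ _ _ (fun x => norm1 (wd tau x))) => //.
  - by move=> n; apply: cmeasM => //; apply: (cmeas_comp (cmk_cmeas (mpsi n))); exact: measurable_funD.
  - by apply: cmeasM => //; apply: (cmeas_comp (cmk_cmeas (step_meas _))); exact: measurable_funD.
  - by move=> x _; apply: ccvgM; [exact: ccvg_cst|exact: ccvg_cmk].
  - move=> n x _; apply: (le_trans (norm1M _ _)); apply: ler_piMr; first exact: norm1_ge0.
    by rewrite /norm1 !reimE normr0 addr0.
have Xc t : ccvg (fun n => Xpsi (psi n) t) (Xpsi (step (tau + a)) t).
  have [mg gi] := gt_cL1 Hg (measurable_itv `[0, L]%R).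
  apply: (@ccvg_cint _ _ _ (fun x => norm1 (gt L g x))) => //.
  - by move=> n; apply: cmeasM => //; apply: (cmeas_comp (cmk_cmeas (mpsi n))); exact: measurable_funD.
  - by apply: cmeasM => //; apply: (cmeas_comp (cmk_cmeas (step_meas _))); exact: measurable_funD.
  - by move=> x _; apply: ccvgM; [exact: ccvg_cst|exact: ccvg_cmk].
  - move=> n x _; apply: (le_trans (norm1M _ _)); apply: ler_piMr; first exact: norm1_ge0.
    by rewrite /norm1 !reimE normr0 addr0.
have rhs : ccvg (fun n => cint `[0, tau] (fun t => hd t * Xpsi (psi n) t))
   (cint `[0, tau] (fun t => hd t * Xpsi (step (tau + a)) t)).
  apply: (@ccvg_cint _ _ _ (fun _ => M * normg L g)) => //.
  - by move=> n; apply: cmeasM => //; exact: Xpsi_cmeas.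
  - by apply: cmeasM => //; exact: Xpsi_cmeas.
  - by move=> t _; apply: ccvgM; [exact: ccvg_cst|exact: Xc].
  - exact: integrable_cst_itv.
  - move=> n t _; apply: (le_trans (norm1M _ _)).
    by apply: ler_pM; [exact: norm1_ge0|exact: norm1_ge0|exact: HM|exact: Xpsi_le].
apply: (ccvg_unique lhs).
rewrite (_ : (fun n => _) = (fun n => cint `[0, tau] (fun t => hd t * Xpsi (psi n) t))) //.
by apply/funext => n; exact: (test_diff tt (dpsi n) (cdpsi n) (psi0 n) (psi1 n)).
Qed.

(** At [a = 0] the step is 1 on the whole of [[0, L]] but its left end, so the difference of the
    means is the integral over [[0, s]] of itself against a factor bounded by [normg]. Gronwall
    closes the argument. *)
Let hd0 t : 0 <= t <= L -> hd t = 0.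
Proof.
move=> tt; have [M HM] := hd_bounded.
have M0 : 0 <= M by exact: le_trans (norm1_ge0 _) (HM 0).
apply: norm1_le0; rewrite (@gronwall_zero (fun t => norm1 (hd t)) (normg L g) M L) //.
- exact: normg_ge0.
- exact: measurable_norm1.
- by move=> s _; rewrite norm1_ge0 HM.
- move=> s ss; have [s0 sL] := andP ss.
  have -> : norm1 (hd s) = norm1 (cint `[0, s] (fun t => hd t * Xpsi (step (s + 0)) t)).
    rewrite -(step_diff ss (lexx 0)) hd_wd //; congr norm1; have [mw wi] := wd_cL1 ss.
    apply: cint_eq_oc => //.
      by apply: cmeasM => //; apply: (cmeas_comp (cmk_cmeas (step_meas _))); exact: measurable_funD.
    move=> x /andP[x0 xL]; rewrite /step addr0 ltrDl x0.
    by apply: complex_ext; rewrite !reimE; ring.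
  have hi : mu.-integrable `[0, s] (EFin \o (fun t => norm1 (hd t))).
    apply: (@Rintegrable_le _ _ _ (fun _ => M)) => //; first exact: measurable_norm1.
      exact: integrable_cst_itv.
    by move=> r _; rewrite ger0_norm ?norm1_ge0.
  rewrite -RintegralZl //; apply: norm1_cint_le => //.
  + by apply: cmeasM => //; exact: Xpsi_cmeas.
  + exact: RintegrableZ.
  + move=> r _; apply: (le_trans (norm1M _ _)); rewrite mulrC.
    by apply: ler_wpM2r; [exact: norm1_ge0|exact: Xpsi_le].
Qed.

(** Once the means agree, the integral of the difference of the final states over every tail of
    [[0, L]] is 0, hence so is every primitive, and differentiation gives equality almost
    everywhere. *)
Lemma weak_solution_final_unique : {ae mu, forall x, `[0, L] x -> u L x = v L x}.
Proof.
have LL : 0 <= L <= L by rewrite ltW /=.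
have [mw wi] := wd_cL1 LL.
have wout x : ~~ (0 <= x <= L) -> wd L x = 0.
  by move=> h; rewrite /wd !cutc_out ?subrr // ltW.
have tail a : 0 <= a -> cint `[0, L] (fun x => wd L x * cmk (step (L + a) (L + x)) 0) = 0.
  move=> a0; rewrite (step_diff LL a0) -[RHS](cint0 `[0, L]).
  by apply: eq_cint => t /=; rewrite in_itv /= => tL; rewrite hd0 // mul0r.
have tot : cint `[0, L] (wd L) = 0.
  by rewrite -hd_wd // hd0.
(* Inside [[0, L]] the primitive is the total minus the tail beyond [x]; before 0 the interval is
   empty and past [L] the difference is 0. *)
have prim x : cint `[0, x] (wd L) = 0.
  case: (ltP x 0) => x0.
    rewrite set_itv_ge; last by rewrite bnd_simp -ltNge.
    by apply: complex_ext; rewrite ?cre_cint ?cim_cint Rintegral_set0.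
  case: (leP x L) => xL; last first.
    rewrite -tot [RHS](cint_sub _ (lexx 0) (ltW xL)); apply: eq_cint => y /=.
    by rewrite in_itv /= => /andP[y0 yx]; case: ifPn => // /wout.
  have E : cint `[0, x] (wd L) =
      cint `[0, L] (wd L) - cint `[0, L] (fun y => wd L y * cmk (step (L + x) (L + y)) 0).
    rewrite -cintB //; last first.
      apply: (@cL1Mb _ _ _ _ 1) => //.
        by apply: (cmeas_comp (cmk_cmeas (step_meas _))); exact: measurable_funD.
      by move=> y _; rewrite /norm1 !reimE normr0 addr0.
    rewrite (cint_sub _ (lexx 0) xL).
    apply: eq_cint => y /=; rewrite in_itv /= => /andP[y0 yL]; rewrite y0 /step ltrD2l.
    by case: (leP y x) => _; apply: complex_ext; rewrite !reimE; ring.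
  by rewrite E tot tail // subr0.
have intT (k : C -> R) : (forall z, `|k z| <= norm1 z) -> measurable_fun setT (fun x => k (wd L x)) ->
    mu.-integrable setT (EFin \o (fun x => k (wd L x))).
  move=> kn mk.
  have h : mu.-integrable setT ((fun x => (norm1 (wd L x))%:E) \_ `[0, L]).
    exact: ((@integrable_mkcond _ (measurableTypeR R) R mu _ _ (measurable_itv `[0, L]%R)).1 wi).
  apply: le_integrable h => //; first exact/measurable_EFinP.
  move=> x _; rewrite /= patchE; case: ifPn => [_|/negP xL].
    by rewrite lee_fin (le_trans (kn _)) // ler_norm.
  have -> : wd L x = 0.
    apply: wout; apply/negP => h; apply: xL; apply/mem_set; by rewrite /= in_itv.
  have := kn 0; rewrite norm1_0 normr_le0 => /eqP ->.
  by rewrite normr0; exact: abse_ge0.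
have [m1 m2] := mw.
have z1 := ae0_of_primitive m1 (intT cre cre_le_norm1 m1) (fun x => congr1 cre (prim x)).
have z2 := ae0_of_primitive m2 (intT cim cim_le_norm1 m2) (fun x => congr1 cim (prim x)).
(* The differentiation argument speaks of [x > 0] only, so the point 0 of [[0, L]] is discarded. *)
have z3 : {ae mu, forall x : R, x <> 0}.
  exists [set 0]; split => //; first exact: lebesgue_measure_set1.
  by move=> x /=; apply: contra_notP.
have : {ae mu, forall x, (0 < x -> cre (wd L x) = 0) /\ (0 < x -> cim (wd L x) = 0) /\ x <> 0}.
  exact: (filterI (F := almost_everywhere mu) z1 (filterI (F := almost_everywhere mu) z2 z3)).
move=> H; apply: (ae_imp H) => x [h1 [h2 h3]] /=; rewrite in_itv /= => xL.
have x0 : 0 < x by rewrite lt_neqAle eq_sym (introN eqP h3) /=; case/andP: xL.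
have : wd L x = 0 by apply: complex_ext; [exact: h1|exact: h2].
by rewrite /wd !cutcE // => /eqP; rewrite subr_eq0 => /eqP.
Qed.

End TwoSolutions.

End Uniqueness.

(** * Convolution on the circle and the Neumann series *)

Section Circle.
Context {R : realType}.
Local Notation C := (R[i]).
Local Notation mu := (@lebesgue_measure R).

(** The space, with its sup norm, in which the equation on the circle is solved. The L2 data enter
    that equation only through their integrals, which are bounded functions of time. *)
Definition bm (f : R -> C) := cmeas f /\ exists M : R, forall x, norm1 (f x) <= M.

Lemma bm_bound f : bm f -> exists2 M : R, 0 <= M & forall x, norm1 (f x) <= M.
Proof. by move=> [_ [M HM]]; exists M => //; exact: le_trans (norm1_ge0 _) (HM 0). Qed.

Lemma bm_cmeas f : bm f -> cmeas f. Proof. by case. Qed.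

Lemma bm_cst (c : C) : bm (fun _ => c).
Proof. by split; [exact: cmeas_cst|exists (norm1 c)]. Qed.

Lemma bmD f g : bm f -> bm g -> bm (fun x => f x + g x).
Proof.
move=> [mf [M HM]] [mg [N HN]]; split; first exact: cmeasD.
by exists (M + N) => x; apply: (le_trans (norm1D _ _)); exact: lerD.
Qed.

Lemma bmN f : bm f -> bm (fun x => - f x).
Proof.
move=> [mf [M HM]]; split; first exact: cmeasN.
by exists M => x; rewrite norm1N.
Qed.

Lemma bmB f g : bm f -> bm g -> bm (fun x => f x - g x).
Proof. by move=> hf hg; apply: bmD => //; exact: bmN. Qed.

Lemma bmM f g : bm f -> bm g -> bm (fun x => f x * g x).
Proof.
move=> [mf [M HM]] [mg [N HN]]; split; first exact: cmeasM.
by exists (M * N) => x; apply: (le_trans (norm1M _ _)); apply: ler_pM => //; exact: norm1_ge0.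
Qed.

Lemma bm_comp f (k : R -> R) : bm f -> measurable_fun setT k -> bm (fun x => f (k x)).
Proof. by move=> [mf [M HM]] mk; split; [exact: (cmeas_comp mf)|exists M]. Qed.

Lemma bm_sum (I : Type) (r : seq I) (F : I -> R -> C) : (forall i, bm (F i)) ->
  bm (fun x => \sum_(i <- r) F i x).
Proof.
move=> h; elim: r => [|i r IH].
  by rewrite (_ : (fun x => _) = (fun _ => 0)); [exact: bm_cst|apply/funext => x; rewrite big_nil].
rewrite (_ : (fun x => _) = (fun x => F i x + \sum_(j <- r) F j x)); first exact: bmD.
by apply/funext => x; rewrite big_cons.
Qed.

Lemma bm_if (b : R -> bool) f g : measurable_fun setT b -> bm f -> bm g ->
  bm (fun x => if b x then f x else g x).
Proof.
move=> mb [mf [M HM]] [mg [N HN]]; split; first exact: cmeas_if.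
exists (Num.max M N) => x; case: ifP => _; rewrite le_max ?HM ?HN ?orbT //.
Qed.

Lemma bm_cL1 f a b : bm f -> cL1 `[a, b] f.
Proof.
move=> [mf [M HM]]; apply: (@cL1_bounded _ _ _ M) => //; exact: itv_fin.
Qed.

Variable L : R.
Hypothesis L0 : 0 < L.

(** The argument is always a difference of two points of [[0, L]], so a single wrap from the left
    realises the periodic extension. *)
Definition per (f : R -> C) (r : R) : C := if 0 <= r then f r else f (r + L).
Definition circ (f k : R -> C) (t : R) : C := cint `[0, L] (fun s => per f (t - s) * k s).

Lemma bm_per f : bm f -> bm (per f).
Proof.
move=> hf; apply: bm_if => //; first exact: measurable_fun_ler.
by apply: (bm_comp hf); exact: measurable_funD.
Qed.

Lemma bm_per_sub f (t : R) : bm f -> bm (fun s => per f (t - s)).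
Proof. by move=> hf; apply: (bm_comp (bm_per hf)); exact: measurable_funB. Qed.

Lemma circ_integrand_bm f k t : bm f -> bm k -> bm (fun s => per f (t - s) * k s).
Proof. by move=> hf hk; apply: bmM => //; exact: bm_per_sub. Qed.

Lemma bm_circ f k : bm f -> bm k -> bm (circ f k).
Proof.
move=> hf hk; split.
  apply: (@cmeas_cint _ _ _ _ (fun t s : R => per f (t - s) * k s)) => //.
  apply: cmeasM; last exact: (cmeas_comp (bm_cmeas hk)).
  by apply: (cmeas_comp (bm_cmeas (bm_per hf))); exact: measurable_funB.
have [M M0 HM] := bm_bound (bm_per hf); have [N N0 HN] := bm_bound hk.
exists (M * N * (L - 0)) => t; rewrite -(Rintegral_cst_itv _ (ltW L0)).
apply: norm1_cint_le => //.
- exact: bm_cmeas (circ_integrand_bm t hf hk).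
- exact: integrable_cst_itv.
- by move=> s _; apply: (le_trans (norm1M _ _)); apply: ler_pM => //; exact: norm1_ge0.
Qed.

(** Commutativity of the convolution: the integral is cut at [s = t], and the pieces are reflected
    by [t - s] and [t + L - s], which exchanges wrapped and unwrapped values. *)
Lemma circ_swap f k t : bm f -> bm k -> 0 <= t <= L ->
  circ f k t = cint `[0, L] (fun r => f r * per k (t - r)).
Proof.
move=> hf hk /andP[t0 tL].
have mtr (c : R) : measurable_fun setT (fun r : R => c - r) by exact: measurable_funB.
have hf1 := bm_comp hf (mtr t); have hf2 := bm_comp hf (mtr (t + L)).
have hk1 := bm_comp hk (mtr t); have hk2 := bm_comp hk (mtr (t + L)).
rewrite /circ (cint_split t0 tL (bm_cL1 _ _ (circ_integrand_bm t hf hk))).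
rewrite [RHS](cint_split t0 tL (bm_cL1 _ _ (bmM hf (bm_per_sub t hk)))); congr (_ + _).
  transitivity (cint `[0, t] (fun s => f (t - s) * k (t - (t - s)))).
    apply: eq_cint => s /=; rewrite in_itv /= => /andP[s0 st].
    rewrite /per subr_ge0 st; congr (_ * k _); ring.
  rewrite (cint_reflect (f := fun r => f r * k (t - r))); last exact: bm_cmeas (bmM hf hk1).
  rewrite subrr subr0; apply: eq_cint => r /=; rewrite in_itv /= => /andP[r0 rt].
  by rewrite /per subr_ge0 rt.
transitivity (cint `[t, L] (fun s => f (t + L - s) * k (t + L - (t + L - s)))).
  apply: cint_eq_oc.
  - exact: bm_cmeas (circ_integrand_bm t hf hk).
  - have hh := bm_comp (bmM hf hk2) (mtr (t + L)); exact: bm_cmeas hh.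
  - move=> s /andP[ts sL]; rewrite /per leNgt subr_lt0 ts /=.
    by congr (f _ * k _); ring.
rewrite (cint_reflect (f := fun r => f r * k (t + L - r))); last exact: bm_cmeas (bmM hf hk2).
have -> : t + L - L = t by ring.
have -> : t + L - t = L by ring.
apply: cint_eq_oc.
- exact: bm_cmeas (bmM hf hk2).
- exact: bm_cmeas (bmM hf (bm_per_sub t hk)).
- move=> r /andP[tr rL]; rewrite /per leNgt subr_lt0 tr /=.
  by congr (_ * k _); ring.
Qed.

Lemma circD f k k' t : bm f -> bm k -> bm k' ->
  circ f (fun s => k s + k' s) t = circ f k t + circ f k' t.
Proof.
move=> hf hk hk'; rewrite /circ -cintD //; [|exact: bm_cL1 (circ_integrand_bm t hf _)..].
by apply: eq_cint => s _; rewrite mulrDr.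
Qed.

Lemma circB f k k' t : bm f -> bm k -> bm k' ->
  circ f (fun s => k s - k' s) t = circ f k t - circ f k' t.
Proof.
move=> hf hk hk'; rewrite /circ -cintB //; [|exact: bm_cL1 (circ_integrand_bm t hf _)..].
by apply: eq_cint => s _; rewrite mulrBr.
Qed.

Lemma circDl f f' k t : bm f -> bm f' -> bm k ->
  circ (fun s => f s + f' s) k t = circ f k t + circ f' k t.
Proof.
move=> hf hf' hk; rewrite /circ -cintD //; last 2 first.
- exact: bm_cL1 (circ_integrand_bm t hf hk).
- exact: bm_cL1 (circ_integrand_bm t hf' hk).
by apply: eq_cint => s _; rewrite /per; case: ifP => _; rewrite mulrDl.
Qed.

(** Young's bound of L1 against sup norm; what has to be seen is that the L1 norm over one period
    does not change under translation on the circle. *)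
Lemma circ_le f k (K t : R) : bm f -> bm k -> 0 <= t <= L -> (forall s, norm1 (k s) <= K) ->
  norm1 (circ f k t) <= (\int[mu]_(r in `[0, L]) norm1 (f r)) * K.
Proof.
move=> hf hk tL kK; have K0 : 0 <= K by exact: le_trans (norm1_ge0 _) (kK 0).
(* The modulus of [f] as a complex function: [circ_swap] against the constant 1 then gives the
   invariance of its integral. *)
pose f' r : C := cmk (norm1 (f r)) 0.
have hf' : bm f'.
  split; first by split; [exact: measurable_norm1 (bm_cmeas hf)|exact: measurable_cst].
  have [M _ HM] := bm_bound hf; exists M => x.
  by rewrite /norm1 !reimE normr0 addr0 ger0_norm ?norm1_ge0 //; exact: HM.
have E : \int[mu]_(s in `[0, L]) norm1 (per f (t - s)) = \int[mu]_(r in `[0, L]) norm1 (f r).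
  have := congr1 cre (circ_swap hf' (bm_cst 1) tL); rewrite !cre_cint => E.
  transitivity (\int[mu]_(x in `[0, L]) cre (per f' (t - x) * 1)).
    by apply: eq_Rintegral => s _; rewrite mulr1 /per; case: ifP.
  rewrite E; apply: eq_Rintegral => s _.
  by rewrite /per; case: ifP => _; rewrite mulr1.
rewrite -E; have [_ fi] := bm_cL1 0 L (bm_per_sub t hf).
rewrite mulrC -RintegralZl //; apply: norm1_cint_le => //.
- exact: bm_cmeas (circ_integrand_bm t hf hk).
- exact: RintegrableZ.
- move=> s _; apply: (le_trans (norm1M _ _)); rewrite mulrC.
  by apply: ler_wpM2r; [exact: norm1_ge0|exact: kK].
Qed.

(** With [r n] the tail of the geometric series, the intervals of centre [a n] and radius [r n] are
    nested; the supremum of their left ends lies in all of them. This provides the limit together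
    with its rate. *)
Lemma geometric_limit (a : nat -> R) (K q : R) : 0 <= q < 1 ->
  (forall n, `|a n.+1 - a n| <= K * q ^+ n) ->
  exists l, forall n, `|l - a n| <= K * q ^+ n / (1 - q).
Proof.
move=> /andP[q0 q1] ha; have q1' : 0 < 1 - q by rewrite subr_gt0.
have K0 : 0 <= K by have := ha 0%N; rewrite expr0 mulr1; exact: le_trans.
pose r n := K * q ^+ n / (1 - q).
have r0 n : 0 <= r n by rewrite divr_ge0 ?mulr_ge0 ?exprn_ge0 // ltW.
have rS n : r n - r n.+1 = K * q ^+ n.
  by rewrite /r exprS; field; rewrite gt_eqF.
have up n m : (n <= m)%N -> a n - r n <= a m - r m.
  elim: m => [|m IH]; first by rewrite leqn0 => /eqP ->.
  rewrite leq_eqVlt => /predU1P[->//|]; rewrite ltnS => /IH h; apply: (le_trans h).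
  by have := ha m; rewrite ler_norml -rS => /andP[]; lra.
have dn n m : (n <= m)%N -> a m + r m <= a n + r n.
  elim: m => [|m IH]; first by rewrite leqn0 => /eqP ->.
  rewrite leq_eqVlt => /predU1P[->//|]; rewrite ltnS => /IH h; apply: (le_trans _ h).
  by have := ha m; rewrite ler_norml -rS => /andP[]; lra.
have cross n m : a n - r n <= a m + r m.
  case: (leqP n m) => nm.
    by apply: (le_trans (up _ _ nm)); have := r0 m; lra.
  by apply: (le_trans _ (dn _ _ (ltnW nm))); have := r0 n; lra.
pose S : set R := [set a n - r n | n in setT].
have hS : has_sup S.
  split; first by exists (a 0%N - r 0%N), 0%N.
  by exists (a 0%N + r 0%N) => _ [n _ <-]; exact: cross.
exists (sup S) => n; rewrite -/(r n) ler_norml; apply/andP; split.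
  have h : a n - r n <= sup S by apply: sup_upper_bound => //; exists n.
  lra.
have h : sup S <= a n + r n by apply: ge_sup; [exact: hS.1|move=> _ [m _ <-]; exact: cross].
lra.
Qed.

Lemma cvg_geometric0 (c q : R) : 0 <= q < 1 -> c * q ^+ n @[n --> \oo] --> (0 : R).
Proof.
move=> /andP[q0 q1]; rewrite -[X in _ --> X](mulr0 c); apply: cvgM; first exact: cvg_cst.
by apply: cvg_expr; rewrite ger0_norm.
Qed.

Lemma le0_geometric (x c q : R) : 0 <= q < 1 -> (forall n, x <= c * q ^+ n) -> x <= 0.
Proof.
move=> hq h; rewrite leNgt; apply/negP => x0.
have /cvgrPdist_lt /(_ _ x0) [n _ hn] := @cvg_geometric0 c q hq.
have := hn n (leqnn n); rewrite /= sub0r normrN => h1.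
by have := le_lt_trans (le_trans (h n) (ler_norm _)) h1; rewrite ltxx.
Qed.

(** The iteration [h := f - circ E h] contracts in sup norm by the L1 norm [q] of [E]. Coordinates
    converge at a geometric rate uniform in [t], so the limit is measurable and bounded and solves
    the equation. *)
Lemma neumann (E f : R -> C) : bm E -> bm f -> \int[mu]_(r in `[0, L]) norm1 (E r) < 1 ->
  exists h, bm h /\ forall t, 0 <= t <= L -> h t + circ E h t = f t.
Proof.
move=> hE hf; set q := \int[mu]_(r in `[0, L]) norm1 (E r) => q1.
have q0 : 0 <= q by apply: Rintegral_ge0 => x _; exact: norm1_ge0.
have hq : 0 <= q < 1 by rewrite q0.
have mproj : measurable_fun setT (proj0L L).
  apply: continuous_measurable_fun => t; apply/cvgrPdist_lt => e e0; near=> s.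
  apply: (le_lt_trans (proj0L_lip L0 t s)); near: s.
  exact: cvgr_dist_lt (@cvg_id _ _) e e0.
(* [circ_le] holds for times in [[0, L]]; evaluating at [proj0L] makes the iterates satisfy it on
   the whole line. *)
pose hs := fix hs (n : nat) : R -> C := if n is n'.+1 then fun t => f t - circ E (hs n') (proj0L L t) else f.
have hsb n : bm (hs n).
  elim: n => [//|n IH] /=; apply: bmB => //.
  exact: (bm_comp (bm_circ hE IH) mproj).
have [F F0 HF] := bm_bound hf.
pose K := q * F.
have hd n t : norm1 (hs n.+1 t - hs n t) <= K * q ^+ n.
  elim: n t => [|n IH] t.
    rewrite /= expr0 mulr1.
    have -> : f t - circ E f (proj0L L t) - f t = - circ E f (proj0L L t) by ring.
    by rewrite norm1N; apply: circ_le => //; exact: proj0L_in.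
  have -> : hs n.+2 t - hs n.+1 t = - circ E (fun s => hs n.+1 s - hs n s) (proj0L L t).
    by rewrite circB //; rewrite [hs n.+2 t]/= [hs n.+1 t]/=; ring.
  rewrite norm1N exprS mulrCA; apply: circ_le => //; [exact: bmB|exact: proj0L_in].
have ere t : exists l, forall n, `|l - cre (hs n t)| <= K * q ^+ n / (1 - q).
  apply: geometric_limit => // n; apply: le_trans (hd n t).
  by have := cre_le_norm1 (hs n.+1 t - hs n t); rewrite !reimE.
have eim t : exists l, forall n, `|l - cim (hs n t)| <= K * q ^+ n / (1 - q).
  apply: geometric_limit => // n; apply: le_trans (hd n t).
  by have := cim_le_norm1 (hs n.+1 t - hs n t); rewrite !reimE.
have [lre hre] := choice ere; have [lim him] := choice eim.
pose h t : C := cmk (lre t) (lim t).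
pose D := 2 * K / (1 - q).
have hh n t : norm1 (h t - hs n t) <= D * q ^+ n.
  rewrite /norm1 !reimE; apply: (le_trans (lerD (hre t n) (him t n))).
  by have -> : D * q ^+ n = K * q ^+ n / (1 - q) + K * q ^+ n / (1 - q) by rewrite /D; field; rewrite subr_eq0 gt_eqF.
have lim0 : (K / (1 - q)) * q ^+ n @[n --> \oo] --> (0 : R) by exact: cvg_geometric0.
have cv (a : nat -> R) (l : R) : (forall n, `|l - a n| <= K * q ^+ n / (1 - q)) -> a n @[n --> \oo] --> l.
  move=> ha; apply/cvgrPdist_lt => e e0.
  have /cvgrPdist_lt /(_ _ e0) [N _ hN] := lim0.
  exists N => // n Nn; apply: (le_lt_trans (ha n)).
  have := hN n Nn; rewrite /= sub0r normrN; apply: le_lt_trans.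
  have -> : K * q ^+ n / (1 - q) = K / (1 - q) * q ^+ n by ring.
  exact: ler_norm.
have mh : cmeas h.
  split.
    apply: (@measurable_fun_cvg _ _ R setT (fun n t => cre (hs n t))).
      by move=> n; have [[]] := hsb n.
    by move=> t _; apply: cv; exact: hre.
  apply: (@measurable_fun_cvg _ _ R setT (fun n t => cim (hs n t))).
    by move=> n; have [[]] := hsb n.
  by move=> t _; apply: cv; exact: him.
have hb : bm h.
  split => //; exists (F + D) => t.
  have -> : h t = f t + (h t - f t) by ring.
  apply: (le_trans (norm1D _ _)); apply: lerD => //.
  by have := hh 0%N t; rewrite expr0 mulr1.
exists h; split => // t tt; apply/eqP; rewrite -subr_eq0; apply/eqP; apply: norm1_le0.
(* The residual is the distance to the next iterate plus the image of the distance to the current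
   one, each at most [D * q ^+ n.+1]. *)
apply: (@le0_geometric _ (2 * D * q) q) => // n.
have -> : h t + circ E h t - f t = (h t - hs n.+1 t) + circ E (fun s => h s - hs n s) t.
  by rewrite circB // [hs n.+1 t]/= (proj0L_id tt); ring.
apply: (le_trans (norm1D _ _)).
have c1 := hh n.+1 t.
have c2 : norm1 (circ E (fun s => h s - hs n s) t) <= q * (D * q ^+ n).
  by apply: circ_le => //; exact: bmB.
move: c1 c2; rewrite exprS; set Q := q ^+ n; lra.
Unshelve. all: by end_near. Qed.

End Circle.

(** * Trigonometric approximation in L1 by powers of a cosine *)

Section Trigonometric.
Context {R : realType}.
Local Notation C := (R[i]).
Local Notation mu := (@lebesgue_measure R).

Definition cexpi (x : R) : C := cmk (cos x) (sin x).

Lemma cexpiD x y : cexpi (x + y) = cexpi x * cexpi y.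
Proof. by apply: complex_ext; rewrite !reimE ?cosD ?sinD //; ring. Qed.

Lemma cexpi0 : cexpi 0 = 1.
Proof. by apply: complex_ext; rewrite !reimE ?cos0 ?sin0. Qed.

Lemma cexpi_natM (n : nat) (x : R) : cexpi (n%:R * x) = cexpi x ^+ n.
Proof.
elim: n => [|n IH]; first by rewrite mul0r expr0 cexpi0.
by rewrite exprS -IH -cexpiD -[n.+1]addn1 natrD; congr cexpi; ring.
Qed.

Lemma bm_cexpi (k : R -> R) : measurable_fun setT k -> bm (fun x : R => cexpi (k x)).
Proof.
move=> mk; apply: (@bm_comp _ cexpi) => //; split.
  split; apply: continuous_measurable_fun; [exact: continuous_cos|exact: continuous_sin].
by exists (1 + 1) => x; apply: lerD; [exact: cos_max|exact: sin_max].
Qed.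

Lemma cmk_exp (x : R) n : cmk (x ^+ n) 0 = cmk x 0 ^+ n :> C.
Proof.
elim: n => [|n IH]; first by rewrite !expr0; apply: complex_ext; rewrite !reimE.
by rewrite [in RHS]exprS -IH; apply: complex_ext; rewrite !reimE ?exprS; ring.
Qed.

Lemma le_cos (x y : R) : 0 <= y -> y <= x -> x <= pi -> cos x <= cos y.
Proof.
move=> y0 yx xp; rewrite leNgt ltr_cos ?in_itv /= -?leNgt //.
- by rewrite (le_trans y0 yx).
- by rewrite y0 (le_trans yx).
Qed.

Variable L : R.
Hypothesis L0 : 0 < L.

Let Lneq0 : L != 0. Proof. by rewrite gt_eqF. Qed.

Definition omega := pi *+ 2 / L : R.
(** The frequencies from [- n * omega] to [n * omega] numbered by naturals from 0 to [n + n]; the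
    zero mode is [j = n]. *)
Definition freq (n j : nat) := (j%:R - n%:R) * omega.

Lemma omega_gt0 : 0 < omega.
Proof. by rewrite divr_gt0 // pmulrn_lgt0 // pi_gt0. Qed.

Lemma cexpi_freq_period n j r : cexpi (freq n j * (r + L)) = cexpi (freq n j * r).
Proof.
have e2 : cexpi (pi *+ 2) = 1 by apply: complex_ext; rewrite !reimE ?cos2pi ?sin2pi.
have -> : freq n j * (r + L) = freq n j * r + (j%:R * (pi *+ 2) + - (n%:R * (pi *+ 2))).
  by rewrite /freq /omega; field.
rewrite !cexpiD cexpi_natM e2 expr1n mul1r.
have h : cexpi (- (n%:R * (pi *+ 2))) = 1.
  have := cexpiD (n%:R * (pi *+ 2)) (- (n%:R * (pi *+ 2))).
  by rewrite subrr cexpi0 cexpi_natM e2 expr1n mul1r.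
by rewrite h mulr1.
Qed.

(** The de la Vallee-Poussin kernel before normalisation: a nonnegative trigonometric polynomial
    whose mass gathers at 0 modulo [L] as [n] grows. *)
Definition bump (n : nat) (s : R) : R := ((1 + cos (omega * s)) / 2) ^+ n.

Lemma bump_base_ge0 s : 0 <= (1 + cos (omega * s)) / 2.
Proof. by have := cos_geN1 (omega * s); lra. Qed.

Lemma bump_ge0 n s : 0 <= bump n s.
Proof. by apply: exprn_ge0; exact: bump_base_ge0. Qed.

Lemma bump_le1 n s : bump n s <= 1.
Proof. by apply: exprn_ile1; [exact: bump_base_ge0|have := cos_le1 (omega * s); lra]. Qed.

Lemma bump_period n s : bump n (s + L) = bump n s.
Proof.
rewrite /bump; have -> : omega * (s + L) = omega * s + pi *+ 2 by rewrite /omega; field.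
by rewrite cosD2pi.
Qed.

Lemma measurable_bump n : measurable_fun setT (bump n).
Proof.
apply: (@measurable_funX _ _ _ _ (fun s => (1 + cos (omega * s)) / 2)).
apply: measurable_funM => //; apply: measurable_funD => //.
apply: (@measurableT_comp _ _ _ _ _ _ (@cos R)); last exact: mulrl_measurable.
by apply: continuous_measurable_fun; exact: continuous_cos.
Qed.

Lemma integrable_bump n a b : mu.-integrable `[a, b] (EFin \o bump n).
Proof.
apply: (Rintegrable_le _ _ (integrable_cst_itv 1 a b)) => //; first exact: measurable_bump.
by move=> x _; rewrite ger0_norm ?bump_ge0 ?bump_le1.
Qed.

(* With [e = exp (i omega s)], [(1 + cos (omega s)) / 2 = (1 + e)^2 / (4 e)]. *)
Lemma bump_expand n : exists c : nat -> C,
  forall s, cmk (bump n s) 0 = \sum_(j < (n + n).+1) c j * cexpi (freq n j * s).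
Proof.
pose q : C := cmk 4^-1 0.
exists (fun j => q ^+ n *+ 'C(n + n, j)) => s.
pose e := cexpi (omega * s); pose e' := cexpi (- (omega * s)).
have ee : e' * e = 1 by rewrite -cexpiD addNr cexpi0.
have E : cmk ((1 + cos (omega * s)) / 2) 0 = q * e' * (e + 1) ^+ 2.
  have -> : q * e' * (e + 1) ^+ 2 = q * (e' * e * e + (e' * e + e' * e) + e') by ring.
  by rewrite ee; apply: complex_ext; rewrite /q /e /e' !reimE ?cosN ?sinN; field.
rewrite /bump cmk_exp E exprMn exprMn -exprM mul2n -addnn exprD1n mulr_sumr.
apply: eq_bigr => j _.
have -> : freq n j * s = j%:R * (omega * s) + n%:R * (- (omega * s)) by rewrite /freq; ring.
rewrite cexpiD !cexpi_natM -/e -/e' mulrnAr mulrnAl; congr (_ *+ _).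
by rewrite -mulrA; congr (_ * _); rewrite mulrC.
Qed.

(** On the circle [s] is small near both ends of [[0, L]]. The function [k] repeats [f] over a
    period on each side, so that [per L f (t - s)] is a genuine translate of [k], by [- s] near 0
    and by [L - s] near [L], and continuity of translations in L2 applies. *)
Lemma per_translation f : bm f -> f L = f 0 ->
  exists2 del : R, 0 < del & forall s, 0 <= s <= L -> s < del \/ L - s < del ->
    \int[mu]_(t in `[0, L]) norm1 (f t - per L f (t - s)) <= 1 / 2.
Proof.
move=> hf fL0.
pose k r := if r < 0 then f (r + L) else if r <= L then f r else f (r - L).
have hk : bm k.
  apply: bm_if; first exact: measurable_fun_ltr.
    by apply: (bm_comp hf); exact: measurable_funD.
  apply: bm_if => //; first exact: measurable_fun_ler.
  by apply: (bm_comp hf); exact: measurable_funB.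
have [M M0 HM] := bm_bound hk.
have ci (h : R -> C) (N : R) a b : cmeas h -> (forall x, norm1 (h x) <= N) ->
    mu.-integrable `[a, b] (EFin \o (fun x => cabs2 (h x))).
  move=> mh hN; apply: (Rintegrable_le _ _ (integrable_cst_itv (N ^+ 2) a b)) => //.
    exact: measurable_cabs2.
  move=> x _; rewrite ger0_norm ?cabs2_ge0 //; apply: (le_trans (cabs2_le_norm1 _)).
  by apply: lerXn2r; rewrite ?nnegrE ?norm1_ge0 //; exact: le_trans (norm1_ge0 _) (hN x).
(* Young weight: [a * L = 1 / 4], and an L2 error below [a / 4] divided by [a] is below [1 / 4]. *)
pose a := (4 * L)^-1; have a0 : 0 < a by rewrite invr_gt0 mulr_gt0.
have a40 : 0 < a / 4 by rewrite divr_gt0.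
have ki c d : mu.-integrable `[c, d] (fun x => (cabs2 (k x))%:E) by apply: ci (bm_cmeas hk) HM.
have [del d0 hd] := cL2_translation 0 L a40 (bm_cmeas hk) ki.
have main eta : `|eta| < del -> \int[mu]_(t in `[0, L]) norm1 (k t - k (t + eta)) <= 1 / 2.
  move=> /hd he.
  have hs : bm (fun t : R => k (t + eta)) by apply: (bm_comp hk); exact: measurable_funD.
  have hdf := bmB hs hk; have [N N0 HN] := bm_bound hdf.
  have i1 : mu.-integrable `[0, L] (EFin \o (fun t => cabs2 (k (t + eta) - k t))).
    exact: ci (bm_cmeas hdf) HN.
  have i2 := RintegrableZ a^-1 (measurable_itv `[0, L]%R) i1.
  have i3 := integrable_cst_itv a 0 L.
  apply: (@le_trans _ _ (\int[mu]_(t in `[0, L]) (a + a^-1 * cabs2 (k (t + eta) - k t)))).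
    apply: le_Rintegral => //.
    - by have [] := bm_cL1 0 L (bmB hk hs).
    - exact: RintegrableD.
    - by move=> t _; rewrite -norm1N opprB; exact: norm1_le_young.
  rewrite RintegralD // RintegralZl // (Rintegral_cst_itv _ (ltW L0)).
  have h2 : a^-1 * (\int[mu]_(t in `[0, L]) cabs2 (k (t + eta) - k t)) <= a^-1 * (a / 4).
    by apply: ler_wpM2l; [rewrite invr_ge0 ltW|exact: ltW].
  have e1 : a^-1 * (a / 4) = 1 / 4 by field; rewrite gt_eqF.
  have e2 : a * (L - 0) = 1 / 4 by rewrite /a; field.
  by rewrite e2; rewrite e1 in h2; lra.
exists del => // s /andP[s0 sL] [sd|sd].
  have sd' : `|- s| < del by rewrite normrN ger0_norm.
  rewrite (_ : \int[mu]_(t in _) _ = \int[mu]_(t in `[0, L]) norm1 (k t - k (t + - s))); first exact: main.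
  apply: eq_Rintegral => t /set_mem /=; rewrite in_itv /= => /andP[t0 tL].
  rewrite /per /k ltNge t0 /= tL ltNge; case: ifP => //= _.
  by rewrite (_ : t - s <= L) //; lra.
have sd' : `|L - s| < del by rewrite ger0_norm // subr_ge0.
rewrite (_ : \int[mu]_(t in _) _ = \int[mu]_(t in `[0, L]) norm1 (k t - k (t + (L - s)))); first exact: main.
apply: eq_Rintegral => t /set_mem /=; rewrite in_itv /= => /andP[t0 tL].
rewrite /per /k ltNge t0 /= tL subr_ge0.
have -> : (t + (L - s) < 0) = false by apply/negbTE; rewrite -leNgt; lra.
have -> : (t + (L - s) <= L) = (t <= s) by apply/idP/idP; lra.
have e1 : t - s + L = t + (L - s) by ring.
have e2 : t + (L - s) - L = t - s by ring.
case: (ltgtP s t) => st; rewrite ?e1 ?e2 //.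
(* At [t = s] the left side reads [f 0] and the translate of [k] reads [f L]; the two ends of [f]
   have to agree. *)
by rewrite st subrr (_ : t + (L - t) = L) ?fL0 //; ring.
Qed.

(** At distance at least [d] from 0 modulo [L] the kernel is at most [B ^+ n], while its integral is
    at least [A ^+ n * (d / 2)], where [A] is the base at [d / 2]. As [B < A], the ratio tends to
    0. *)
Lemma bump_concentrates (del eta : R) : 0 < del -> 0 < eta ->
  exists n, 0 < \int[mu]_(s in `[0, L]) bump n s /\
    forall s, del <= s <= L - del -> bump n s <= eta * \int[mu]_(s in `[0, L]) bump n s.
Proof.
(* [d <= L / 2] keeps [omega * d] in [[0, pi]], where the cosine decreases. *)
move=> del0 eta0; pose d := Num.min del (L / 2).
have d0 : 0 < d by rewrite lt_min del0 divr_gt0.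
have dd : d <= del by rewrite ge_min lexx.
have dL : d <= L / 2 by rewrite ge_min lexx orbT.
have w0 := omega_gt0.
have wpi : omega * (L / 2) = pi by rewrite /omega; field.
have wd : omega * d <= pi by rewrite -wpi ler_pM2l.
pose A := (1 + cos (omega * (d / 2))) / 2; pose B := (1 + cos (omega * d)) / 2.
have BA : B < A.
  have : cos (omega * d) < cos (omega * (d / 2)); last by rewrite /A /B; lra.
  have h1 : omega * (d / 2) < omega * d by rewrite ltr_pM2l //; lra.
  have h0 : 0 <= omega * (d / 2) by apply: mulr_ge0; [exact: ltW|lra].
  rewrite ltr_cos ?in_itv //=; first by rewrite h0 (le_trans (ltW h1)).
  by rewrite (le_trans h0 (ltW h1)).
have B0 : 0 <= B by exact: bump_base_ge0.
have A0 : 0 < A by exact: le_lt_trans BA.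
have q01 : 0 <= B / A < 1 by rewrite divr_ge0 ?(ltW A0) //= ltr_pdivrMr // mul1r.
have /cvgrPdist_lt /(_ _ eta0) [n _ hn] := @cvg_geometric0 _ (2 / d) _ q01.
have {hn} := hn n (leqnn n); rewrite /= sub0r normrN => hn.
have An0 : 0 < A ^+ n by exact: exprn_gt0.
have low : A ^+ n * (d / 2) <= \int[mu]_(s in `[0, L]) bump n s.
  have d20 : 0 <= d / 2 by rewrite ltW // divr_gt0.
  have d2L : d / 2 <= L by lra.
  rewrite (@Rintegral_split _ _ 0 (d / 2) L) //; last exact: integrable_bump.
  rewrite -[leLHS]addr0; apply: lerD; last by apply: Rintegral_ge0 => s _; exact: bump_ge0.
  rewrite -[d / 2 in leLHS]subr0 -Rintegral_cst_itv //.
  apply: le_Rintegral => //; [exact: integrable_cst_itv|exact: integrable_bump|].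
  move=> s /=; rewrite in_itv /= => /andP[s0 sd].
  apply: lerXn2r; rewrite ?nnegrE ?(ltW A0) ?bump_base_ge0 //.
  have : cos (omega * (d / 2)) <= cos (omega * s); last by rewrite /A; lra.
  apply: le_cos; [by rewrite mulr_ge0 // ltW|by rewrite ler_pM2l|].
  by apply: le_trans wd; rewrite ler_pM2l //; lra.
have I0 : 0 < \int[mu]_(s in `[0, L]) bump n s.
  by apply: lt_le_trans low; rewrite mulr_gt0 // divr_gt0.
exists n; split => // s /andP[ds sd].
have sB : bump n s <= B ^+ n.
  apply: lerXn2r; rewrite ?nnegrE ?bump_base_ge0 //.
  have : cos (omega * s) <= cos (omega * d); last by rewrite /B; lra.
  case: (lerP s (L / 2)) => sL.
    apply: le_cos; [by rewrite mulr_ge0 // ltW|by rewrite ler_pM2l //; lra|].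
    by rewrite -wpi ler_pM2l.
  (* The second half of the period is folded onto the first by [s] to [L - s]. *)
  have -> : cos (omega * s) = cos (omega * (L - s)).
    have -> : omega * s = - (omega * (L - s)) + pi *+ 2 by rewrite /omega; field.
    by rewrite cosD2pi cosN.
  apply: le_cos; [by rewrite mulr_ge0 // ltW|by rewrite ler_pM2l //; lra|].
  by rewrite -wpi ler_pM2l //; lra.
apply: (le_trans sB); apply: (@le_trans _ _ (eta * (A ^+ n * (d / 2)))); last first.
  by rewrite ler_pM2l.
have := ltW (le_lt_trans (ler_norm _) hn); rewrite expr_div_n => h.
have -> : B ^+ n = 2 / d * (B ^+ n / A ^+ n) * (A ^+ n * (d / 2)).
  by field; rewrite !gt_eqF.
by apply: ler_wpM2r => //; rewrite mulr_ge0 ?ltW // divr_gt0.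
Qed.

(** Convolving [f] with the normalised kernel [K] gives a trigonometric polynomial. As [K] has
    integral 1, the L1 error is at most the average, with weight [K], of the L1 distances between
    [f] and its translates: shifts near 0 modulo [L] cost at most [1 / 2] in all, the others at most
    [1 / 4], where [K] is below [eta]. *)
Lemma trig_approx f : bm f -> f L = f 0 -> exists n (p : nat -> C),
  \int[mu]_(r in `[0, L]) norm1 (f r - \sum_(j < (n + n).+1) p j * cexpi (freq n j * r)) < 1.
Proof.
move=> hf fL0; have [del d0 hd] := per_translation hf fL0.
have [M M0 HM] := bm_bound hf.
(* Chosen for [2 * M * L * eta * L <= 1 / 4]: a translate is at L1 distance at most [2 * M * L] from
   [f], and the shifts fill a length at most [L]. The added 1 guards against [M = 0]. *)
pose eta := (8 * M * L ^+ 2 + 1)^-1.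
have eta0 : 0 < eta.
  have h : 0 <= 8 * M * L ^+ 2 by apply: mulr_ge0; [lra|exact: exprn_ge0 (ltW L0)].
  by rewrite invr_gt0 ltr_wpDl.
have etaM : 2 * M * L * eta * L <= 1 / 4.
  have h : (8 * M * L ^+ 2 + 1) * eta = 1 by rewrite divff // gt_eqF // -invr_gt0.
  rewrite expr2 in h; nra.
have [n [I0 hn]] := bump_concentrates d0 eta0.
set I := \int[mu]_(s in `[0, L]) bump n s in I0 hn.
have [c hc] := bump_expand n.
pose K (s : R) : C := cmk (I^-1 * bump n s) 0.
have Iinv : 0 <= I^-1 by rewrite invr_ge0 ltW.
have nK s : norm1 (K s) = I^-1 * bump n s.
  by rewrite /norm1 !reimE normr0 addr0 ger0_norm // mulr_ge0 // bump_ge0.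
have hK : bm K.
  split.
    split; last exact: measurable_cst.
    by apply: measurable_funM => //; exact: measurable_bump.
  by exists (I^-1 * 1) => s; rewrite nK; apply: ler_wpM2l => //; exact: bump_le1.
have KE s : K s = cmk I^-1 0 * \sum_(j < (n + n).+1) c j * cexpi (freq n j * s).
  by rewrite -hc; apply: complex_ext; rewrite !reimE; ring.
have perK r : per L K r = K r by rewrite /per; case: ifP => // _; rewrite /K bump_period.
have he j : bm (fun s : R => cexpi (- (freq n j * s))).
  by apply: bm_cexpi; apply: measurableT_comp => //; exact: mulrl_measurable.
pose p j := cmk I^-1 0 * c j * cint `[0, L] (fun s => cexpi (- (freq n j * s)) * f s).
exists n, p.
have PE t : \sum_(j < (n + n).+1) p j * cexpi (freq n j * t) = circ L K f t.
  transitivity (cint `[0, L] (fun s => \sum_(j < (n + n).+1)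
      (cmk I^-1 0 * c j * cexpi (freq n j * t)) * (cexpi (- (freq n j * s)) * f s))).
    rewrite cint_sum //; last by move=> j; apply: cL1Z => //; exact: bm_cL1 (bmM (he j) hf).
    apply: eq_bigr => j _; rewrite cintZl //; last exact: bm_cL1 (bmM (he j) hf).
    by rewrite /p mulrAC.
  apply: eq_cint => s _; rewrite perK KE mulr_sumr mulr_suml; apply: eq_bigr => j _.
  have -> : freq n j * (t - s) = freq n j * t + - (freq n j * s) by ring.
  by rewrite cexpiD; ring.
have K1 : cint `[0, L] K = 1.
  apply: complex_ext; rewrite ?cre_cint ?cim_cint.
    transitivity (I^-1 * I); last by rewrite mulVf ?gt_eqF // cre1.
    by rewrite -RintegralZl //; exact: integrable_bump.
  by rewrite (_ : (fun x => _) = (fun _ => 0)) // Rintegral_cst // mul0r.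
have hdf t : bm (fun r : R => f t - per L f (t - r)).
  by apply: bmB; [exact: bm_cst|exact: bm_per_sub].
have diffE t : 0 <= t <= L ->
    f t - \sum_(j < (n + n).+1) p j * cexpi (freq n j * t) =
    cint `[0, L] (fun r => K r * (f t - per L f (t - r))).
  move=> tt; rewrite PE circ_swap // -[f t in LHS]mul1r -K1 -cintZr //; last exact: bm_cL1.
  rewrite -cintB //.
  - by apply: eq_cint => r _; rewrite mulrBr.
  - exact: bm_cL1 (bmM hK (bm_cst (f t))).
  - exact: bm_cL1 (bmM hK (bm_per_sub L t hf)).
(* The weighted modulus as a complex function with zero imaginary part, so that complex Fubini
   exchanges the average over shifts and the L1 norm. *)
pose G (t r : R) : C := cmk (I^-1 * bump n r * norm1 (f t - per L f (t - r))) 0.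
have df2 t r : norm1 (f t - per L f (t - r)) <= 2 * M.
  apply: (le_trans (norm1B _ _)); have h1 := HM t.
  have h2 : norm1 (per L f (t - r)) <= M by rewrite /per; case: ifP.
  lra.
have Gn t r : norm1 (G t r) = I^-1 * bump n r * norm1 (f t - per L f (t - r)).
  by rewrite {1}/norm1 !reimE normr0 addr0 ger0_norm // mulr_ge0 ?norm1_ge0 // mulr_ge0 // bump_ge0.
have GN t r : norm1 (G t r) <= I^-1 * (2 * M).
  rewrite Gn -mulrA; apply: ler_wpM2l => //; rewrite -[leRHS]mul1r.
  by apply: ler_pM; [exact: bump_ge0|exact: norm1_ge0|exact: bump_le1|].
have mG : cmeas (fun q : R * R => G q.1 q.2).
  split; last exact: measurable_cst.
  apply: measurable_funM.
    apply: measurable_funM => //.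
    exact: (measurableT_comp (measurable_bump n) measurable_snd).
  apply: (@measurable_norm1 _ _ _ (fun q : R * R => f q.1 - per L f (q.1 - q.2))).
  apply: cmeasB; first exact: (cmeas_comp (bm_cmeas hf)).
  by apply: (cmeas_comp (bm_cmeas (bm_per L hf))); exact: measurable_funB.
have hG1 t : bm (G t).
  split; last by exists (I^-1 * (2 * M)).
  exact: (cmeas_comp2 mG (a := fun _ : R => t) (b := id)).
have hG2 r : bm (fun t => G t r).
  split; last by exists (I^-1 * (2 * M)).
  exact: (cmeas_comp2 mG (a := id) (b := fun _ : R => r)).
have mP : bm (fun t => f t - \sum_(j < (n + n).+1) p j * cexpi (freq n j * t)).
  apply: bmB => //; apply: (@bm_sum _ _ _ (fun (j : 'I_(n + n).+1) t => p j * cexpi (freq n j * t))) => j.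
  by apply: bmM; [exact: bm_cst|apply: bm_cexpi; exact: mulrl_measurable].
pose GI t := cint `[0, L] (G t).
have GIb : norm1 (cint `[0, L] GI) < 1; last first.
  have bG : bm GI.
    split; first exact: (@cmeas_cint _ _ _ _ G).
    exists (I^-1 * (2 * M) * (L - 0)) => t; rewrite -(Rintegral_cst_itv _ (ltW L0)).
    apply: norm1_cint_le => //; [exact: bm_cmeas (hG1 t)|exact: integrable_cst_itv].
  apply: le_lt_trans GIb; apply: (@le_trans _ _ (cre (cint `[0, L] GI))); last first.
    exact: le_trans (ler_norm _) (cre_le_norm1 _).
  rewrite cre_cint; apply: le_Rintegral => //.
  - by have [] := bm_cL1 0 L mP.
  - exact: cL1_re (bm_cL1 0 L bG).
  - move=> t t0; have tt : 0 <= t <= L by move: t0; rewrite /= in_itv.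
    rewrite diffE // /GI cre_cint.
    apply: norm1_cint_le => //.
    + exact: bm_cmeas (bmM hK (hdf t)).
    + exact: cL1_re (bm_cL1 0 L (hG1 t)).
    + by move=> r _; apply: (le_trans (norm1M _ _)); rewrite nK; exact: lexx.
rewrite /GI (@cfubini_le _ _ _ _ (I^-1 * (2 * M) * (L - 0))) //; first last.
- move=> t _; exists (fun _ => I^-1 * (2 * M)); split => //.
  + exact: integrable_cst_itv.
  + by rewrite Rintegral_cst_itv // ltW.
- exact: itv_fin.
have ib := RintegrableZ (1 / 2 * I^-1) (measurable_itv `[0, L]%R) (integrable_bump n 0 L).
have ic := integrable_cst_itv (2 * M * L * eta) 0 L.
apply: (@le_lt_trans _ _ (\int[mu]_(r in `[0, L]) (1 / 2 * I^-1 * bump n r + 2 * M * L * eta))); last first.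
  have e : \int[mu]_(r in `[0, L]) (1 / 2 * I^-1 * bump n r) = 1 / 2 * I^-1 * I.
    by rewrite RintegralZl //; exact: integrable_bump.
  rewrite RintegralD // e Rintegral_cst_itv ?ltW // subr0.
  have -> : 1 / 2 * I^-1 * I = 1 / 2 by field; rewrite gt_eqF.
  lra.
apply: norm1_cint_le => //.
- apply: (@cmeas_cint _ _ _ _ (fun r t => G t r)) => //.
  apply: (cmeas_comp2 mG (a := fun q : R * R => q.2) (b := fun q => q.1)).
    exact: measurable_snd.
  exact: measurable_fst.
- exact: RintegrableD.
move=> r /=; rewrite in_itv /= => /andP[r0 rL].
have idf : mu.-integrable `[0, L] (EFin \o (fun t => norm1 (f t - per L f (t - r)))).
  have h : bm (fun t : R => f t - per L f (t - r)).
    by apply: bmB => //; apply: (bm_comp (bm_per L hf)); exact: measurable_funB.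
  by have [] := bm_cL1 0 L h.
apply: (@le_trans _ _ (\int[mu]_(t in `[0, L]) (I^-1 * bump n r * norm1 (f t - per L f (t - r))))).
  apply: norm1_cint_le => //; [exact: bm_cmeas (hG2 r)|exact: RintegrableZ|].
  by move=> t _; rewrite Gn.
rewrite RintegralZl //.
have Ib : 0 <= I^-1 * bump n r by rewrite mulr_ge0 // bump_ge0.
have E0 : 0 <= 2 * M * L * eta by rewrite !mulr_ge0 // ltW.
have rr : 0 <= r <= L by rewrite r0.
case: (ltrP r del) => rd.
  have h := ler_wpM2l Ib (hd r rr (or_introl rd)).
  by apply: (le_trans h); lra.
case: (ltrP (L - r) del) => rd'.
  have h := ler_wpM2l Ib (hd r rr (or_intror rd')).
  by apply: (le_trans h); lra.
have hb : bump n r <= eta * I by apply: hn; rewrite rd /=; lra.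
have wb : \int[mu]_(t in `[0, L]) norm1 (f t - per L f (t - r)) <= 2 * M * L.
  rewrite -[L in leRHS]subr0 -(Rintegral_cst_itv _ (ltW L0)).
  by apply: le_Rintegral => //; exact: integrable_cst_itv.
have Ib' : I^-1 * bump n r <= eta.
  by rewrite mulrC ler_pdivrMr.
apply: (@le_trans _ _ (eta * (2 * M * L))).
  by apply: ler_pM => //; apply: Rintegral_ge0 => t _; exact: norm1_ge0.
lra.
Qed.

End Trigonometric.

(** * Inverting 1 + F * modulo constants; Fourier coefficients of the kernel *)

Section Fredholm.
Context {R : realType}.
Local Notation C := (R[i]).
Local Notation mu := (@lebesgue_measure R).
Variables (L : R) (g : R -> C).
Hypotheses (L0 : 0 < L) (Hg : cL2 0 L g).

(** Left without the factor [1 / L], so that convolution by [f] multiplies a wave by exactly this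
    number. *)
Definition fourier (f : R -> C) (th : R) : C :=
  cint `[0, L] (fun s => f s * cexpi (- (th * s))).

Lemma bm_wave (th : R) : bm (fun s : R => cexpi (th * s)).
Proof. by apply: bm_cexpi; exact: mulrl_measurable. Qed.

Lemma bm_waveN (th : R) : bm (fun s : R => cexpi (- (th * s))).
Proof. by apply: bm_cexpi; apply: measurableT_comp => //; exact: mulrl_measurable. Qed.

Lemma bm_trig (m n : nat) (a : nat -> C) :
  bm (fun s : R => \sum_(j < m) a j * cexpi (freq L n j * s)).
Proof.
apply: (@bm_sum _ _ _ (fun (j : 'I_m) s => a j * cexpi (freq L n j * s))) => j.
by apply: bmM; [exact: bm_cst|exact: bm_wave].
Qed.

Lemma per_wave n j r : per L (fun s => cexpi (freq L n j * s)) r = cexpi (freq L n j * r).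
Proof. by rewrite /per; case: ifP => // _; rewrite cexpi_freq_period. Qed.

Lemma wave_sub (th t s : R) : cexpi (th * (t - s)) = cexpi (th * t) * cexpi (- (th * s)).
Proof. by rewrite -cexpiD; congr cexpi; ring. Qed.

Lemma circ_wave f n j t : bm f -> 0 <= t <= L ->
  circ L f (fun s => cexpi (freq L n j * s)) t = fourier f (freq L n j) * cexpi (freq L n j * t).
Proof.
move=> hf tt; rewrite circ_swap //; last exact: bm_wave.
rewrite /fourier -cintZr //; last exact: bm_cL1 (bmM hf (bm_waveN _)).
by apply: eq_cint => r _; rewrite per_wave wave_sub; ring.
Qed.

Lemma circ_trigl (m n : nat) (p : nat -> C) k t : bm k ->
  circ L (fun s => \sum_(j < m) p j * cexpi (freq L n j * s)) k t =
  \sum_(j < m) p j * fourier k (freq L n j) * cexpi (freq L n j * t).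
Proof.
move=> hk.
transitivity (cint `[0, L] (fun s => \sum_(j < m)
    (p j * cexpi (freq L n j * t)) * (k s * cexpi (- (freq L n j * s))))).
  apply: eq_cint => s _.
  have -> : per L (fun s0 => \sum_(j < m) p j * cexpi (freq L n j * s0)) (t - s) =
      \sum_(j < m) p j * cexpi (freq L n j * (t - s)).
    rewrite /per; case: ifP => // _; apply: eq_bigr => j _.
    by rewrite cexpi_freq_period.
  by rewrite mulr_suml; apply: eq_bigr => j _; rewrite wave_sub; ring.
have h j := bm_cL1 0 L (bmM hk (bm_waveN (freq L n j))).
rewrite cint_sum //; last by move=> j; exact: cL1Z.
by apply: eq_bigr => j _; rewrite cintZl // /fourier; ring.
Qed.

Lemma circ_trigr f (m n : nat) (a : nat -> C) t : bm f -> 0 <= t <= L ->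
  circ L f (fun s => \sum_(j < m) a j * cexpi (freq L n j * s)) t =
  \sum_(j < m) a j * fourier f (freq L n j) * cexpi (freq L n j * t).
Proof.
move=> hf tt.
transitivity (cint `[0, L] (fun s => \sum_(j < m) a j * (per L f (t - s) * cexpi (freq L n j * s)))).
  by apply: eq_cint => s _; rewrite mulr_sumr; apply: eq_bigr => j _; ring.
have h j := bm_cL1 0 L (circ_integrand_bm L t hf (bm_wave (freq L n j))).
rewrite cint_sum //; last by move=> j; exact: cL1Z.
by apply: eq_bigr => j _; rewrite cintZl // -mulrA -circ_wave.
Qed.

(* Writing [F = E + P] with [E] small and [P] a trigonometric polynomial, the Neumann series
   inverts [1 + E *], and the finitely many waves of [P] are corrected mode by mode, except
   the constant one. *)
Lemma fredholm_mod_constants F f : bm F -> F L = F 0 -> bm f ->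
  (forall n j, j != n -> 1 + fourier F (freq L n j) != 0) ->
  exists h d, bm h /\ forall t, 0 <= t <= L -> h t + circ L F h t = f t + d.
Proof.
move=> hF FL hf hne.
have [n [p hp]] := trig_approx L0 hF FL.
pose P s := \sum_(j < (n + n).+1) p j * cexpi (freq L n j * s).
have hP : bm P by exact: bm_trig.
have hE : bm (fun s => F s - P s) by exact: bmB.
have [S [hS SE]] := neumann L0 hE hf hp.
pose Sh j := fourier S (freq L n j); pose Fh j := fourier F (freq L n j).
(* [a j * (1 + Fh j)] cancels [p j * Sh j]. At the zero mode no correction is made and the leftover
   is the constant [d]. *)
pose a j := if j == n then 0 else - (p j * Sh j) / (1 + Fh j).
pose T s := \sum_(j < (n + n).+1) a j * cexpi (freq L n j * s).
have hT : bm T by exact: bm_trig.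
exists (fun s => S s + T s), (\sum_(j < (n + n).+1) if j == n :> nat then p j * Sh j else 0).
split => [|t tt]; first exact: bmD.
rewrite circD // circ_trigr //.
(* [F = E + P], and convolution of [S] by [E] equals [f - S] by the choice of [S]. *)
have -> : circ L F S t = f t - S t + circ L P S t.
  rewrite -(SE t tt) (addrC (S t)) addrK -circDl //.
  by congr circ; apply/funext => s; rewrite subrK.
rewrite circ_trigl // /T.
have -> : S t + \sum_(j < (n + n).+1) a j * cexpi (freq L n j * t) +
    (f t - S t + \sum_(j < (n + n).+1) p j * fourier S (freq L n j) * cexpi (freq L n j * t) +
     \sum_(j < (n + n).+1) a j * fourier F (freq L n j) * cexpi (freq L n j * t)) =
    f t + (\sum_(j < (n + n).+1) a j * cexpi (freq L n j * t) +
    \sum_(j < (n + n).+1) p j * fourier S (freq L n j) * cexpi (freq L n j * t) +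
     \sum_(j < (n + n).+1) a j * fourier F (freq L n j) * cexpi (freq L n j * t)) by ring.
congr (_ + _); rewrite -!big_split /=; apply: eq_bigr => j _.
rewrite /a; case: eqVneq => [->|jn].
  rewrite !mul0r add0r addr0 /Sh (_ : freq L n n = 0); last by rewrite /freq subrr mul0r.
  by rewrite mul0r cexpi0 mulr1.
by have := hne n j jn; rewrite -/(Sh j) -/(Fh j) => h; field.
Qed.

(** The primitive of [gt], with the bound moved into the integrand: it is defined for every real
    [t], 0 before 0 and constant from [L] on. *)
Definition Gam (t : R) : C := cint `[0, L] (fun y => if y <= t then gt L g y else 0).

Lemma gt_le_cmeas (t : R) : cmeas (fun y : R => if y <= t then gt L g y else 0).
Proof. by apply: cmeas_if; [exact: measurable_fun_ler|exact: gt_cmeas|exact: cmeas_cst]. Qed.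

Lemma bm_Gam : bm Gam.
Proof.
have [mg gi] := gt_cL1 Hg measurableT; split.
  apply: (@cmeas_cint _ _ _ _ (fun t y : R => if y <= t then gt L g y else 0)) => //.
  apply: cmeas_if; [exact: measurable_fun_ler|exact: (cmeas_comp mg)|exact: cmeas_cst].
exists (normg L g) => t.
apply: (@le_trans _ _ (\int[mu]_(y in `[0, L]) norm1 (gt L g y))).
  apply: norm1_cint_le => //; first exact: gt_le_cmeas.
    by have [] := gt_cL1 Hg (measurable_itv `[0, L]%R).
  by move=> y _; case: ifP => // _; rewrite norm1_0 norm1_ge0.
by apply: Rintegral_le_setT => //; exact: measurable_norm1.
Qed.

Lemma Gam_cint t : 0 <= t -> Gam t = cint `[0, t] (gt L g).
Proof.
move=> t0; pose M := Num.max t L.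
have tM : t <= M by rewrite le_max lexx.
have LM : L <= M by rewrite le_max lexx orbT.
rewrite /Gam (@cint_sub _ _ 0 L 0 M) // [RHS](@cint_sub _ _ 0 t 0 M) //.
apply: eq_cint => y _; case: (boolP (0 <= y < L)) => [/andP[y0 yL]|h].
  by rewrite y0 /= (ltW yL).
by rewrite gt_out // !if_same.
Qed.

Lemma Gam0 : Gam 0 = 0.
Proof. by rewrite Gam_cint // cint_point. Qed.

Lemma cint_gt_Gam a b : 0 <= a -> a <= b -> cint `[a, b] (gt L g) = Gam b - Gam a.
Proof.
move=> a0 ab; rewrite !Gam_cint ?(le_trans a0) // (@cint_split _ _ 0 a b) //; last exact: gt_cL1.
by rewrite (addrC (cint `[0, a] _)) addrK.
Qed.

Lemma Gam_ge t : L <= t -> Gam t = Gam L.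
Proof.
move=> Lt; apply: eq_cint => y /=; rewrite in_itv /= => /andP[_ yL].
by rewrite yL (le_trans yL Lt).
Qed.

(** One period of the kernel. Unwrapped, [Gam] does not return to 0 at [L]; the value there is reset
    so that the two ends agree, as the trigonometric approximation demands, and the jump is harmless
    in L1. *)
Definition Fam (r : R) : C := if r < L then Gam r else 0.

Lemma bm_Fam : bm Fam.
Proof. by apply: bm_if; [exact: measurable_fun_ltr|exact: bm_Gam|exact: bm_cst]. Qed.

Lemma Fam_ends : Fam L = Fam 0.
Proof. by rewrite /Fam ltxx L0 Gam0. Qed.

Lemma freq_neq0 n j : j != n -> freq L n j != 0.
Proof.
by move=> jn; rewrite /freq mulf_neq0 // ?subr_eq0 ?eqr_nat // gt_eqF // omega_gt0.
Qed.

(* [eigz th x] is the integral of [exp (i th y)] over [[0, x]]; if the mode [th] of [1 + Fam *]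
   vanishes, it is an eigenfunction of the adjoint with [eigz th L = 0]. *)
Definition eigz (th x : R) : C := cmk (sin (th * x) / th) ((1 - cos (th * x)) / th).

Lemma is_derive_sinM (th x : R) :
  is_derive x (1 : R) (fun y : R => sin (th * y)) (th * cos (th * x)).
Proof.
have d := is_derive_mull th x.
have d2 := @is_derive1_comp _ (@sin R) (fun y : R => th * y) x _ _ (is_derive_sin _) d.
by apply: is_derive_eq; rewrite [LHS]mulrC.
Qed.

Lemma is_derive_cosM (th x : R) :
  is_derive x (1 : R) (fun y : R => cos (th * y)) (- (th * sin (th * x))).
Proof.
have d := is_derive_mull th x.
have d2 := @is_derive1_comp _ (@cos R) (fun y : R => th * y) x _ _ (is_derive_cos _) d.
by apply: is_derive_eq; rewrite -mulrN [LHS]mulrC.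
Qed.

Lemma continuous_cosM (th : R) : continuous (fun y : R => cos (th * y)).
Proof. exact: is_derive_continuous (is_derive_cosM th). Qed.

Lemma continuous_sinM (th : R) : continuous (fun y : R => sin (th * y)).
Proof. exact: is_derive_continuous (is_derive_sinM th). Qed.

Lemma bm_eigz th : bm (eigz th).
Proof.
split.
  split; apply: measurable_funM => //.
    by apply: continuous_measurable_fun; exact: continuous_sinM.
  by apply: measurable_funB => //; apply: continuous_measurable_fun; exact: continuous_cosM.
exists (1 * `|th^-1| + (1 + 1) * `|th^-1|) => x; rewrite /norm1 !reimE !normrM.
apply: lerD; apply: ler_wpM2r => //; first exact: sin_max.
by apply: (le_trans (ler_normB _ _)); rewrite normr1 lerD2l; exact: cos_max.
Qed.

Lemma cint_wave (th x : R) : th != 0 -> 0 <= x -> cint `[0, x] (fun y => cexpi (th * y)) = eigz th x.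
Proof.
move=> th0 x0; transitivity (eigz th x - eigz th 0); last first.
  by apply: complex_ext; rewrite !reimE mulr0 ?sin0 ?cos0; field.
apply: cint_FTC2 => //.
- move=> y; have d := is_derive_sinM th y; apply: is_derive_eq.
  by rewrite /= !scaler0 ?addr0 ?add0r /GRing.scale /=; field.
- move=> y; have d := is_derive_cosM th y; apply: is_derive_eq.
  by rewrite /= !scaler0 ?addr0 ?add0r /GRing.scale /=; field.
- exact: continuous_cosM.
- exact: continuous_sinM.
Qed.

Lemma cexpi_freqL n j : cexpi (freq L n j * L) = 1.
Proof. by rewrite -[L in _ * L]add0r cexpi_freq_period // mulr0 cexpi0. Qed.

Lemma cexpiN (x : R) : cexpi (- x) = cconj (cexpi x).
Proof. by apply: complex_ext; rewrite !reimE ?cosN ?sinN. Qed.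

Lemma eigz_L n j : eigz (freq L n j) L = 0.
Proof.
have := cexpi_freqL n j => h; have h1 := congr1 cre h; have h2 := congr1 cim h.
move: h1 h2; rewrite !reimE => h1 h2.
by apply: complex_ext; rewrite !reimE ?h1 ?h2 ?subrr mul0r.
Qed.

(** An integration by parts made by Fubini: the wave is integrated from [y] to [L]. At a nonzero
    frequency its integral over the full period is 0, so this is minus the integral over [[0, y]],
    the conjugate of [eigz]. *)
Lemma fourier_Fam n j : j != n ->
  fourier Fam (freq L n j) = - cint `[0, L] (fun y => gt L g y * cconj (eigz (freq L n j) y)).
Proof.
move=> /freq_neq0; set th := freq L n j => th0.
have hw := bm_waveN th; have hz := bm_eigz th.
transitivity (cint `[0, L] (fun s => Gam s * cexpi (- (th * s)))).
  apply: cint_eq_co.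
  - exact: bm_cmeas (bmM bm_Fam hw).
  - exact: bm_cmeas (bmM bm_Gam hw).
  - by move=> s /andP[_ sL]; rewrite /Fam sL.
have gL1 t : cL1 `[0, L] (fun y => if y <= t then gt L g y else 0).
  have [mg gi] := gt_cL1 Hg (measurable_itv `[0, L]%R).
  apply: (cL1_le _ (gt_le_cmeas t) gi) => // y _.
  by case: ifP => // _; rewrite norm1_0 norm1_ge0.
have [N N0 HN] := bm_bound hw.
have gN : \int[mu]_(y in `[0, L]) norm1 (gt L g y) <= normg L g.
  have [mg gi] := gt_cL1 Hg measurableT.
  by apply: Rintegral_le_setT => //; exact: measurable_norm1.
transitivity (cint `[0, L] (fun s => cint `[0, L] (fun y =>
    (if y <= s then gt L g y else 0) * cexpi (- (th * s))))).
  by apply: eq_cint => s _; rewrite -cintZr.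
rewrite (@cfubini_le _ _ _ _ (N * normg L g)) //; first last.
- move=> s _; have [mg gi] := gt_cL1 Hg (measurable_itv `[0, L]%R).
  exists (fun y => N * norm1 (gt L g y)); split.
  + exact: RintegrableZ.
  + move=> y _; apply: (le_trans (norm1M _ _)); rewrite mulrC.
    apply: ler_pM => //; [exact: norm1_ge0|exact: norm1_ge0|].
    by case: ifP => // _; rewrite norm1_0 norm1_ge0.
  + by rewrite RintegralZl //; exact: ler_wpM2l.
- apply: cmeasM; last exact: (cmeas_comp (bm_cmeas hw)).
  apply: cmeas_if; [exact: measurable_fun_ler|exact: (cmeas_comp (gt_cmeas Hg))|exact: cmeas_cst].
- exact: itv_fin.
have hgz : cL1 `[0, L] (fun y => gt L g y * cconj (eigz th y)).
  have [Z Z0 HZ] := bm_bound hz.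
  apply: (@cL1Mb _ _ _ _ Z) => //; [exact: gt_cL1|exact: cmeas_conj (bm_cmeas hz)|].
  by move=> y _; rewrite norm1_conj.
rewrite -cintN //; apply: eq_cint => y yin.
have /andP[y0 yL] : 0 <= y <= L by move: yin; rewrite /= in_itv.
transitivity (gt L g y * cint `[y, L] (fun s => cexpi (- (th * s)))).
  rewrite (@cint_sub _ _ y L 0 L) // -cintZl //.
    apply: eq_cint => s /=; rewrite in_itv /= => /andP[_ sL]; rewrite sL andbT.
    by case: ifP => _; rewrite ?mul0r ?mulr0.
  apply: bm_cL1; apply: bm_if => //; last exact: bm_cst.
  by apply: measurable_and; exact: measurable_fun_ler.
have E x : 0 <= x -> cint `[0, x] (fun s => cexpi (- (th * s))) = cconj (eigz th x).
  move=> x0; rewrite -cint_wave // -cint_conj //; last exact: bm_cL1 (bm_wave th).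
  by apply: eq_cint => s _; rewrite cexpiN.
have := @cint_split _ _ 0 y L y0 yL (bm_cL1 0 L hw).
rewrite !E ?(ltW L0) // (eigz_L n j : eigz th L = 0) => /esym h.
have c0 : cconj (0 : C) = 0 by apply: complex_ext; rewrite !reimE ?oppr0.
rewrite c0 in h; rewrite -mulrN; congr (_ * _).
by apply/eqP; rewrite -addr_eq0 addrC h.
Qed.

(** If the mode vanished, the nonlocal term of the adjoint at [eigz th] would be 1. Then
    [- z' + 1 = 1 - exp (i th x) = - i th z], an eigenfunction with [z L = 0]; unique continuation
    makes it 0 almost everywhere, and the nonlocal term would be 0 as well. *)
Lemma fourier_Fam_neq (n j : nat) : (forall lam, unique_continuation L g lam) -> j != n ->
  1 + fourier Fam (freq L n j) != 0.
Proof.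
move=> UC jn; apply/eqP; rewrite fourier_Fam // => /eqP; rewrite subr_eq0 => /eqP E.
have th0 := freq_neq0 jn; set th := freq L n j in th0 E.
have hz := bm_eigz th; have [Z Z0 HZ] := bm_bound hz.
have adj := adjoint_integral Hg (bm_cmeas hz) (fun x _ => HZ x).
have c1 : cconj (1 : C) = 1 by apply: complex_ext; rewrite !reimE ?oppr0.
have E1 : cint `[0, L] (fun y => cconj (g y) * eigz th y) = 1.
  by rewrite -[LHS]cconjK adj -E c1.
have z0 : eigz th 0 = 0.
  by apply: complex_ext; rewrite !reimE mulr0 ?sin0 ?cos0 ?subrr mul0r.
have A : Astar_graph L g (eigz th) (fun x => cmk 0 (- th) * eigz th x).
  exists (fun x => cexpi (th * x)); split; [|split; [|split]] => //.
  - have [[m1 m2] [N HN]] := bm_wave th; split; first exact: measurable_funTS.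
    split; first exact: measurable_funTS.
    apply: (Rintegrable_le _ _ (integrable_cst_itv (N ^+ 2) 0 L)) => //.
      exact: measurable_cabs2.
    move=> x _; rewrite ger0_norm ?cabs2_ge0 //; apply: (le_trans (cabs2_le_norm1 _)).
    by apply: lerXn2r; rewrite ?nnegrE ?norm1_ge0 //; exact: le_trans (norm1_ge0 _) (HN x).
  - by move=> x /andP[x0 _]; rewrite z0 add0r cint_wave.
  - apply: aeW => x _; rewrite E1.
    by apply: complex_ext; rewrite !reimE; field.
have /(_ _ A (eigz_L n j)) ae := UC (cmk 0 (- th)).
have : cint `[0, L] (fun y => gt L g y * cconj (eigz th y)) = cint `[0, L] (fun _ => 0).
  apply: ae_eq_cint => //.
  - apply: (@cL1Mb _ _ _ _ Z) => //; [exact: gt_cL1|exact: cmeas_conj (bm_cmeas hz)|].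
    by move=> y _; rewrite norm1_conj.
  - exact: bm_cL1 (bm_cst 0).
  - apply: (ae_imp ae) => x h xL; rewrite h //.
    by apply: complex_ext; rewrite !reimE; ring.
by rewrite -E cint0 => /eqP; rewrite oner_eq0.
Qed.

End Fredholm.

(** * From unique continuation to a control *)

Section Sufficiency.
Context {R : realType}.
Local Notation C := (R[i]).
Local Notation mu := (@lebesgue_measure R).
Variables (L : R) (g : R -> C).
Hypotheses (L0 : 0 < L) (Hg : cL2 0 L g).

(** The equation is solved by [k] up to a constant [d]. Adding a constant [gam] to [k] adds
    [gam * Phi] both to the integral against [Gam (L - s)] and to the convolution, because both
    kernels have the integral [Phi]. These cancel whatever [Phi] is, so [gam = c0 - d] repairs the
    constant even when the zero mode of [1 + F *] vanishes. *)
Lemma volterra_fredholm f : (forall lam, unique_continuation L g lam) -> bm f ->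
  exists2 h, bm h & forall t, 0 <= t <= L ->
    h t = f t + cint `[0, L] (fun s => h s * Gam L g (L - s)) - circ L (Fam L g) h t.
Proof.
move=> UC hf.
have hF := bm_Fam Hg; have hG := bm_Gam Hg.
have [k [d [hk kE]]] := fredholm_mod_constants L0 hF (Fam_ends g L0) hf
  (fun n j => @fourier_Fam_neq R L g L0 Hg n j UC).
have hGL : bm (fun s : R => Gam L g (L - s)) by apply: (bm_comp hG); exact: measurable_funB.
pose c0 := cint `[0, L] (fun s => k s * Gam L g (L - s)).
pose gam := c0 - d; pose Phi := cint `[0, L] (Fam L g).
exists (fun s => k s + gam); first by apply: bmD => //; exact: bm_cst.
move=> t tt; rewrite circD //; last exact: bm_cst.
have -> : cint `[0, L] (fun s => (k s + gam) * Gam L g (L - s)) = c0 + gam * Phi.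
  transitivity (cint `[0, L] (fun s => k s * Gam L g (L - s) + gam * Gam L g (L - s))).
    by apply: eq_cint => s _; rewrite mulrDl.
  rewrite cintD //; [|exact: bm_cL1 (bmM hk hGL)|exact: bm_cL1 (bmM (bm_cst gam) hGL)].
  rewrite cintZl //; last exact: bm_cL1.
  congr (_ + _ * _); rewrite cint_reflect ?subrr ?subr0; last exact: bm_cmeas.
  apply: cint_eq_co; [exact: bm_cmeas|exact: bm_cmeas|].
  by move=> s /andP[_ sL]; rewrite /Fam sL.
have -> : circ L (Fam L g) (fun _ => gam) t = gam * Phi.
  rewrite circ_swap //; last exact: bm_cst.
  rewrite mulrC -cintZr //; last exact: bm_cL1.
  by apply: eq_cint => s _; rewrite /per; case: ifP.
have := kE t tt => e.
have -> : circ L (Fam L g) k t = f t + d - k t by rewrite -e; ring.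
by rewrite /gam; ring.
Qed.

Lemma ae_neq (a : R) : {ae mu, forall x, x != a}.
Proof.
exists [set a]; split => //; first exact: lebesgue_measure_set1.
by move=> x /= /negP; rewrite negbK => /eqP.
Qed.

Section Control.
Variables (u0 u1 : R -> C).
Hypotheses (Hu0 : cL2 0 L u0) (Hu1 : cL2 0 L u1).
Let v0 := cut 0 L u0.
Let v1 := cut 0 L u1.

Lemma bm_left (v : R -> C) : cL1 `[0, L] v -> bm (fun t => cint `[0, L] (fun x => if x <= t then v x else 0)).
Proof.
move=> [mv vi]; split.
  apply: (@cmeas_cint _ _ _ _ (fun t x : R => if x <= t then v x else 0)) => //.
  by apply: cmeas_if; [exact: measurable_fun_ler|exact: (cmeas_comp mv)|exact: cmeas_cst].
exists (\int[mu]_(x in `[0, L]) norm1 (v x)) => t; apply: norm1_cint_le => //.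
  by apply: cmeas_if; [exact: measurable_fun_ler| |exact: cmeas_cst].
by move=> x _; case: ifP => // _; rewrite norm1_0 norm1_ge0.
Qed.

Lemma bm_right (v : R -> C) : cL1 `[0, L] v -> bm (fun t => cint `[0, L] (fun x => if t <= x then v x else 0)).
Proof.
move=> [mv vi]; split.
  apply: (@cmeas_cint _ _ _ _ (fun t x : R => if t <= x then v x else 0)) => //.
  by apply: cmeas_if; [exact: measurable_fun_ler|exact: (cmeas_comp mv)|exact: cmeas_cst].
exists (\int[mu]_(x in `[0, L]) norm1 (v x)) => t; apply: norm1_cint_le => //.
  by apply: cmeas_if; [exact: measurable_fun_ler| |exact: cmeas_cst].
by move=> x _; case: ifP => // _; rewrite norm1_0 norm1_ge0.
Qed.

Variables (h : R -> C) (H : R).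
Hypotheses (mh : cmeas h) (hH : forall s, norm1 (h s) <= H).
Hypothesis hE : forall t, 0 <= t <= L ->
  h t = cint `[0, L] (fun x => if t <= x then v0 x else 0)
      + cint `[0, L] (fun x => if x <= t then v1 x else 0)
      + cint `[0, L] (fun s => h s * Gam L g (L - s)) - circ L (Fam L g) h t.

(** At time [L] the state is [W (L + x) + duh L x] and [W (L + x)] is the control at time [x]; the
    formula solves [u L = u1] for it. *)
Let U x := v1 x - duh L g h L x.
Let W xi := if xi < L then v0 xi else U (xi - L).

Let mv0 : cmeas v0. Proof. exact: cL2_cut_cmeas. Qed.
Let mv1 : cmeas v1. Proof. exact: cL2_cut_cmeas. Qed.
Let mU : cmeas U. Proof. by apply: cmeasB => //; exact: duh_cmeas. Qed.
Let mUL : cmeas (fun xi : R => U (xi - L)).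
Proof. by apply: (cmeas_comp mU); exact: measurable_funB. Qed.
Let mW : cmeas W.
Proof. by apply: cmeas_if => //; exact: measurable_fun_ltr. Qed.
Let v0L1 a b : cL1 `[a, b] v0.
Proof. by apply: (cL1S measurableT) => //; exact: cL2_cut_cL1. Qed.
Let v1L1 a b : cL1 `[a, b] v1.
Proof. by apply: (cL1S measurableT) => //; exact: cL2_cut_cL1. Qed.
Let hb : bm h. Proof. by split => //; exists H. Qed.

Let U_cabs2 x : cabs2 (U x) <= 2 * cabs2 (v1 x) + 2 * (H * normg L g) ^+ 2.
Proof.
apply: (le_trans (cabs2B_le _ _)); rewrite lerD2l ler_pM2l //.
apply: (le_trans (cabs2_le_norm1 _)); have hd := duh_le Hg mh hH L x.
by apply: lerXn2r; rewrite ?nnegrE ?norm1_ge0 //; exact: le_trans (norm1_ge0 _) hd.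
Qed.

Let v1_cabs2 a b : mu.-integrable `[a, b] (EFin \o (fun x => cabs2 (v1 x))).
Proof. by apply: (integrableS measurableT) => //; exact: cL2_cut_cabs2. Qed.

Let v0_cabs2 a b : mu.-integrable `[a, b] (EFin \o (fun x => cabs2 (v0 x))).
Proof. by apply: (integrableS measurableT) => //; exact: cL2_cut_cabs2. Qed.

Let U_L2 : cL2 0 L U.
Proof.
have [m1 m2] := mU; split; first exact: measurable_funTS.
split; first exact: measurable_funTS.
have i1 := RintegrableZ 2 (measurable_itv `[0, L]%R) (v1_cabs2 0 L).
have i2 := RintegrableD (measurable_itv `[0, L]%R) i1 (integrable_cst_itv (2 * (H * normg L g) ^+ 2) 0 L).
apply: (Rintegrable_le _ _ i2) => //; first exact: measurable_cabs2.
by move=> x _; rewrite ger0_norm ?cabs2_ge0.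
Qed.

Let W_L2 a b : mu.-integrable `[a, b] (EFin \o (fun x => cabs2 (W x))).
Proof.
have i0 : mu.-integrable `[a, b] (EFin \o (fun x : R => cabs2 (v1 (x + - L)))).
  by apply: (@Rintegrable_shift _ (fun x => cabs2 (v1 x))) => //; exact: measurable_cabs2.
have i1 := RintegrableZ 2 (measurable_itv `[a, b]%R) i0.
have i2 := RintegrableD (measurable_itv `[a, b]%R) i1 (integrable_cst_itv (2 * (H * normg L g) ^+ 2) a b).
have i3 := RintegrableD (measurable_itv `[a, b]%R) (v0_cabs2 a b) i2.
apply: (Rintegrable_le _ _ i3) => //; first exact: measurable_cabs2.
move=> x _; rewrite ger0_norm ?cabs2_ge0 // /W; case: ifP => _.
  by rewrite lerDl addr_ge0 // mulr_ge0 // ?cabs2_ge0 // sqr_ge0.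
by apply: (le_trans (U_cabs2 _)); rewrite lerDr cabs2_ge0.
Qed.

Let cint_duh (k : R -> C) (b c : R) : cmeas k -> (forall s, norm1 (k s) <= H) ->
  cint `[0, b] (fun x => cint `[0, L] (fun s => k s * gt L g (x + c - s))) =
  cint `[0, L] (fun s => k s * cint `[c - s, b + c - s] (gt L g)).
Proof.
move=> mk kH.
have := @convolution_swap _ L g L0 Hg k (fun _ => 1) 0 b c H (norm1 1) mk (fun s _ => kH s)
  (cmeas_cst _) (fun _ _ => lexx _).
rewrite (_ : (fun x : R => _ * 1) = (fun x => cint `[0, L] (fun s => k s * gt L g (x + c - s)))); last first.
  by apply/funext => x; rewrite mulr1.
move=> ->; apply: eq_cint => s _; congr (_ * _).
transitivity (cint `[0, b] (fun x => gt L g (x + (c - s)))).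
  by apply: eq_cint => x _; rewrite mulr1 addrA.
rewrite cint_shift; last exact: gt_cmeas.
by rewrite add0r addrA.
Qed.

(** The mean of [W (t + x)] is an integral of [W] over [[t, L + t]], cut at [L] into data and
    control. The means of the Duhamel terms, in the control and in the state, become integrals of
    [h] against increments of [Gam], and these assemble into the equation [hE]. *)
Let h_mean t : 0 <= t <= L -> h t = cint `[0, L] (sol L g h W t).
Proof.
move=> tt; have /andP[t0 tL] := tt.
have WL1 a b : cL1 `[a, b] W.
  split => //; apply: (Rintegrable_le _ _ (RintegrableD _ (integrable_cst_itv 1 a b) (W_L2 a b))) => //.
    exact: measurable_norm1.
  move=> x _; rewrite ger0_norm ?norm1_ge0 //.
  by have := norm1_le_young (W x) ltr01; rewrite invr1 mul1r.
have UL1 a b : cL1 `[a, b] U by apply: cL1B => //; exact: duh_cL1.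
have hG := bm_Gam Hg.
have hcm s := hcut_cmeas mh s; have hcH := hcut_le hH.
have EW : cint `[0, L] (fun x => W (t + x)) =
    cint `[0, L] (fun x => if t <= x then v0 x else 0)
    + (cint `[0, L] (fun x => if x <= t then v1 x else 0) - cint `[0, t] (duh L g h L)).
  transitivity (cint `[0, L] (fun x => W (x + t))).
    by apply: eq_cint => x _; rewrite addrC.
  rewrite cint_shift // add0r (@cint_split _ _ t L (L + t)) //; last by rewrite lerDl.
  congr (_ + _).
    rewrite (@cint_eq_co _ t L W v0) //; last by move=> x /andP[_ xL]; rewrite /W xL.
    rewrite (@cint_sub _ _ t L 0 L) //; apply: eq_cint => x /=; rewrite in_itv /= => /andP[_ xL].
    by rewrite xL andbT.
  transitivity (cint `[L, L + t] (fun xi => U (xi + - L))).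
    apply: eq_cint => x /=; rewrite in_itv /= => /andP[Lx _].
    by rewrite /W ltNge Lx.
  rewrite cint_shift // subrr (_ : L + t - L = t); last by ring.
  rewrite /U cintB //; last exact: duh_cL1.
  congr (_ - _); rewrite (@cint_sub _ _ 0 t 0 L) //; apply: eq_cint => x /=.
  by rewrite in_itv /= => /andP[x0 _]; rewrite x0.
have hGs (c : R) : bm (fun s : R => Gam L g (c - s)) by apply: (bm_comp hG); exact: measurable_funB.
have ED : cint `[0, t] (duh L g h L) =
    cint `[0, L] (fun s => h s * Gam L g (t + L - s)) - cint `[0, L] (fun s => h s * Gam L g (L - s)).
  rewrite [LHS]cint_duh //.
  rewrite -cintB //; [|exact: bm_cL1 (bmM hb (hGs _))|exact: bm_cL1 (bmM hb (hGs _))].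
  apply: eq_cint => s /=; rewrite in_itv /= => /andP[s0 sL].
  rewrite /hcut sL cint_gt_Gam //; [by rewrite mulrBr|by rewrite subr_ge0|].
  by rewrite -addrA lerDr.
have ET : cint `[0, L] (duh L g h t) =
    cint `[0, L] (fun s => if s <= t then h s * (Gam L g L - Gam L g (t - s)) else 0).
  rewrite [LHS]cint_duh //; apply: eq_cint => s /=; rewrite in_itv /= => /andP[s0 sL].
  rewrite /hcut; case: ifP => st; last by rewrite mul0r.
  rewrite cint_gt_Gam ?subr_ge0 //; last by rewrite -addrA lerDr ltW.
  by rewrite (@Gam_ge _ L g (L + t - s)) // -addrA lerDl subr_ge0.
(* For [s <= t] one has [Gam (t + L - s) = Gam L], so the difference leaves [Gam (t - s)]; for
   [s > t] only [Gam (t + L - s)] remains. This is the periodised kernel on both sides of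
   [s = t]. *)
have hcirc : circ L (Fam L g) h t = cint `[0, L] (fun s => h s * Gam L g (t + L - s))
    - cint `[0, L] (fun s => if s <= t then h s * (Gam L g L - Gam L g (t - s)) else 0).
  have hif : bm (fun s => if s <= t then h s * (Gam L g L - Gam L g (t - s)) else 0).
    apply: bm_if; [exact: measurable_fun_ler| |exact: bm_cst].
    by apply: bmM => //; apply: bmB => //; exact: bm_cst.
  rewrite -cintB //; [|exact: bm_cL1 (bmM hb (hGs _))|exact: bm_cL1].
  apply: cint_eq_oc.
  - exact: bm_cmeas (circ_integrand_bm L t (bm_Fam Hg) hb).
  - exact: bm_cmeas (bmB (bmM hb (hGs _)) hif).
  move=> s /andP[s0 sL]; rewrite /per subr_ge0; case: ifP => st.
    rewrite /Fam (_ : t - s < L); last by lra.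
    by rewrite (@Gam_ge _ L g (t + L - s)); [ring|lra].
  have ts : t < s by rewrite ltNge st.
  rewrite /Fam (_ : t - s + L < L); last by lra.
  by rewrite subr0 mulrC (_ : t - s + L = t + L - s) //; ring.
rewrite hE // hcirc.
transitivity (cint `[0, L] (fun x => W (t + x)) + cint `[0, L] (duh L g h t)).
  have alg (a b c d e : C) : a + b + c - (d - e) = a + (b - (d - c)) + e by ring.
  by rewrite EW ED ET alg.
rewrite -cintD //; last exact: duh_cL1.
rewrite (_ : (fun x : R => W (t + x)) = (fun x : R => W (x + t))); last first.
  by apply/funext => x; rewrite addrC.
exact: cL1_shift.
Qed.

Lemma control_exists : exists U, cL2 0 L U /\
  (exists u, weak_solution L L g u0 U u) /\
  (forall u, weak_solution L L g u0 U u -> {ae mu, forall x, `[0, L] x -> u L x = u1 x}).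
Proof.
have ws : weak_solution L L g u0 U (sol L g h W).
  apply: (sol_weak_solution L0 Hg mh hH mW W_L2 h_mean Hu0).
  - by move=> x /andP[x0 xL]; rewrite /W xL /v0 /cut x0 xL.
  - move=> t /andP[t0 tL]; rewrite /W ltNge lerDr t0 /=; congr U; ring.
exists U; split => //; split; first by exists (sol L g h W).
move=> u wu; have uq := weak_solution_final_unique L0 Hg wu ws.
(* The point [L] is discarded because [v1] is cut to [[0, L)] and need not equal [u1] there. *)
move: (ae_neq L); apply: filterS2 uq; first exact: (ae_filter_ringOfSetsType mu).
move=> x ux xL xin; rewrite ux //; have x0L : 0 <= x <= L by move: xin; rewrite /= in_itv.
have /andP[x0 xL'] := x0L; have xlt : x < L by rewrite lt_neqAle xL.
rewrite /sol /W ltNge lerDl x0 /= (_ : L + x - L = x); last by ring.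
by rewrite /U subrK /v1 /cut x0 xlt.
Qed.

End Control.

Lemma unique_continuation_controllable :
  (forall lam, unique_continuation L g lam) -> exactly_controllable L L g.
Proof.
move=> UC u0 u1 Hu0 Hu1.
have i0 : cL1 `[0, L] (cut 0 L u0) by apply: (cL1S measurableT) => //; exact: cL2_cut_cL1.
have i1 : cL1 `[0, L] (cut 0 L u1) by apply: (cL1S measurableT) => //; exact: cL2_cut_cL1.
have [h hb hE] := volterra_fredholm UC (bmD (bm_right i0) (bm_left i1)).
have [H _ hH] := bm_bound hb.
exact: (control_exists Hu0 Hu1 (bm_cmeas hb) hH hE).
Qed.

End Sufficiency.

(** * From exact controllability to unique continuation *)

Section Necessity.
Context {R : realType}.
Local Notation C := (R[i]).
Local Notation mu := (@lebesgue_measure R).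

Definition cderiv (F f : R -> C) := forall x : R,
  is_derive x (1 : R) (fun y : R => cre (F y)) (cre (f x)) /\
  is_derive x (1 : R) (fun y : R => cim (F y)) (cim (f x)).

Definition ccontinuous (F : R -> C) :=
  continuous (fun x : R => cre (F x)) /\ continuous (fun x : R => cim (F x)).

Lemma cderiv_continuous F f : cderiv F f -> ccontinuous F.
Proof.
move=> d; split.
  exact: (is_derive_continuous (fun x => (d x).1)).
exact: (is_derive_continuous (fun x => (d x).2)).
Qed.

Lemma is_derive_lin (F G : R -> R) (a b x f g' : R) :
  is_derive x (1 : R) F f -> is_derive x (1 : R) G g' ->
  is_derive x (1 : R) (fun y => a * F y + b * G y) (a * f + b * g').
Proof.
by move=> dF dG; have := is_deriveD (is_deriveZ a dF) (is_deriveZ b dG).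
Qed.

Lemma cderivZ (c : C) F f : cderiv F f -> cderiv (fun y => c * F y) (fun y => c * f y).
Proof.
move=> d x; have [d1 d2] := d x; split.
  have h := is_derive_lin (cre c) (- cim c) d1 d2.
  rewrite reimE (_ : (fun y => _) = (fun y => cre c * cre (F y) + - cim c * cim (F y))).
    by rewrite -mulNr.
  by apply/funext => y; rewrite !reimE mulNr.
have h := is_derive_lin (cim c) (cre c) d1 d2.
rewrite reimE (_ : (fun y => _) = (fun y => cim c * cre (F y) + cre c * cim (F y))).
  by rewrite addrC.
by apply/funext => y; rewrite !reimE addrC.
Qed.

Lemma ccontinuousZ (c : C) F : ccontinuous F -> ccontinuous (fun y => c * F y).
Proof.
move=> [c1 c2]; split => x.
  rewrite (_ : (fun y => _) = (fun y => cre c * cre (F y) - cim c * cim (F y))).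
    by apply: cvgB; apply: cvgM; [exact: cvg_cst|exact: c1|exact: cvg_cst|exact: c2].
  by apply/funext => y; rewrite !reimE.
rewrite (_ : (fun y => _) = (fun y => cre c * cim (F y) + cim c * cre (F y))).
  by apply: cvgD; apply: cvgM; [exact: cvg_cst|exact: c2|exact: cvg_cst|exact: c1].
by apply/funext => y; rewrite !reimE.
Qed.

Lemma ccontinuous_cmeas F : ccontinuous F -> cmeas F.
Proof. by move=> [c1 c2]; split; exact: continuous_measurable_fun. Qed.

Lemma ccontinuous_bounded F a b : ccontinuous F -> exists M : R, forall x, a <= x <= b -> norm1 (F x) <= M.
Proof.
move=> [c1 c2]; have [M1 h1] := continuous1_bounded a b c1; have [M2 h2] := continuous1_bounded a b c2.
by exists (M1 + M2) => x xab; apply: lerD; [exact: h1|exact: h2].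
Qed.

Lemma continuous_fst_comp (f : R -> R) : continuous f -> continuous (fun p : R * R => f p.1).
Proof. by move=> cf p; apply: (continuous_comp (f := fst)); [exact: cvg_fst|exact: cf]. Qed.

Lemma continuous_snd_comp (f : R -> R) : continuous f -> continuous (fun p : R * R => f p.2).
Proof. by move=> cf p; apply: (continuous_comp (f := snd)); [exact: cvg_snd|exact: cf]. Qed.

Lemma product_re_continuous (A B : R -> C) : ccontinuous A -> ccontinuous B ->
  continuous (fun p : R * R => cre (A p.1 * B p.2)).
Proof.
move=> [a1 a2] [b1 b2].
rewrite (_ : (fun p : R * R => _) = (fun p : R * R => cre (A p.1) * cre (B p.2) - cim (A p.1) * cim (B p.2))).
  move=> p.
  have h1 : cre (A q.1) @[q --> p] --> cre (A p.1) := @continuous_fst_comp _ a1 p.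
  have h2 : cre (B q.2) @[q --> p] --> cre (B p.2) := @continuous_snd_comp _ b1 p.
  have h3 : cim (A q.1) @[q --> p] --> cim (A p.1) := @continuous_fst_comp _ a2 p.
  have h4 : cim (B q.2) @[q --> p] --> cim (B p.2) := @continuous_snd_comp _ b2 p.
  exact: (cvgB (cvgM h1 h2) (cvgM h3 h4)).
by apply/funext => p; rewrite reimE.
Qed.

Lemma product_im_continuous (A B : R -> C) : ccontinuous A -> ccontinuous B ->
  continuous (fun p : R * R => cim (A p.1 * B p.2)).
Proof.
move=> [a1 a2] [b1 b2].
rewrite (_ : (fun p : R * R => _) = (fun p : R * R => cre (A p.1) * cim (B p.2) + cim (A p.1) * cre (B p.2))).
  move=> p.
  have h1 : cre (A q.1) @[q --> p] --> cre (A p.1) := @continuous_fst_comp _ a1 p.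
  have h2 : cim (B q.2) @[q --> p] --> cim (B p.2) := @continuous_snd_comp _ b2 p.
  have h3 : cim (A q.1) @[q --> p] --> cim (A p.1) := @continuous_fst_comp _ a2 p.
  have h4 : cre (B q.2) @[q --> p] --> cre (B p.2) := @continuous_snd_comp _ b1 p.
  exact: (cvgD (cvgM h1 h2) (cvgM h3 h4)).
by apply/funext => p; rewrite reimE.
Qed.

Lemma product_C1 (A dA B dB : R -> C) : cderiv A dA -> cderiv B dB ->
  ccontinuous dA -> ccontinuous dB ->
  [/\ C1fun (fun t x : R => A t * B x),
      forall t x, pt (fun t x : R => A t * B x) t x = dA t * B x &
      forall t x, px (fun t x : R => A t * B x) t x = A t * dB x].
Proof.
move=> hA hB cdA cdB; have cA := cderiv_continuous hA; have cB := cderiv_continuous hB.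
have dt t x : is_derive t (1 : R) (fun s => cre (A s * B x)) (cre (dA t * B x)) /\
    is_derive t (1 : R) (fun s => cim (A s * B x)) (cim (dA t * B x)).
  have [h1 h2] := cderivZ (B x) hA t; split.
    by rewrite mulrC (_ : (fun s => _) = (fun s => cre (B x * A s))) //; apply/funext => s; rewrite mulrC.
  by rewrite mulrC (_ : (fun s => _) = (fun s => cim (B x * A s))) //; apply/funext => s; rewrite mulrC.
have dx t x := cderivZ (A t) hB x.
have e1 t x : pt (fun t x : R => A t * B x) t x = dA t * B x.
  have [d1 d2] := dt t x.
  by apply: complex_ext; rewrite /pt ?cre_mk ?cim_mk derive1E;
    [have [_ ->] := d1|have [_ ->] := d2].
have e2 t x : px (fun t x : R => A t * B x) t x = A t * dB x.
  have [d1 d2] := dx t x.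
  by apply: complex_ext; rewrite /px ?cre_mk ?cim_mk derive1E;
    [have [_ ->] := d1|have [_ ->] := d2].
split => //; split.
  move=> t x; have [[d1 _] [d2 _]] := dt t x; have [[d3 _] [d4 _]] := dx t x.
  exact: (conj d1 (conj d2 (conj d3 d4))).
split; first exact: product_re_continuous.
split; first exact: product_im_continuous.
have -> : (fun p : R * R => cre (pt (fun t x : R => A t * B x) p.1 p.2)) = (fun p => cre (dA p.1 * B p.2)).
  by apply/funext => p; rewrite e1.
have -> : (fun p : R * R => cim (pt (fun t x : R => A t * B x) p.1 p.2)) = (fun p => cim (dA p.1 * B p.2)).
  by apply/funext => p; rewrite e1.
have -> : (fun p : R * R => cre (px (fun t x : R => A t * B x) p.1 p.2)) = (fun p => cre (A p.1 * dB p.2)).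
  by apply/funext => p; rewrite e2.
have -> : (fun p : R * R => cim (px (fun t x : R => A t * B x) p.1 p.2)) = (fun p => cim (A p.1 * dB p.2)).
  by apply/funext => p; rewrite e2.
split; first exact: product_re_continuous.
split; first exact: product_im_continuous.
split; first exact: product_re_continuous.
exact: product_im_continuous.
Qed.

Definition cexp (lam : C) (s : R) : C :=
  cmk (expR (cre lam * s) * cos (cim lam * s)) (expR (cre lam * s) * sin (cim lam * s)).

Lemma cexp_at0 lam : cexp lam 0 = 1.
Proof. by apply: complex_ext; rewrite !reimE !mulr0 expR0 ?cos0 ?sin0 mul1r. Qed.

Lemma cexp0 s : cexp 0 s = 1.
Proof. by apply: complex_ext; rewrite !reimE !mul0r expR0 ?cos0 ?sin0 mul1r. Qed.

Lemma cexpK lam s : cexp lam s * cexp (- lam) s = 1.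
Proof.
have E0 : expR (cre lam * s) != 0 by rewrite gt_eqF // expR_gt0.
apply: complex_ext; rewrite !reimE !mulNr expRN ?cosN ?sinN.
  by rewrite -[RHS](cos2Dsin2 (cim lam * s)); field.
by field.
Qed.

Lemma cderiv_cexp lam : cderiv (cexp lam) (fun s => lam * cexp lam s).
Proof.
move=> x; have de := is_derive_exp_comp (is_derive_mull (cre lam) x).
have dc := is_derive_cosM (cim lam) x; have ds := is_derive_sinM (cim lam) x.
split.
  have h := is_deriveM de dc; apply: is_derive_eq.
  by rewrite !reimE /GRing.scale /=; ring.
have h := is_deriveM de ds; apply: is_derive_eq.
by rewrite !reimE /GRing.scale /=; ring.
Qed.

(** The integral of [exp (- lam y)] over [[0, s]], with the case [lam = 0] written apart. *)
Definition eprim (lam : C) (s : R) : C :=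
  if lam == 0 then cmk s 0 else lam^-1 * (1 - cexp (- lam) s).

Lemma eprimE lam s : lam * eprim lam s + cexp (- lam) s = 1.
Proof.
rewrite /eprim; case: eqVneq => [->|l0]; first by rewrite mul0r oppr0 cexp0 add0r.
by rewrite mulVKf // subrK.
Qed.

Lemma eprim0 lam : eprim lam 0 = 0.
Proof. by rewrite /eprim; case: ifP => // _; rewrite cexp_at0 subrr mulr0. Qed.

Lemma cderiv_eprim lam : cderiv (eprim lam) (cexp (- lam)).
Proof.
case: (eqVneq lam 0) => [->|l0] x.
  rewrite oppr0 cexp0; split.
    rewrite (_ : (fun y => _) = id); last by apply/funext => y; rewrite /eprim eqxx.
    exact: is_derive_id.
  rewrite (_ : (fun y => _) = cst 0); last by apply/funext => y; rewrite /eprim eqxx.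
  exact: is_derive_cst.
have d1 : cderiv (fun s => 1 - cexp (- lam) s) (fun s => lam * cexp (- lam) s).
  move=> y; have [a b] := cderiv_cexp (- lam) y; split.
    have h := is_deriveB (is_derive_cst (1 : R) y (1 : R)) a.
    rewrite (_ : (fun y => _) = cst 1 - (fun y => cre (cexp (- lam) y))).
      by apply: is_derive_eq; rewrite sub0r -creN mulNr opprK.
    by apply/funext => s; rewrite creD creN cre1.
  have h := is_deriveB (is_derive_cst (0 : R) y (1 : R)) b.
  rewrite (_ : (fun y => _) = cst 0 - (fun y => cim (cexp (- lam) y))).
    by apply: is_derive_eq; rewrite sub0r -cimN mulNr opprK.
  by apply/funext => s; rewrite cimD cimN cim1.
have := cderivZ lam^-1 d1 x; rewrite mulKf //.
by have -> : eprim lam = (fun y => lam^-1 * (1 - cexp (- lam) y))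
  by apply/funext => y; rewrite /eprim (negbTE l0).
Qed.

Variables (L : R) (g : R -> C).
Hypotheses (L0 : 0 < L) (Hg : cL2 0 L g).

(* Eigenfunctions of the adjoint solve [z' = c - lam z], [z 0 = 0], hence are multiples of [eprim]. *)
Lemma adjoint_eigenfunction lam z : Astar_graph L g z (fun x => lam * z x) ->
  let c := cint `[0, L] (fun y => cconj (g y) * z y) in
  forall x, 0 <= x <= L -> z x = c * eprim lam x.
Proof.
move=> [w [wL2 [zE [z0 ae]]]] c.
have mw := cL2_cutc_cmeas wL2; have wL1 := cutc_cL1 wL2; have [_ wi] := wL1.
pose q x := c * eprim lam x.
have dq : cderiv q (fun x => c * cexp (- lam) x) by apply: cderivZ; exact: cderiv_eprim.
have cq := cderiv_continuous dq.
(* [z] is known on [[0, L]] only; [Z] agrees with it there and is bounded and measurable on the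
   line. *)
pose Z x := cint `[0, L] (fun y => if y <= proj0L L x then cutc 0 L w y else 0).
have mproj : measurable_fun setT (proj0L L).
  apply: continuous_measurable_fun => t; apply/cvgrPdist_lt => e e0; near=> s.
  apply: (le_lt_trans (proj0L_lip L0 t s)); near: s.
  exact: cvgr_dist_lt (@cvg_id _ _) e e0.
have zZ x : 0 <= x <= L -> z x = Z x.
  move=> xx; have /andP[x0 xL] := xx; rewrite zE // z0 add0r (@cint_sub _ _ 0 x 0 L) //.
  apply: eq_cint => y /=; rewrite in_itv /= => /andP[y0 yL].
  by rewrite y0 /= proj0L_id // cutcE ?y0.
have bZ : bm Z.
  have h : bm (fun t => cint `[0, L] (fun x => if x <= t then cutc 0 L w x else 0)) by exact: bm_left.
  exact: (bm_comp h mproj).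
have bq : bm (fun x => q (proj0L L x)).
  split; first by apply: (cmeas_comp (ccontinuous_cmeas cq)).
  have [M HM] := ccontinuous_bounded 0 L cq; exists M => x; apply: HM; exact: proj0L_in.
have bd := bmB bZ bq; have [M M0 HM] := bm_bound bd.
(* [Z] and [q] satisfy the same integral equation; Gronwall with constant [norm1 lam] identifies
   them. *)
have Zint x : 0 <= x <= L -> Z x = cint `[0, x] (fun y => c - lam * Z y).
  move=> xx; have /andP[x0 xL] := xx; rewrite -zZ // zE // z0 add0r.
  transitivity (cint `[0, x] (cutc 0 L w)).
    apply: eq_cint => y /=; rewrite in_itv /= => /andP[y0 yx].
    by rewrite cutcE // y0 (le_trans yx).
  apply: ae_eq_cint => //.
  - apply: (cL1S _ _ _ wL1) => //; apply: subset_itvl; by rewrite bnd_simp.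
  - exact: bm_cL1 (bmB (bm_cst c) (bmM (bm_cst lam) bZ)).
  - apply: (ae_imp ae) => y hy yin.
    have /andP[y0 yx] : 0 <= y <= x by move: yin; rewrite /= in_itv.
    have yL : 0 <= y <= L by rewrite y0 (le_trans yx).
    rewrite cutcE // -zZ // hy ?/(`[0, L]%classic y); first by rewrite -/c; ring.
    by rewrite /= in_itv.
have qint x : 0 <= x <= L -> q x = cint `[0, x] (fun y => c - lam * q (proj0L L y)).
  move=> xx; have /andP[x0 xL] := xx.
  transitivity (cint `[0, x] (fun y => c * cexp (- lam) y)).
    have [c1 c2] := ccontinuousZ c (cderiv_continuous (cderiv_cexp (- lam))).
    have -> : q x = q x - q 0 by rewrite {3}/q eprim0 mulr0 subr0.
    symmetry; apply: cint_FTC2 => //.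
    - by move=> y; have [] := dq y.
    - by move=> y; have [] := dq y.
  apply: eq_cint => y yin.
  have /andP[y0 yx] : 0 <= y <= x by move: yin; rewrite /= in_itv.
  rewrite proj0L_id ?y0 ?(le_trans yx) // /q.
  have e := eprimE lam y; have -> : cexp (- lam) y = 1 - lam * eprim lam y by rewrite -e; ring.
  ring.
move=> x xx; rewrite zZ // -/(q x); apply/eqP; rewrite -subr_eq0; apply/eqP.
apply: norm1_le0; rewrite -{2}(proj0L_id xx).
pose f y := norm1 (Z y - q (proj0L L y)).
suff h : f x = 0 by rewrite -/(f x) h.
apply: (@gronwall_zero _ f (norm1 lam) M L) => //.
- exact: measurable_norm1 (bm_cmeas bd).
- by move=> t _; rewrite norm1_ge0 HM.
move=> t tt; rewrite /f proj0L_id // Zint // qint // -cintB //; last 2 first.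
- exact: bm_cL1 (bmB (bm_cst c) (bmM (bm_cst lam) bZ)).
- exact: bm_cL1 (bmB (bm_cst c) (bmM (bm_cst lam) bq)).
have [_ fi] := bm_cL1 0 t bd.
rewrite -RintegralZl //; apply: norm1_cint_le => //.
- exact: bm_cmeas (bmB (bmB (bm_cst c) (bmM (bm_cst lam) bZ)) (bmB (bm_cst c) (bmM (bm_cst lam) bq))).
- exact: RintegrableZ.
- move=> y _.
  have -> : c - lam * Z y - (c - lam * q (proj0L L y)) = - (lam * (Z y - q (proj0L L y))) by ring.
  by rewrite norm1N; exact: norm1M.
Unshelve. all: by end_near. Qed.

(** The orthogonality is applied to the eigenfunction as its own target: steered from 0 to [z], the
    system ends in a state orthogonal to [z], so the integral of [cabs2] of [z] is 0. *)
Lemma controllable_unique_continuation lam : exactly_controllable L L g -> unique_continuation L g lam.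
Proof.
move=> EC z Az zL.
pose c := cint `[0, L] (fun y => cconj (g y) * z y).
have zE : forall x, 0 <= x <= L -> z x = c * eprim lam x := adjoint_eigenfunction Az.
(* [q] equals [z] on [[0, L]] and is smooth on the whole line, as [C1fun] requires of a test
   function. *)
pose q x := c * eprim lam x.
have dq : cderiv q (fun x => c * cexp (- lam) x) by apply: cderivZ; exact: cderiv_eprim.
have cq := cderiv_continuous dq; have mq := ccontinuous_cmeas cq.
have [M HM] := ccontinuous_bounded 0 L cq.
have LL : 0 <= L <= L by rewrite lexx ltW.
have qL : q L = 0 by rewrite /q -zE.
have qi : mu.-integrable `[0, L] (EFin \o (fun x => cabs2 (q x))).
  apply: (Rintegrable_le _ _ (integrable_cst_itv (M ^+ 2) 0 L)) => //.
    exact: measurable_cabs2.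
  move=> x /=; rewrite in_itv /= => xx; rewrite ger0_norm ?cabs2_ge0 //.
  apply: (le_trans (cabs2_le_norm1 _)).
  by apply: lerXn2r; rewrite ?nnegrE ?norm1_ge0 ?HM //; exact: le_trans (norm1_ge0 _) (HM x xx).
have qL2 : cL2 0 L q.
  by have [m1 m2] := mq; split; [exact: measurable_funTS|split => //; exact: measurable_funTS].
have zL2 : cL2 0 L (fun _ => 0 : C).
  split; first exact: measurable_cst.
  split; first exact: measurable_cst.
  rewrite (_ : (fun x => _) = (EFin \o (fun _ => 0))); first exact: integrable_cst_itv.
  by apply/funext => x /=; rewrite cabs2_0.
have [U [UL2 [[u wu] /(_ _ wu) uq]]] := EC _ _ zL2 qL2.
(* The time factor [exp (lam (L - t))], equal to 1 at the final time. *)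
pose A t := cexp lam L * cexp (- lam) t.
have dA : cderiv A (fun t => cexp lam L * (- lam * cexp (- lam) t)) by apply: cderivZ; exact: cderiv_cexp.
have cexpc : ccontinuous (cexp (- lam)) by exact: cderiv_continuous (cderiv_cexp _).
have [C1 ept epx] := product_C1 dA dq (ccontinuousZ _ (ccontinuousZ _ cexpc)) (ccontinuousZ _ cexpc).
have [[uL2 _] weq] := wu.
have phi0 t : 0 <= t <= L -> A t * q 0 = 0 by move=> _; rewrite /q eprim0 !mulr0.
have := weq L LL _ C1 phi0.
have qN x : 0 <= x <= L -> norm1 (q x) <= M by exact: HM.
have gq : cint `[0, L] (fun y => cconj (g y) * q y) = c.
  apply: eq_cint => y yin; have yy : 0 <= y <= L by move: yin; rewrite /= in_itv.
  by rewrite zE.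
have gqA a : cint `[0, L] (fun y => cconj (g y) * (a * q y)) = a * c.
  have h1 := adjoint_integral Hg mq qN.
  have mqa : cmeas (fun y => a * q y) by apply: cmeasM => //; exact: cmeas_cst.
  have h2 := @adjoint_integral _ L g Hg (fun y => a * q y) (norm1 a * M) mqa.
  rewrite -[LHS]cconjK h2; last first.
    move=> x xx; apply: (le_trans (norm1M _ _)); apply: ler_wpM2l; [exact: norm1_ge0|exact: HM].
  transitivity (cconj (cconj a * cint `[0, L] (fun y => gt L g y * cconj (q y)))).
    congr cconj; rewrite -cintZl //.
      by apply: eq_cint => y _; rewrite cconjM mulrCA.
    apply: (@cL1Mb _ _ _ _ M) => //; [exact: gt_cL1|exact: cmeas_conj|].
    move=> y yin; have yy : 0 <= y <= L by move: yin; rewrite /= in_itv.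
    by rewrite norm1_conj HM.
  by rewrite -h1 -cconjM cconjK gq.
have c00 : cconj (0 : C) = 0 by apply: complex_ext; rewrite !reimE ?oppr0.
(* The adjoint expression vanishes pointwise: it is [A t * c] times
   [lam * eprim lam x + cexp (- lam) x - 1], which is 0 by [eprimE]. *)
rewrite (_ : cint `[0, L] (fun t => cint `[0, L] _) = 0); last first.
  rewrite -[RHS](cint0 `[0, L]); apply: eq_cint => t _.
  rewrite -[RHS](cint0 `[0, L]); apply: eq_cint => x _.
  rewrite ept epx gqA.
  have -> : - (cexp lam L * (- lam * cexp (- lam) t) * q x) + A t * (c * cexp (- lam) x) - A t * c =
      A t * c * (lam * eprim lam x + cexp (- lam) x - 1) by rewrite /A /q; ring.
  by rewrite eprimE subrr mulr0 c00 mulr0.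
rewrite (_ : cint `[0, L] (fun x => 0 * _) = 0); last first.
  by rewrite -[RHS](cint0 `[0, L]); apply: eq_cint => x _; rewrite mul0r.
(* The control is invisible because the test function vanishes at [x = L]; this is where [z L = 0]
   enters. *)
rewrite (_ : cint `[0, L] (fun t => U t * _) = 0); last first.
  by rewrite -[RHS](cint0 `[0, L]); apply: eq_cint => t _; rewrite qL mulr0 c00 mulr0.
rewrite /A cexpK add0r !subr0 => E.
have uLL2 := uL2 L LL.
have {E} E : cint `[0, L] (fun x => q x * cconj (q x)) = 0.
  rewrite -[RHS]E; symmetry.
  transitivity (cint `[0, L] (fun x => cutc 0 L (u L) x * cconj (q x))).
    apply: eq_cint => x xin; have xx : 0 <= x <= L by move: xin; rewrite /= in_itv.
    by rewrite cutcE // mul1r.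
  have b x : `[0, L] x -> norm1 (cconj (q x)) <= M.
    move=> xin; have xx : 0 <= x <= L by move: xin; rewrite /= in_itv.
    by rewrite norm1_conj HM.
  apply: ae_eq_cint => //.
  - apply: (@cL1Mb _ _ _ _ M) => //; [exact: cutc_cL1|exact: cmeas_conj].
  - apply: (@cL1Mb _ _ _ _ M) => //; last exact: cmeas_conj.
    by apply: (@cL1_le _ _ _ (fun _ => M)) => //; exact: integrable_cst_itv.
  - apply: (ae_imp uq) => x hx xin.
    have xx : 0 <= x <= L by move: xin; rewrite /= in_itv.
    by rewrite cutcE // hx.
have {E} E : \int[mu]_(x in `[0, L]) cabs2 (q x) = 0.
  have E1 := congr1 cre E; rewrite cre_cint cre0 in E1; rewrite -[RHS]E1.
  have e (y : C) : cabs2 y = cre (y * cconj y) by rewrite !reimE /cabs2; ring.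
  by apply: eq_Rintegral => x _; rewrite e.
have E' : (\int[mu]_(x in `[0%R, L]) `|(cabs2 (q x))%:E| = 0)%E.
  have fi : (\int[mu]_(x in `[0%R, L]) (cabs2 (q x))%:E)%E \is a fin_num.
    by apply: integrable_fin_num => //; exact: qi.
  transitivity (\int[mu]_(x in `[0, L]) cabs2 (q x))%:E; last by rewrite E.
  rewrite /Rintegral fineK //.
  by apply: eq_integral => x _; rewrite /= ger0_norm // cabs2_ge0.
have m2 : measurable_fun `[0, L] (fun x => (cabs2 (q x))%:E).
  by apply/measurable_EFinP; apply: measurable_funTS; exact: measurable_cabs2.
have := (@ae_eq_integral_abs _ (measurableTypeR R) _ mu _ (measurable_itv `[0, L]%R) _ m2).1 E'.
move=> ae; apply: (ae_imp ae) => x hx xin.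
have xx : 0 <= x <= L by move: xin; rewrite /= in_itv.
have /= [] := hx xin; rewrite zE // -/(q x) => h.
apply: norm1_le0; have := norm1_le_cabs2 (q x); rewrite h mulr0 => h1.
have h2 : norm1 (q x) ^+ 2 = 0 by apply/le_anti; rewrite h1 sqr_ge0.
by move/eqP: h2; rewrite sqrf_eq0 => /eqP ->.
Qed.

End Necessity.

Theorem theorem2 (R : realType) (L : R) (g : R -> R[i]) :
  0 < L -> cL2 0 L g ->
  (exactly_controllable L L g <-> forall lam : R[i], unique_continuation L g lam).
Proof.
move=> L0 Hg; split => [EC lam|UC].
  exact: controllable_unique_continuation.
exact: unique_continuation_controllable.
Qed.
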